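(* Let $C$ be any tamely laced and indecomposable Cartan matrix such that the diagram $X'(C)$ is nonbipartite, and let $\ell\ge 2$ be an integer. Let $B$ be the skew-symmetric matrix corresponding to the quiver $Q_\ell(C)$ defined in the context. Then the ring $\mathcal{T}^{\circ}_{\ell}(C)$ is isomorphic to the T-subalgebra $\mathcal{A}_T(B,x)$, and the group $\mathcal{Y}^{\circ}_{\ell}(C)$ is isomorphic to the Y-subgroup $\mathcal{G}_Y(B,y)$.
   Context: **Cartan matrices.** $I=\{1,\dots,r\}$; $C=(C_{ij})_{i,j\in I}$ is an integer matrix with $C_{ii}=2$, $C_{ij}\le 0$ for $i\ne j$, $C_{ij}=0\iff C_{ji}=0$, and it is symmetrizable: there is $D=\mathrm{diag}(d_1,\dots,d_r)$, $d_i\in\mathbb{Z}_{>0}$, with $DC$ symmetric; the $d_i$ are taken without common divisor except 1. $C$ is *tamely laced* if moreover $C_{ij}<-1$ implies $d_i=-C_{ji}=1$. Write $a\sim b$ if $a\neq b$ and $C_{ab}<0$; $X(C)$ is the graph on $I$ with adjacency $\sim$ (the Dynkin diagram); $C$ is indecomposable if $X(C)$ is connected. If $a\sim b$ then $d_a=d_b$ or $\min(d_a,d_b)=1$. Put $t=\mathrm{lcm}(d_1,\dots,d_r)$, $t_a=t/d_a$, and $\mathcal{I}_\ell=\{(a,m,u)\mid a\in I,\ 1\le m\le t_a\ell-1,\ u\in\frac1t\mathbb{Z}\}$. **Even blocks, $X'(C)$.** An even block is a maximal connected full subdiagram of $X(C)$ all of whose vertices have $d_a$ even ($d_a$ is constant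 on it). $X'(C)$ is obtained from $X(C)$ by shrinking each even block to a single vertex, keeping all edges from the block to its outside. Bipartite means: no cycle of odd length. **T-system.** $\mathbb{T}_\ell(C)$ is the system of relations, for $(a,m,u)\in\mathcal{I}_\ell$, $$T^{(a)}_m(u-\tfrac{d_a}{t})T^{(a)}_m(u+\tfrac{d_a}{t})=T^{(a)}_{m-1}(u)T^{(a)}_{m+1}(u)+\begin{cases}\prod_{b\sim a}T^{(b)}_{d_am/d_b}(u)& d_a>1\\ \prod_{b\sim a}S^{(b)}_m(u)& d_a=1,\end{cases}$$ with $T^{(a)}_0(u)=T^{(a)}_{t_a\ell}(u)=1$, where for $m\ge0$, $0\le j<d_b$, $$S^{(b)}_{d_bm+j}(u)=\prod_{k=1}^{j}T^{(b)}_{m+1}(u+\tfrac{j+1-2k}{t})\ \prod_{k=1}^{d_b-j}T^{(b)}_m(u+\tfrac{d_b-j+1-2k}{t}).$$ $\mathcal{T}_\ell(C)$ is the commutative ring with generators $T^{(a)}_m(u)^{\pm1}$ ($(a,m,u)\in\mathcal{I}_\ell$) and relations $\mathbb{T}_\ell(C)$ (and $T^{(a)}_m(u)T^{(a)}_m(u)^{-1}=1$); $\mathcal{T}^\circ_\ell(C)$ is its subring generated by the $T^{(a)}_m(u)$. **Y-system.** A semifield is an abelian multiplicative group with a commutative, associative addition over which multiplication distributes. $\mathbb{Y}_\ell(C)$ is the system, for $(a,m,u)\in\mathcal{I}_\ell$, $$Y^{(a)}_m(u-\tfrac{d_a}{t})Y^{(a)}_m(u+\tfrac{d_a}{t})=\frac{N^{(a)}_m(u)}{(1+Y^{(a)}_{m-1}(u)^{-1})(1+Y^{(a)}_{m+1}(u)^{-1})},$$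 where $Y^{(a)}_0(u)^{-1}=Y^{(a)}_{t_a\ell}(u)^{-1}=0$ (the corresponding factor is 1); $N^{(a)}_m(u)=\prod_{b\sim a}Z^{(b)}_{d_a/d_b,m}(u)$ if $d_a>1$; $N^{(a)}_m(u)=\prod_{b\sim a,\ d_b\mid m}(1+Y^{(b)}_{m/d_b}(u))$ if $d_a=1$; and $Z^{(b)}_{p,m}(u)=\prod_{j=-p+1}^{p-1}\prod_{k=1}^{p-|j|}\bigl(1+Y^{(b)}_{pm+j}(u+\tfrac{p-|j|+1-2k}{t})\bigr)$. $\mathcal{Y}_\ell(C)$ is the semifield with generators $Y^{(a)}_m(u)$ and relations $\mathbb{Y}_\ell(C)$; $\mathcal{Y}^\circ_\ell(C)$ is the multiplicative subgroup generated by all $Y^{(a)}_m(u)$, $1+Y^{(a)}_m(u)$. **The diagram $\tilde X(C)$.** It is obtained by taking the bipartite double of $X'(C)$, restoring in it each even block (which appears twice) in place of its shrunk vertex, and replacing each restored nonbipartite even block by its bipartite double. Explicitly: its vertex set $J$ consists of $(a,\varepsilon)$, $\varepsilon\in\{+,-\}$, for each $a\in I$ not in a nonbipartite even block, and $(a,\varepsilon,\delta)$, $\varepsilon,\delta\in\{+,-\}$, for each $a\in I$ in a nonbipartite even block. Two vertices of $J$ with underlying $a,b\in I$ and second components $\varepsilon,\varepsilon'$ are adjacent ($\sim$) iff $a\sim b$ in $X(C)$ and: $\varepsilon\ne\varepsilon'$ when $d_a,d_b$ are both odd; $\varepsilon=\varepsilon'$ when at least one of $d_a,d_b$ is even; and,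 when $a,b$ lie in the same nonbipartite even block, also their third components $\delta,\delta'$ are different. Let $J_\pm$ be the set of vertices with second component $\varepsilon=\pm$. Each $v\in J$ inherits $d_v,t_v$ from its underlying vertex of $I$. Fix a colour $c_v\in\{\alpha,\beta\}$ for each $v\in J$ with $d_v$ even such that adjacent coloured vertices have different colours. Put $N_v=\{1,3,\dots,d_v-1\}$ if $v$ comes from a nonbipartite even block, and $N_v=\{1,2,\dots,d_v\}$ otherwise. **The quiver $Q_\ell(C)$.** Vertex set $\mathbf{I}=\{(v,i,m)\mid v\in J,\ i\in N_v,\ 1\le m\le t_v\ell-1\}$. Each vertex $(v,i,m)$ has a sign, which is $+$ exactly when: $i+m$ is even, if ($d_v$ odd, $v\in J_+$) or ($d_v$ even, $c_v=\beta$); $i+m$ is odd, if ($d_v$ odd, $v\in J_-$) or ($d_v$ even, $c_v=\alpha$). Otherwise the sign is $-$. The arrows (all of multiplicity one) are: (A1) between $(v,i,m)$ and $(v,i,m\pm1)$ (which have opposite signs), from the $+$ vertex to the $-$ vertex; (A2) if $v\sim w$ and $d_v=d_w$: between $(v,i,m)$ and $(w,i,m)$ (which have opposite signs), from the $-$ vertex to the $+$ vertex; (A3) if $v\sim w$, $d:=d_v>1$, $d_w=1$: $(v,i,m)$ and $(w,1,k)$ are joined iff $|k-dm|\le\rho(v,i,m)$, and then the arrow is $(v,i,m)\to(w,1,k)$ if $(w,1,k)$ has sign $+$, and $(w,1,k)\to(v,i,m)$ if $(w,1,k)$ has sign $-$. Here, with $i^*=i+1$ for $i$ odd and $i^*=i-1$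 for $i$ even, $\rho(v,i,m)$ is: – $d-i$ ($m$ odd), $i-1$ ($m$ even), if ($d$ odd, $v\in J_-$) or ($d$ even, $v\in J_+$, $c_v=\alpha$); – $i-1$ ($m$ odd), $d-i$ ($m$ even), if ($d$ odd, $v\in J_+$) or ($d$ even, $v\in J_+$, $c_v=\beta$); – $d-i^*$ ($m$ odd), $i^*-1$ ($m$ even), if $d$ even, $v\in J_-$, $c_v=\alpha$; – $i^*-1$ ($m$ odd), $d-i^*$ ($m$ even), if $d$ even, $v\in J_-$, $c_v=\beta$. $B=(B_{\mathbf{i}\mathbf{j}})$ is the skew-symmetric matrix with $B_{\mathbf{i}\mathbf{j}}=$ (number of arrows $\mathbf{i}\to\mathbf{j}$) $-$ (number of arrows $\mathbf{j}\to\mathbf{i}$). **Mutation sequence.** Let $\mathbf{I}^v_{\pm,i}$ be the set of vertices $(v,i,m)$ of sign $\pm$ (empty if $i\notin N_v$). For $v\in J$, $d=d_v$, $k\in\mathbb{Z}$, define $M_v(k/t)\subset\mathbf{I}$: – $d$ odd, $p\in\{0,\dots,2d-1\}$, $p\equiv k$ mod $2d$: $M_v(k/t)=\mathbf{I}^v_{+,p+1}$ ($p<d$ even), $\mathbf{I}^v_{+,d-p}$ ($p<d$ odd), $\mathbf{I}^v_{-,2d-p}$ ($p\ge d$ even), $\mathbf{I}^v_{-,p+1-d}$ ($p\ge d$ odd); – $d$ even, with $p\in\{0,\dots,2d-1\}$, $p\equiv k$ mod $2d$ if $v\in J_+$, and $p\equiv k-1$ mod $2d$ if $v\in J_-$: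 $M_v(k/t)=\mathbf{I}^v_{+,p+1}\sqcup\mathbf{I}^v_{+,d-p}$ ($p<d$ even), $\mathbf{I}^v_{-,p+1-d}\sqcup\mathbf{I}^v_{-,2d-p}$ ($p\ge d$ even), $\emptyset$ ($p$ odd). Let $M(u)=\bigsqcup_vM_v(u)$ and let $\mu(u)$ be the composition of the mutations at all vertices of $M(u)$ (the order is immaterial). **Cluster algebra conventions.** $x=(x_{\mathbf i})$, $y=(y_{\mathbf i})$ are tuples of formal variables; $\mathbb{P}=\mathbb{Q}_{\mathrm{sf}}(y)$ is the universal semifield of subtraction-free rational functions in $y$, with addition $\oplus$ (also written $+$ in expressions $1+y$). The mutation at $k$ sends $(B',x',y')$ to $(B'',x'',y'')$, where $B''_{ij}=-B'_{ij}$ if $k\in\{i,j\}$ and $B''_{ij}=B'_{ij}+\frac12(|B'_{ik}|B'_{kj}+B'_{ik}|B'_{kj}|)$ otherwise; $y''_k=y_k'^{-1}$, and for $i\ne k$, $y''_i=y'_i\bigl(\frac{y'_k}{1\oplus y'_k}\bigr)^{B'_{ki}}$ if $B'_{ki}\ge0$, $y''_i=y'_i(1\oplus y'_k)^{-B'_{ki}}$ if $B'_{ki}\le0$; $x''_i=x'_i$ for $i\neq k$ and $x''_k=\frac{y'_k\prod_{B'_{jk}>0}x_j'^{B'_{jk}}+\prod_{B'_{jk}<0}x_j'^{-B'_{jk}}}{(1\oplus y'_k)x'_k}$. Set $(B(0),x(0),y(0))=(B,x,y)$ and define $(B(u),x(u),y(u))$ for $u\in\frac1t\mathbb{Z}$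 by $(B(u+\frac1t),x(u+\frac1t),y(u+\frac1t))=\mu(u)(B(u),x(u),y(u))$ (mutations are involutions, so this also defines negative $u$). $[x_{\mathbf i}(u)]_{\mathbf 1}$ is the trivial evaluation of $x_{\mathbf i}(u)$: the element of the cluster algebra $\mathcal{A}(B,x)$ with trivial coefficients obtained by the same mutations with all coefficients in the trivial semifield $\{1\}$. $\mathcal{A}_T(B,x)$ is the subring of $\mathcal{A}(B,x)$ generated by all $[x_{\mathbf i}(u)]_{\mathbf 1}$ ($\mathbf i\in\mathbf I$, $u\in\frac1t\mathbb{Z}$). $\mathcal{G}_Y(B,y)$ is the multiplicative subgroup of $\mathbb{P}$ generated by all $y_{\mathbf i}(u)$ ($\mathbf i\in\mathbf I,u\in\frac1t\mathbb{Z}$) and by $1+y_{\mathbf i}(u)$ for those $(\mathbf i,u)$ with $\mathbf i\in M(u)$ or $\mathbf i\in M(u-\frac1t)$. *)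

(* Defs.v *)
From HB Require Import structures.
From mathcomp Require Import all_boot all_order all_algebra.
From mathcomp Require Import generic_quotient boolp.
From mathcomp Require Import mpoly.

Set Implicit Arguments.
Unset Strict Implicit.
Unset Printing Implicit Defensive.

Import Order.TTheory GRing.Theory Num.Theory.

Local Open Scope ring_scope.
Local Open Scope quotient_scope.

Delimit Scope presring_scope with rx.
Delimit Scope pressf_scope with sx.

(* The commutative ring with generators G and relations x = y for E x y is the
   quotient of ring expressions by the congruence [req] below. *)
Inductive rexpr (G : Type) : Type :=
| RGen of G
| RZero
| ROne
| RAdd of rexpr G & rexpr G
| ROpp of rexpr G
| RMul of rexpr G & rexpr G.

Arguments RZero {G}.
Arguments ROne {G}.
Bind Scope presring_scope with rexpr.

Notation "1" := ROne : presring_scope.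
Notation "x + y" := (RAdd x%rx y%rx) : presring_scope.
Notation "x * y" := (RMul x%rx y%rx) : presring_scope.

HB.instance Definition _ G := gen_eqMixin (rexpr G).
HB.instance Definition _ G := gen_choiceMixin (rexpr G).

Section PresentedRing.
Variables (G : Type) (E : rexpr G -> rexpr G -> Prop).
Implicit Types x y z : rexpr G.

Inductive req : rexpr G -> rexpr G -> Prop :=
| req_rel x y : E x y -> req x y
| req_refl x : req x x
| req_sym x y : req x y -> req y x
| req_trans y x z : req x y -> req y z -> req x z
| req_add x x' y y' : req x x' -> req y y' -> req (RAdd x y) (RAdd x' y')
| req_opp x x' : req x x' -> req (ROpp x) (ROpp x')
| req_mul x x' y y' : req x x' -> req y y' -> req (RMul x y) (RMul x' y')
| req_addA x y z : req (RAdd x (RAdd y z)) (RAdd (RAdd x y) z)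
| req_addC x y : req (RAdd x y) (RAdd y x)
| req_add0 x : req (RAdd RZero x) x
| req_addN x : req (RAdd (ROpp x) x) RZero
| req_mulA x y z : req (RMul x (RMul y z)) (RMul (RMul x y) z)
| req_mulC x y : req (RMul x y) (RMul y x)
| req_mul1 x : req (RMul ROne x) x
| req_mulDl x y z : req (RMul (RAdd x y) z) (RAdd (RMul x z) (RMul y z)).

Definition reqb : rel (rexpr G) := fun x y => `[< req x y >].

Lemma reqb_refl : reflexive reqb.
Proof. by move=> x; apply/asboolP/req_refl. Qed.

Lemma reqb_sym : ssrbool.symmetric reqb.
Proof. by move=> x y; apply/asboolP/asboolP; apply: req_sym. Qed.

Lemma reqb_trans : transitive reqb.
Proof.
by move=> y x z /asboolP xy /asboolP yz; apply/asboolP; apply: req_trans xy yz.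
Qed.

Canonical req_equiv := EquivRel reqb reqb_refl reqb_sym reqb_trans.

Definition presring := {eq_quot req_equiv}.
HB.instance Definition _ : EqQuotient _ req_equiv presring :=
  EqQuotient.on presring.
HB.instance Definition _ := Choice.on presring.

Local Notation cls x := (\pi_presring x).

Lemma presringP x y : cls x = cls y <-> req x y.
Proof.
split; first by move=> /eqmodP /asboolP.
by move=> xy; apply/eqmodP/asboolP.
Qed.

Lemma req_repr x : req (repr (cls x)) x.
Proof. by apply/presringP; rewrite reprK. Qed.

Definition pr_add (x y : presring) : presring := cls (RAdd (repr x) (repr y)).
Definition pr_opp (x : presring) : presring := cls (ROpp (repr x)).
Definition pr_mul (x y : presring) : presring := cls (RMul (repr x) (repr y)).

Lemma pr_addE x y : pr_add (cls x) (cls y) = cls (RAdd x y).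
Proof. by apply/presringP/req_add; apply: req_repr. Qed.

Lemma pr_oppE x : pr_opp (cls x) = cls (ROpp x).
Proof. by apply/presringP/req_opp; apply: req_repr. Qed.

Lemma pr_mulE x y : pr_mul (cls x) (cls y) = cls (RMul x y).
Proof. by apply/presringP/req_mul; apply: req_repr. Qed.

Lemma pr_addA : associative pr_add.
Proof.
elim/quotW=> x; elim/quotW=> y; elim/quotW=> z.
rewrite (pr_addE y z) (pr_addE x y) (pr_addE x) (pr_addE _ z).
exact/presringP/req_addA.
Qed.

Lemma pr_addC : commutative pr_add.
Proof.
by elim/quotW=> x; elim/quotW=> y; rewrite (pr_addE x y) (pr_addE y x); apply/presringP/req_addC.
Qed.

Lemma pr_add0 : left_id (cls RZero) pr_add.
Proof. by elim/quotW=> x; rewrite pr_addE; apply/presringP/req_add0. Qed.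

Lemma pr_addN : left_inverse (cls RZero) pr_opp pr_add.
Proof.
by elim/quotW=> x; rewrite pr_oppE pr_addE; apply/presringP/req_addN.
Qed.

Lemma pr_mulA : associative pr_mul.
Proof.
elim/quotW=> x; elim/quotW=> y; elim/quotW=> z.
rewrite (pr_mulE y z) (pr_mulE x y) (pr_mulE x) (pr_mulE _ z).
exact/presringP/req_mulA.
Qed.

Lemma pr_mulC : commutative pr_mul.
Proof.
by elim/quotW=> x; elim/quotW=> y; rewrite (pr_mulE x y) (pr_mulE y x); apply/presringP/req_mulC.
Qed.

Lemma pr_mul1 : left_id (cls ROne) pr_mul.
Proof. by elim/quotW=> x; rewrite pr_mulE; apply/presringP/req_mul1. Qed.

Lemma pr_mulDl : left_distributive pr_mul pr_add.
Proof.
elim/quotW=> x; elim/quotW=> y; elim/quotW=> z.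
rewrite (pr_addE x y) (pr_mulE _ z) (pr_mulE x z) (pr_mulE y z) pr_addE.
exact/presringP/req_mulDl.
Qed.

HB.instance Definition _ :=
  GRing.isZmodule.Build presring pr_addA pr_addC pr_add0 pr_addN.
HB.instance Definition _ :=
  GRing.Zmodule_isComPzRing.Build presring pr_mulA pr_mulC pr_mul1 pr_mulDl.

Definition pres_gen (g : G) : presring := cls (RGen g).

Fixpoint reval (R : comPzRingType) (f : G -> R) x : R :=
  match x with
  | RGen g => f g
  | RZero => 0
  | ROne => 1
  | RAdd x y => reval f x + reval f y
  | ROpp x => - reval f x
  | RMul x y => reval f x * reval f y
  end.

Lemma presring_eval x : reval pres_gen x = cls x.
Proof.
elim: x => [g|||x IHx y IHy|x IHx|x IHx y IHy] //=.
- by rewrite IHx IHy; apply: pr_addE.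
- by rewrite IHx; apply: pr_oppE.
- by rewrite IHx IHy; apply: pr_mulE.
Qed.

Lemma presring_rel x y :
  E x y -> reval pres_gen x = reval pres_gen y.
Proof. by move=> xy; rewrite !presring_eval; apply/presringP/req_rel. Qed.

Lemma presring_univ (R : comPzRingType) (f : G -> R) :
    (forall x y, E x y -> reval f x = reval f y) ->
  exists! h : presring -> R, [/\ h 1 = 1, {morph h : x y / x + y},
    {morph h : x y / x * y} & forall g, h (pres_gen g) = f g].
Proof.
move=> fE.
have ev x y : req x y -> reval f x = reval f y.
  elim=> //= *; try congruence.
  - exact: addrA.
  - exact: addrC.
  - exact: add0r.
  - exact: addNr.
  - exact: mulrA.
  - exact: mulrC.
  - exact: mul1r.
  - exact: mulrDl.
pose h (x : presring) := reval f (repr x).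
have hE x : h (cls x) = reval f x by apply/ev/req_repr.
exists h; split; first split.
- exact: hE ROne.
- elim/quotW=> x; elim/quotW=> y.
  by rewrite [cls x + cls y]pr_addE !hE.
- elim/quotW=> x; elim/quotW=> y.
  by rewrite [cls x * cls y]pr_mulE !hE.
- by move=> g; apply: hE.
move=> h' [h1 hD hM hg]; apply/funext; elim/quotW=> x; rewrite hE.
have h0 : h' 0 = 0 by apply: (addrI (h' 0)); rewrite -hD !addr0.
rewrite -[cls x]presring_eval.
elim: x => [g|||x IHx y IHy|x IHx|x IHx y IHy] //=.
- by rewrite hD IHx IHy.
- by apply: (addrI (reval f x)); rewrite subrr IHx -hD subrr h0.
- by rewrite hM IHx IHy.
Qed.

End PresentedRing.

Section GeneratedSubring.
Variables (R : comPzRingType) (S : R -> Prop).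

Inductive in_subring : R -> Prop :=
| in_subring_gen x : S x -> in_subring x
| in_subring_one : in_subring 1
| in_subring_sub x y : in_subring x -> in_subring y -> in_subring (x - y)
| in_subring_mul x y : in_subring x -> in_subring y -> in_subring (x * y).

Definition subring_pred : {pred R} := fun x => `[< in_subring x >].

Lemma subring_pred_closed : subring_closed subring_pred.
Proof.
split; first exact/asboolP/in_subring_one.
- by move=> x y /asboolP x_in /asboolP y_in; apply/asboolP/in_subring_sub.
- by move=> x y /asboolP x_in /asboolP y_in; apply/asboolP/in_subring_mul.
Qed.

Definition gen_subring := {x : R | x \in subring_pred}.
HB.instance Definition _ := SubChoice.on gen_subring.
HB.instance Definition _ :=
  GRing.SubChoice_isSubComPzRing.Build R subring_pred gen_subring
    subring_pred_closed.

End GeneratedSubring.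

Section GeneratedSubgroup.
Variables (G : groupType) (S : G -> Prop).
Local Open Scope group_scope.

Inductive in_subgroup : G -> Prop :=
| in_subgroup_gen x : S x -> in_subgroup x
| in_subgroup_one : in_subgroup 1
| in_subgroup_div x y : in_subgroup x -> in_subgroup y -> in_subgroup (x / y).

Definition subgroup_pred : {pred G} := fun x => `[< in_subgroup x >].

Lemma subgroup_pred_closed : group_closed subgroup_pred.
Proof.
split; first exact/asboolP/in_subgroup_one.
by move=> x y /asboolP x_in /asboolP y_in; apply/asboolP/in_subgroup_div.
Qed.

Definition gen_subgroup := {x : G | x \in subgroup_pred}.
HB.instance Definition _ := SubChoice.on gen_subgroup.
HB.instance Definition _ :=
  SubChoice_isSubGroup.Build G subgroup_pred gen_subgroup subgroup_pred_closed.

End GeneratedSubgroup.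

Definition ring_isomorphic (R S : comPzRingType) : Prop :=
  exists f : {rmorphism R -> S}, bijective f.

Definition group_isomorphic (G H : groupType) : Prop :=
  exists f : {multiplicative G -> H}, bijective f.

HB.mixin Record Group_isSemifield S of monoid.Group S := {
  sfadd : S -> S -> S;
  sfmulC : commutative (@monoid.mul S);
  sfaddA : associative sfadd;
  sfaddC : commutative sfadd;
  sfmulDl : left_distributive (@monoid.mul S) sfadd
}.

#[short(type="semifieldType")]
HB.structure Definition Semifield :=
  {S of monoid.Group S & Group_isSemifield S}.

Inductive sexpr (G : Type) : Type :=
| SGen of G
| SOne
| SMul of sexpr G & sexpr G
| SInv of sexpr G
| SAdd of sexpr G & sexpr G.

Arguments SOne {G}.
Bind Scope pressf_scope with sexpr.

Notation "1" := SOne : pressf_scope.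
Notation "x * y" := (SMul x%sx y%sx) : pressf_scope.
Notation "x ^-1" := (SInv x%sx) : pressf_scope.
Notation "x / y" := (SMul x%sx (SInv y%sx)) : pressf_scope.
Notation "x + y" := (SAdd x%sx y%sx) : pressf_scope.

HB.instance Definition _ G := gen_eqMixin (sexpr G).
HB.instance Definition _ G := gen_choiceMixin (sexpr G).

Section PresentedSemifield.
Variables (G : Type) (E : sexpr G -> sexpr G -> Prop).
Implicit Types x y z : sexpr G.

Inductive sfeq : sexpr G -> sexpr G -> Prop :=
| sfeq_rel x y : E x y -> sfeq x y
| sfeq_refl x : sfeq x x
| sfeq_sym x y : sfeq x y -> sfeq y x
| sfeq_trans y x z : sfeq x y -> sfeq y z -> sfeq x z
| sfeq_mul x x' y y' : sfeq x x' -> sfeq y y' -> sfeq (SMul x y) (SMul x' y')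
| sfeq_inv x x' : sfeq x x' -> sfeq (SInv x) (SInv x')
| sfeq_add x x' y y' : sfeq x x' -> sfeq y y' -> sfeq (SAdd x y) (SAdd x' y')
| sfeq_mulA x y z : sfeq (SMul x (SMul y z)) (SMul (SMul x y) z)
| sfeq_mulC x y : sfeq (SMul x y) (SMul y x)
| sfeq_mul1 x : sfeq (SMul SOne x) x
| sfeq_mulV x : sfeq (SMul (SInv x) x) SOne
| sfeq_addA x y z : sfeq (SAdd x (SAdd y z)) (SAdd (SAdd x y) z)
| sfeq_addC x y : sfeq (SAdd x y) (SAdd y x)
| sfeq_mulDl x y z : sfeq (SMul (SAdd x y) z) (SAdd (SMul x z) (SMul y z)).

Definition sfeqb : rel (sexpr G) := fun x y => `[< sfeq x y >].

Lemma sfeqb_refl : reflexive sfeqb.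
Proof. by move=> x; apply/asboolP/sfeq_refl. Qed.

Lemma sfeqb_sym : ssrbool.symmetric sfeqb.
Proof. by move=> x y; apply/asboolP/asboolP; apply: sfeq_sym. Qed.

Lemma sfeqb_trans : transitive sfeqb.
Proof.
by move=> y x z /asboolP xy /asboolP yz; apply/asboolP; apply: sfeq_trans xy yz.
Qed.

Canonical sfeq_equiv := EquivRel sfeqb sfeqb_refl sfeqb_sym sfeqb_trans.

Definition pressf := {eq_quot sfeq_equiv}.
HB.instance Definition _ : EqQuotient _ sfeq_equiv pressf :=
  EqQuotient.on pressf.
HB.instance Definition _ := Choice.on pressf.

Local Notation cls x := (\pi_pressf x).

Lemma pressfP x y : cls x = cls y <-> sfeq x y.
Proof.
split; first by move=> /eqmodP /asboolP.
by move=> xy; apply/eqmodP/asboolP.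
Qed.

Lemma sfeq_repr x : sfeq (repr (cls x)) x.
Proof. by apply/pressfP; rewrite reprK. Qed.

Definition ps_mul (x y : pressf) : pressf := cls (SMul (repr x) (repr y)).
Definition ps_inv (x : pressf) : pressf := cls (SInv (repr x)).
Definition ps_add (x y : pressf) : pressf := cls (SAdd (repr x) (repr y)).

Lemma ps_mulE x y : ps_mul (cls x) (cls y) = cls (SMul x y).
Proof. by apply/pressfP/sfeq_mul; apply: sfeq_repr. Qed.

Lemma ps_invE x : ps_inv (cls x) = cls (SInv x).
Proof. by apply/pressfP/sfeq_inv; apply: sfeq_repr. Qed.

Lemma ps_addE x y : ps_add (cls x) (cls y) = cls (SAdd x y).
Proof. by apply/pressfP/sfeq_add; apply: sfeq_repr. Qed.

Lemma ps_mulA : associative ps_mul.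
Proof.
elim/quotW=> x; elim/quotW=> y; elim/quotW=> z.
rewrite (ps_mulE y z) (ps_mulE x y) (ps_mulE x) (ps_mulE _ z).
exact/pressfP/sfeq_mulA.
Qed.

Lemma ps_mulC : commutative ps_mul.
Proof.
elim/quotW=> x; elim/quotW=> y.
by rewrite (ps_mulE x y) (ps_mulE y x); apply/pressfP/sfeq_mulC.
Qed.

Lemma ps_mul1 : left_id (cls SOne) ps_mul.
Proof. by elim/quotW=> x; rewrite ps_mulE; apply/pressfP/sfeq_mul1. Qed.

Lemma ps_mulr1 : right_id (cls SOne) ps_mul.
Proof. by move=> x; rewrite ps_mulC ps_mul1. Qed.

Lemma ps_mulV : left_inverse (cls SOne) ps_inv ps_mul.
Proof.
by elim/quotW=> x; rewrite ps_invE ps_mulE; apply/pressfP/sfeq_mulV.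
Qed.

Lemma ps_mulrV : right_inverse (cls SOne) ps_inv ps_mul.
Proof. by move=> x; rewrite ps_mulC ps_mulV. Qed.

Lemma ps_addA : associative ps_add.
Proof.
elim/quotW=> x; elim/quotW=> y; elim/quotW=> z.
rewrite (ps_addE y z) (ps_addE x y) (ps_addE x) (ps_addE _ z).
exact/pressfP/sfeq_addA.
Qed.

Lemma ps_addC : commutative ps_add.
Proof.
elim/quotW=> x; elim/quotW=> y.
by rewrite (ps_addE x y) (ps_addE y x); apply/pressfP/sfeq_addC.
Qed.

Lemma ps_mulDl : left_distributive ps_mul ps_add.
Proof.
elim/quotW=> x; elim/quotW=> y; elim/quotW=> z.
rewrite (ps_addE x y) (ps_mulE _ z) (ps_mulE x z) (ps_mulE y z) ps_addE.
exact/pressfP/sfeq_mulDl.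
Qed.

HB.instance Definition _ :=
  isGroup.Build pressf ps_mulA ps_mul1 ps_mulr1 ps_mulV ps_mulrV.
HB.instance Definition _ :=
  Group_isSemifield.Build pressf ps_mulC ps_addA ps_addC ps_mulDl.

Definition pressf_gen (g : G) : pressf := cls (SGen g).

Fixpoint seval (P : semifieldType) (f : G -> P) x : P :=
  match x with
  | SGen g => f g
  | SOne => 1%g
  | SMul x y => (seval f x * seval f y)%g
  | SInv x => ((seval f x)^-1)%g
  | SAdd x y => sfadd (seval f x) (seval f y)
  end.

Lemma pressf_eval x : seval pressf_gen x = cls x.
Proof.
elim: x => [g||x IHx y IHy|x IHx|x IHx y IHy] //=.
- by rewrite IHx IHy; apply: ps_mulE.
- by rewrite IHx; apply: ps_invE.
- by rewrite IHx IHy; apply: ps_addE.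
Qed.

Lemma pressf_rel x y : E x y -> seval pressf_gen x = seval pressf_gen y.
Proof. by move=> xy; rewrite !pressf_eval; apply/pressfP/sfeq_rel. Qed.

Lemma pressf_univ (P : semifieldType) (f : G -> P) :
    (forall x y, E x y -> seval f x = seval f y) ->
  exists! h : pressf -> P, [/\ {morph h : x y / (x * y)%g},
    {morph h : x y / sfadd x y} & forall g, h (pressf_gen g) = f g].
Proof.
move=> fE.
have ev x y : sfeq x y -> seval f x = seval f y.
  elim=> //= *; try congruence.
  - exact: mulgA.
  - exact: sfmulC.
  - exact: mul1g.
  - exact: mulVg.
  - exact: sfaddA.
  - exact: sfaddC.
  - exact: sfmulDl.
pose h (x : pressf) := seval f (repr x).
have hE x : h (cls x) = seval f x by apply/ev/sfeq_repr.
exists h; split; first split.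
- elim/quotW=> x; elim/quotW=> y.
  by rewrite [(cls x * cls y)%g]ps_mulE !hE.
- elim/quotW=> x; elim/quotW=> y.
  by rewrite [sfadd _ _]ps_addE !hE.
- by move=> g; apply: hE.
move=> h' [hM hD hg]; apply/funext; elim/quotW=> x; rewrite hE.
have h1 : h' 1%g = 1%g by apply: (mulgI (h' 1%g)); rewrite -hM !mulg1.
rewrite -[cls x]pressf_eval.
elim: x => [g||x IHx y IHy|x IHx|x IHx y IHy] //=.
- by rewrite hM IHx IHy.
- by apply: (mulgI (seval f x)); rewrite mulgV IHx -hM mulgV h1.
- by rewrite hD IHx IHy.
Qed.

End PresentedSemifield.

Section RationalFunctions.
Variable V : finType.

Definition ratfun := {fraction {mpoly rat[#|V|]}}.

Definition ratvar (v : V) : ratfun := tofrac 'X_(enum_rank v).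

Inductive subtraction_free : ratfun -> Prop :=
| sf_var v : subtraction_free (ratvar v)
| sf_one : subtraction_free 1
| sf_add f g :
    subtraction_free f -> subtraction_free g -> subtraction_free (f + g)
| sf_mul f g :
    subtraction_free f -> subtraction_free g -> subtraction_free (f * g)
| sf_div f g :
    subtraction_free f -> subtraction_free g -> subtraction_free (f / g).

Lemma subtraction_free_neq0 f : subtraction_free f -> f != 0.
Proof.
pose ev (p : {mpoly rat[#|V|]}) := p.@[fun=> 1].
have ev0 p : 0 < ev p -> tofrac p != 0 :> ratfun.
  by apply: contraTneq => /eqP; rewrite tofrac_eq0 => /eqP->; rewrite /ev meval0.
suff pos : subtraction_free f ->
    exists p q, [/\ 0 < ev p, 0 < ev q & f = tofrac p / tofrac q].
  by move=> /pos [p [q [p0 q0 ->]]]; rewrite mulf_neq0 ?invr_eq0 ?ev0.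
elim=> {f} [v||f g _ [p [q [p0 q0 ->]]] _ [p' [q' [p'0 q'0 ->]]]
  |f g _ [p [q [p0 q0 ->]]] _ [p' [q' [p'0 q'0 ->]]]
  |f g _ [p [q [p0 q0 ->]]] _ [p' [q' [p'0 q'0 ->]]]].
- exists 'X_(enum_rank v), 1; rewrite /ev mevalXU meval1 ltr01.
  by rewrite rmorph1 divr1.
- by exists 1, 1; rewrite /ev meval1 ltr01 rmorph1 divr1.
- exists (p * q' + p' * q), (q * q').
  rewrite /ev mevalD !mevalM addr_gt0 ?mulr_gt0 //; split=> //.
  by rewrite addf_div ?ev0 // rmorphD !rmorphM.
- exists (p * p'), (q * q'); rewrite /ev !mevalM !mulr_gt0 //; split=> //.
  by rewrite mulf_div !rmorphM.
- exists (p * q'), (q * p'); rewrite /ev !mevalM !mulr_gt0 //; split=> //.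
  by rewrite invf_div mulf_div !rmorphM.
Qed.

Definition usf_pred : {pred ratfun} := fun f => `[< subtraction_free f >].
Definition usf := {f : ratfun | f \in usf_pred}.
HB.instance Definition _ := SubChoice.on usf.

Lemma usf_free (f : usf) : subtraction_free (val f).
Proof. exact/asboolP/(valP f). Qed.

Definition Usf f (hf : subtraction_free f) : usf := exist _ f (asboolT hf).

Definition usf_mul (f g : usf) := Usf (sf_mul (usf_free f) (usf_free g)).
Definition usf_add (f g : usf) := Usf (sf_add (usf_free f) (usf_free g)).
Definition usf_inv (f : usf) := Usf (sf_div sf_one (usf_free f)).

Lemma usf_mulA : associative usf_mul.
Proof. by move=> f g h; apply/val_inj; rewrite /= mulrA. Qed.

Lemma usf_mulC : commutative usf_mul.
Proof. by move=> f g; apply/val_inj; rewrite /= mulrC. Qed.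

Lemma usf_mul1 : left_id (Usf sf_one) usf_mul.
Proof. by move=> f; apply/val_inj; rewrite /= mul1r. Qed.

Lemma usf_mulr1 : right_id (Usf sf_one) usf_mul.
Proof. by move=> f; rewrite usf_mulC usf_mul1. Qed.

Lemma usf_mulV : left_inverse (Usf sf_one) usf_inv usf_mul.
Proof.
move=> f; apply/val_inj; rewrite /= mulrAC mul1r divff //.
exact/subtraction_free_neq0/usf_free.
Qed.

Lemma usf_mulrV : right_inverse (Usf sf_one) usf_inv usf_mul.
Proof. by move=> f; rewrite usf_mulC usf_mulV. Qed.

Lemma usf_addA : associative usf_add.
Proof. by move=> f g h; apply/val_inj; rewrite /= addrA. Qed.

Lemma usf_addC : commutative usf_add.
Proof. by move=> f g; apply/val_inj; rewrite /= addrC. Qed.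

Lemma usf_mulDl : left_distributive usf_mul usf_add.
Proof. by move=> f g h; apply/val_inj; rewrite /= mulrDl. Qed.

HB.instance Definition _ :=
  isGroup.Build usf usf_mulA usf_mul1 usf_mulr1 usf_mulV usf_mulrV.
HB.instance Definition _ :=
  Group_isSemifield.Build usf usf_mulC usf_addA usf_addC usf_mulDl.

Definition usf_var (v : V) : usf := Usf (sf_var v).

End RationalFunctions.

Section Mutation.
Variable V : finType.
Implicit Types (B : V -> V -> int) (k i j : V).

(* The sum divided by 2 is always even. *)
Definition mut_B k B : V -> V -> int := fun i j =>
  if (i == k) || (j == k) then - B i j
  else B i j + ((`|B i k| * B k j + B i k * `|B k j|) %/ 2)%Z.

Definition mut_y (P : semifieldType) k B (y : V -> P) : V -> P := fun i =>
  if i == k then ((y k)^-1)%g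
  else if 0 <= B k i then (y i * (y k / sfadd 1 (y k)) ^+ `|B k i|%N)%g
  else (y i * sfadd 1 (y k) ^+ `|B k i|%N)%g.

(* The exchange relation with all coefficients in the trivial semifield {1},
   where both y_k and 1 (+) y_k are 1. *)
Definition mut_x (F : fieldType) k B (x : V -> F) : V -> F := fun i =>
  if i == k then
    (\prod_(j | 0 < B j k) x j ^+ `|B j k|%N
     + \prod_(j | B j k < 0) x j ^+ `|B j k|%N) / x k
  else x i.

Definition xseed (F : fieldType) := ((V -> V -> int) * (V -> F))%type.
Definition yseed (P : semifieldType) := ((V -> V -> int) * (V -> P))%type.

Definition mut_xseed F (s : xseed F) k : xseed F :=
  (mut_B k s.1, mut_x k s.1 s.2).
Definition mut_yseed P (s : yseed P) k : yseed P :=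
  (mut_B k s.1, mut_y k s.1 s.2).

(* The integer k stands for the time u = k/t; [M k] lists the vertices at which
   one mutates between the times k and k + 1, in the order of [enum].  Mutations
   being involutive, the step from -n to -n - 1 inverts the one from -n - 1 to
   -n by mutating at the same vertices in the reverse order. *)
Section Evolution.
Variables (S : Type) (mut : S -> V -> S) (M : int -> {set V}) (s0 : S).

Fixpoint forward n : S :=
  if n is n'.+1 then foldl mut (forward n') (enum (M n'%:Z)) else s0.

Fixpoint backward n : S :=
  if n is n'.+1 then foldl mut (backward n') (rev (enum (M (- n%:Z)))) else s0.

Definition evolve (k : int) : S :=
  match k with Posz n => forward n | Negz n => backward n.+1 end.

End Evolution.

Definition x_at B (M : int -> {set V}) (k : int) : V -> ratfun V :=
  (evolve (@mut_xseed (ratfun V)) M (B, @ratvar V) k).2.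

Definition y_at B (M : int -> {set V}) (k : int) : V -> usf V :=
  (evolve (@mut_yseed (usf V)) M (B, @usf_var V) k).2.

(* The cluster algebra A(B,x) with trivial coefficients is a subring of the
   field of rational functions in x, which contains all cluster variables. *)
Definition T_subalgebra B (M : int -> {set V}) : comPzRingType :=
  gen_subring (fun z : ratfun V => exists (k : int) i, z = x_at B M k i).

Definition Y_subgroup B (M : int -> {set V}) : groupType :=
  gen_subgroup (fun z : usf V =>
    (exists (k : int) i, z = y_at B M k i) \/
    (exists (k : int) i, ((i \in M k) || (i \in M (k - 1))) /\
                         z = sfadd 1%g (y_at B M k i))).

End Mutation.

(* A simple cycle of odd length in a loopless graph has length at least 3. *)
Definition bipartite (T : finType) (e : rel T) : Prop :=
  forall p : seq T, ucycle e p -> ~~ odd (size p).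

Definition cartan r (C : 'M[int]_r) : Prop :=
  [/\ forall i, C i i = 2,
      forall i j, i != j -> C i j <= 0
    & forall i j, C i j = 0 <-> C j i = 0].

Definition symmetrizer r (C : 'M[int]_r) (d : 'I_r -> nat) : Prop :=
  let D := diag_mx (\row_i (d i)%:Z) in
  [/\ forall i, (0 < d i)%N, (D *m C)^T = D *m C
    & \big[gcdn/0%N]_i d i = 1%N].

Definition tamely_laced r (C : 'M[int]_r) (d : 'I_r -> nat) : Prop :=
  forall i j, C i j < -1 -> d i = 1%N /\ - C j i = 1.

Section TamelyLaced.
Variables (r : nat) (C : 'M[int]_r) (d : 'I_r -> nat).
Implicit Types a b : 'I_r.

Definition dynkin : rel 'I_r := fun a b => (a != b) && (C a b < 0).

Definition indecomposable : Prop := forall a b, connect dynkin a b.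

Definition tlcm : nat := \big[lcmn/1%N]_a d a.
Definition tquo a : nat := (tlcm %/ d a)%N.

Definition even_dynkin : rel 'I_r :=
  fun a b => [&& dynkin a b, ~~ odd (d a) & ~~ odd (d b)].

(* The even block of [a] if [d a] is even, and the singleton of [a] if it is
   odd: these sets are the vertices of X'(C). *)
Definition block a : {set 'I_r} := [set b | connect even_dynkin a b].

(* Multiple edges of X'(C) are not recorded, as they only give cycles of
   length 2. *)
Definition shrunk_dynkin : rel {set 'I_r} := fun A B =>
  (A != B) && [exists a, exists b, [&& A == block a, B == block b & dynkin a b]].

Definition in_nonbip a : bool :=
  ~~ odd (d a) &&
  `[< ~ bipartite [rel b b' | [&& b \in block a, b' \in block a
                                & dynkin b b']] >].

Section Systems.
Variable l : nat.

(* Triples (a, m, k) stand for (a, m, u) with u = k/t. *)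
Definition Tindex := {x : 'I_r * nat * int | 0 < x.1.2 < tquo x.1.1 * l}%N.

Definition idx_a (g : Tindex) : 'I_r := (val g).1.1.
Definition idx_m (g : Tindex) : nat := (val g).1.2.
Definition idx_u (g : Tindex) : int := (val g).2.

(* Out of the range of the generators, only m = 0 and m = t_a l occur. *)
Definition Tm a (m : nat) (u : int) : rexpr (Tindex + Tindex) :=
  if insub (a, m, u) is Some g then RGen (inl g) else ROne.

Definition Sm b (n : nat) (u : int) : rexpr (Tindex + Tindex) :=
  let m := (n %/ d b)%N in
  let j := (n %% d b)%N in
  (\big[@RMul _/ROne]_(1 <= k < j.+1) Tm b m.+1 (u + (j.+1%:Z - k.*2%:Z))
   * \big[@RMul _/ROne]_(1 <= k < (d b - j).+1)
        Tm b m (u + ((d b - j).+1%:Z - k.*2%:Z)))%rx.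

Definition T_nbr a (m : nat) (u : int) : rexpr (Tindex + Tindex) :=
  if (1 < d a)%N
  then \big[@RMul _/ROne]_(b | dynkin b a) Tm b (d a * m %/ d b)%N u
  else \big[@RMul _/ROne]_(b | dynkin b a) Sm b m u.

(* [inl g] is the generator T_g and [inr g] its inverse. *)
Inductive T_relation : rexpr (Tindex + Tindex) -> rexpr (Tindex + Tindex) -> Prop :=
| T_sys g : let a := idx_a g in let m := idx_m g in let u := idx_u g in
    T_relation
      (Tm a m (u - (d a)%:Z) * Tm a m (u + (d a)%:Z))%rx
      (Tm a m.-1 u * Tm a m.+1 u + T_nbr a m u)%rx
| T_inv g : T_relation (RGen (inl g) * RGen (inr g))%rx 1%rx.

Definition T_ring : comPzRingType := presring T_relation.

Definition T_ring_pos : comPzRingType :=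
  gen_subring (fun z : T_ring => exists g, z = pres_gen T_relation (inl g)).

(* Y^(a)_m(u) only occurs with (a, m, u) in the range of the generators, except
   that the factor 1 + Y^(a)_m(u)^-1 is 1 for m = 0 and m = t_a l. *)
Definition Ym a (m : nat) (u : int) : sexpr Tindex :=
  if insub (a, m, u) is Some g then SGen g else SOne.

Definition Ym1V a (m : nat) (u : int) : sexpr Tindex :=
  if insub (a, m, u) is Some g then (1 + (SGen g)^-1)%sx else SOne.

Definition Zm b (p m : nat) (u : int) : sexpr Tindex :=
  \big[@SMul _/SOne]_(j <- [seq i%:Z - p%:Z | i <- iota 1 p.*2.-1])
   \big[@SMul _/SOne]_(1 <= k < (p - `|j|).+1)
     (1 + Ym b `|((p * m)%:Z + j)%R|%N (u + ((p - `|j|).+1%:Z - k.*2%:Z)%R))%sx.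

Definition Y_nbr a (m : nat) (u : int) : sexpr Tindex :=
  if (1 < d a)%N
  then \big[@SMul _/SOne]_(b | dynkin b a) Zm b (d a %/ d b) m u
  else \big[@SMul _/SOne]_(b | dynkin b a && (d b %| m)%N)
         (1 + Ym b (m %/ d b)%N u)%sx.

Inductive Y_relation : sexpr Tindex -> sexpr Tindex -> Prop :=
| Y_sys g : let a := idx_a g in let m := idx_m g in let u := idx_u g in
    Y_relation
      (Ym a m (u - (d a)%:Z)%R * Ym a m (u + (d a)%:Z)%R)%sx
      (Y_nbr a m u / (Ym1V a m.-1 u * Ym1V a m.+1 u))%sx.

Definition Y_semifield : semifieldType := pressf Y_relation.

Definition Y_group : groupType :=
  gen_subgroup (fun z : Y_semifield => exists g,
    z = pressf_gen Y_relation g \/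
    z = sfadd 1%g (pressf_gen Y_relation g)).

End Systems.

(* The second component is true for + and false for -; a third component is
   present exactly on nonbipartite even blocks. *)
Definition tvertex :=
  {v : 'I_r * bool * option bool | isSome v.2 == in_nonbip v.1.1}.

Definition base (v : tvertex) : 'I_r := (val v).1.1.
Definition eps (v : tvertex) : bool := (val v).1.2.
Definition del (v : tvertex) : option bool := (val v).2.
Definition dv (v : tvertex) : nat := d (base v).
Definition tv (v : tvertex) : nat := tquo (base v).

Definition tadj : rel tvertex := fun v w =>
  [&& dynkin (base v) (base w),
      if odd (dv v) && odd (dv w) then eps v != eps w else eps v == eps w
    & (in_nonbip (base v) && (base w \in block (base v)))
        ==> (del v != del w)].

Inductive colour := alpha | beta.

(* The colours of the vertices with odd [dv] are never used. *)
Definition proper_colouring (c : tvertex -> colour) : Prop :=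
  forall v w, tadj v w -> ~~ odd (dv v) -> ~~ odd (dv w) -> c v <> c w.

Definition inN (v : tvertex) (i : nat) : bool :=
  (0 < i <= dv v)%N && (in_nonbip (base v) ==> odd i).

Section Quiver.
Variables (l : nat) (c : tvertex -> colour).

Definition qvertex :=
  {x : tvertex * 'I_tlcm.+1 * 'I_(tlcm * l)
     | inN x.1.1 x.1.2 && (0 < x.2 < tv x.1.1 * l)%N}.

Definition qv (x : qvertex) : tvertex := (val x).1.1.
Definition qi (x : qvertex) : nat := (val x).1.2.
Definition qm (x : qvertex) : nat := (val x).2.

(* true for + *)
Definition vsign (x : qvertex) : bool :=
  let v := qv x in
  let same := if odd (dv v) then eps v else if c v is beta then true else false in
  ~~ odd (qi x + qm x) == same.

Definition istar (i : nat) : nat := if odd i then i.+1 else i.-1.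

Definition rho (v : tvertex) (i m : nat) : nat :=
  if odd (dv v) then
    if eps v then (if odd m then i - 1 else dv v - i)%N
    else (if odd m then dv v - i else i - 1)%N
  else
    let i' := if eps v then i else istar i in
    match c v with
    | alpha => (if odd m then dv v - i' else i' - 1)%N
    | beta => (if odd m then i' - 1 else dv v - i')%N
    end.

(* Without the orientation, which depends on the sign of [y]. *)
Definition tied (x y : qvertex) : bool :=
  [&& tadj (qv x) (qv y), (1 < dv (qv x))%N, dv (qv y) == 1%N
    & (`|(qm y)%:Z - (dv (qv x) * qm x)%:Z| <= rho (qv x) (qi x) (qm x))%N].

Definition arrow (x y : qvertex) : bool :=
  [|| [&& qv x == qv y, qi x == qi y,
          (qm y == (qm x).+1) || (qm x == (qm y).+1), vsign x & ~~ vsign y],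
      [&& tadj (qv x) (qv y), dv (qv x) == dv (qv y), qi x == qi y,
          qm x == qm y, ~~ vsign x & vsign y],
      tied x y && vsign y
    | tied y x && ~~ vsign x].

Definition quiver_matrix (x y : qvertex) : int :=
  (arrow x y)%:Z - (arrow y x)%:Z.

Definition in_M (k : int) (x : qvertex) : bool :=
  let v := qv x in
  let D := dv v in
  if odd D then
    let p := `|(k %% (2 * D)%:Z)%Z|%N in
    if (p < D)%N then
      vsign x && (qi x == if odd p then (D - p)%N else p.+1)
    else
      ~~ vsign x && (qi x == if odd p then (p.+1 - D)%N else (2 * D - p)%N)
  else
    let k' := if eps v then k else k - 1 in
    let p := `|(k' %% (2 * D)%:Z)%Z|%N in
    if odd p then false
    else if (p < D)%N then
      vsign x && ((qi x == p.+1) || (qi x == (D - p)%N))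
    else
      ~~ vsign x && ((qi x == (p.+1 - D)%N) || (qi x == (2 * D - p)%N)).

Definition mut_set (k : int) : {set qvertex} := [set x | in_M k x].

End Quiver.
End TamelyLaced.

Arguments quiver_matrix {r C d} l c x y.
Arguments mut_set {r C d} l c k.

(* Main.v *)
Require Import Defs.
From HB Require Import structures.
From mathcomp Require Import all_boot all_order all_algebra.
From mathcomp Require Import generic_quotient boolp mpoly zify ring.

(* A vertex [x = (v, i, m)] of the quiver, with [v] above [a], is mutated exactly
   once in each period of length [2 d_a].  Label it at time [k] by [(a, m, n)],
   where [k + n] is the time of its next mutation, from [k] on.  At each time this
   is a bijection onto the triples with [0 < m < t_a l] and [0 <= n < 2 d_a], and
   the quiver at time [k] does not depend on [k] when expressed in labels: this
   follows from a local computation with the mutations at the vertices labelled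
   [(a, m, 0)], which are pairwise unlinked and only have arrows to the labels
   [(a, m +- 1, d_a)].  The exchange relations are then the relations of the
   T-system, and the products of the factors which y_x picks up over a period are
   the right-hand sides of the Y-system.

   Conversely, the T-ring injects into the rational functions, since all of its
   generators are units which the T-system expresses through the initial ones;
   and a solution of the Y-system in a semifield extends to a y-pattern, to which
   the universality of the semifield of subtraction-free functions applies, so
   that the homomorphism from the Y-semifield has a left inverse. *)

Set Implicit Arguments.
Unset Strict Implicit.
Unset Printing Implicit Defensive.

Import Order.TTheory GRing.Theory Num.Theory.

Local Open Scope ring_scope.

(** * Mutation along unlinked vertices *)
Section SimultaneousMutation.
Variable V : finType.
Implicit Types (B : V -> V -> int) (i j k z : V) (s : seq V).

(** There are [2 d_a] vertices for each [(a, m)]: two copies with [d_a] rows, or four copies with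
    [d_a / 2] rows if [a] lies in a nonbipartite even block. The doublings in the diagram serve to
    hit every residue of the mutation time modulo [2 d_a] exactly once, so that T^(a)_m(u) and
    Y^(a)_m(u) are met for all [u] and not only for those of one parity. In labels, copies, rows,
    colours and signs have disappeared: the evolution is studied for any finite set with a bijective
    labelling, and only the last part looks at the actual quiver.

    The exchange at time [k + n] trades T at [k + n - d_a] for T at [k + n + d_a]; hence the label
    [(a, m, n)] at time [k] carries T^(a)_m(k + n - d_a).

    The hard case is that of adjacent nodes of unequal length. The arrows between them fill a tent,
    which widens by one per time step and then shrinks again. Its slices at a fixed offset are the
    products of shifted factors in S and Z, and a discrete wave equation for the tent is what makes
    the quiver stationary. *)

Definition skew B := forall i j, B i j = - B j i.

Lemma skew_diag B i : skew B -> B i i = 0.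
Proof. by move=> /(_ i i); lia. Qed.

(* The quotient in [mut_B] is exact: only the parts of like signs contribute. *)
Definition mut_term (p q : int) : int := ((`|p| * q + p * `|q|) %/ 2)%Z.

Lemma mut_term_pos p q : 0 <= p -> 0 <= q -> mut_term p q = p * q.
Proof.
move=> p0 q0; rewrite /mut_term !ger0_norm //.
by rewrite (_ : _ + _ = p * q * 2) ?mulzK //; lia.
Qed.

Lemma mut_term_neg p q : p <= 0 -> q <= 0 -> mut_term p q = - (p * q).
Proof.
move=> p0 q0; rewrite /mut_term !ler0_norm //.
by rewrite (_ : _ + _ = - (p * q) * 2) ?mulzK //; lia.
Qed.

Lemma mut_term_opp p q : p * q <= 0 -> mut_term p q = 0.
Proof. by move=> pq; rewrite /mut_term (_ : _ + _ = 0) ?div0z //; nia. Qed.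

Lemma mut_term0l q : mut_term 0 q = 0.
Proof. by rewrite mut_term_opp ?mul0r. Qed.

Lemma mut_term0r p : mut_term p 0 = 0.
Proof. by rewrite mut_term_opp ?mulr0. Qed.

Lemma mut_termC p q : mut_term p q = mut_term q p.
Proof. by rewrite /mut_term addrC mulrC [X in _ + X]mulrC. Qed.

Lemma mut_termN p q : mut_term (- p) (- q) = - mut_term p q.
Proof.
have [p0|/ltW p0] := leP 0 p; have [q0|/ltW q0] := leP 0 q.
- by rewrite (mut_term_pos p0 q0) mut_term_neg ?oppr_le0 // mulrNN.
- by rewrite !mut_term_opp ?oppr0 //; nia.
- by rewrite !mut_term_opp ?oppr0 //; nia.
- by rewrite (mut_term_neg p0 q0) mut_term_pos ?oppr_ge0 // mulrNN opprK.
Qed.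

Lemma mut_BE k B i j : mut_B k B i j =
  if (i == k) || (j == k) then - B i j else B i j + mut_term (B i k) (B k j).
Proof. by []. Qed.

Lemma mut_B_skew k B : skew B -> skew (mut_B k B).
Proof.
move=> skB i j; rewrite !mut_BE orbC; case: ifP => _; first by rewrite (skB i).
rewrite opprD -(skB i j); congr (_ + _); rewrite -mut_termN mut_termC.
by rewrite -!skB.
Qed.

Lemma mut_B_K k B : skew B -> mut_B k (mut_B k B) = B.
Proof.
move=> skB; apply/funext=> i; apply/funext=> j; rewrite !mut_BE.
case: ((i == k) || (j == k)); first by rewrite opprK.
by rewrite !eqxx /= orbT mut_termN addrK.
Qed.

(** Mutation at [k] negates column [k], so that the second exchange uses the same binomial with its
    two monomials swapped; it cancels because it is nonzero. *)
Lemma mut_x_K (F : fieldType) k B (x : V -> F) : skew B ->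
    mut_x k B x k != 0 -> x k != 0 ->
  mut_x k (mut_B k B) (mut_x k B x) = x.
Proof.
move=> skB x'0 x0; apply/funext=> i; rewrite {1}/mut_x;
  case: eqP => [->|/eqP ik].
  have step (P Q : pred V) : P =1 Q ->
      (forall j, P j -> j != k) ->
      \prod_(j | P j) mut_x k B x j ^+ `|mut_B k B j k|%N =
      \prod_(j | Q j) x j ^+ `|B j k|%N.
    move=> PQ Pk; rewrite (eq_bigl _ _ PQ); apply: eq_bigr => j;
      rewrite -PQ => Pj.
    by rewrite /mut_x (negPf (Pk j Pj)) mut_BE eqxx orbT abszN.
  rewrite (step _ (fun j => B j k < 0)); last 2 first.
  - by move=> j; rewrite mut_BE eqxx orbT oppr_gt0.
  - by move=> j; apply: contraTneq => ->;
    rewrite mut_BE eqxx oppr_gt0 skew_diag.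
  rewrite (step _ (fun j => 0 < B j k)); last 2 first.
  - by move=> j; rewrite mut_BE eqxx orbT oppr_lt0.
  - by move=> j; apply: contraTneq => ->;
    rewrite mut_BE eqxx oppr_lt0 skew_diag.
  move: x'0; rewrite /mut_x eqxx addrC => x'0;
    rewrite invf_div mulrCA mulfV ?mulr1 //.
  by apply: contraNneq x'0 => ->; rewrite mul0r.
by rewrite /mut_x (negPf ik).
Qed.

(** Behind the involutivity of [mut_y]: once y_k is inverted, the factor for the opposite sign is
    the inverse of the former one. The same identity produces the factors [(1 + Y^-1)^-1] of the
    Y-system. *)
Lemma sf_divN (P : semifieldType) (w : P) :
  (w / sfadd 1 w = (sfadd 1 w^-1)^-1)%g.
Proof.
apply: (mulIg (sfadd 1%g w)); rewrite mulgVK.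
apply: (mulgI (sfadd 1%g w^-1%g)); rewrite mulgA mulgV mul1g.
by rewrite sfmulDl mul1g mulVg sfaddC.
Qed.

Lemma mut_y_K (P : semifieldType) k B (y : V -> P) : skew B ->
  mut_y k (mut_B k B) (mut_y k B y) = y.
Proof.
move=> skB; apply/funext=> i; rewrite {1}/mut_y; case: eqP => [->|/eqP ik].
  by rewrite /mut_y eqxx invgK.
rewrite mut_BE eqxx /= oppr_ge0 abszN.
have yk : mut_y k B y k = (y k)^-1%g by rewrite /mut_y eqxx.
rewrite yk.
have invM (a b : P) n : (a ^+ n * b ^+ n = (a * b) ^+ n)%g.
  by rewrite expgMn //; apply: sfmulC.
rewrite /mut_y (negPf ik); case: (ltgtP (B k i) 0) => Bki.
- by rewrite sf_divN invgK -mulgA invM mulgV expg1n mulg1.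
- by rewrite sf_divN -mulgA invM mulVg expg1n mulg1.
by rewrite Bki /= !expg0 !mulg1.
Qed.

End SimultaneousMutation.

HB.instance Definition _ (P : semifieldType) :=
  SemiGroup.isCommutativeLaw.Build P *%g (@sfmulC P).

Section MutationSequence.
Variable V : finType.
Implicit Types (B : V -> V -> int) (i j k z : V) (s : seq V).

Definition mut_Bs B s := foldl (fun B' k => mut_B k B') B s.

Lemma mut_xseeds1 (F : fieldType) (w : xseed V F) s :
  (foldl (@mut_xseed V F) w s).1 = mut_Bs w.1 s.
Proof. by elim: s w => //= z s IH w; rewrite IH. Qed.

Lemma mut_yseeds1 (P : semifieldType) (w : yseed V P) s :
  (foldl (@mut_yseed V P) w s).1 = mut_Bs w.1 s.
Proof. by elim: s w => //= z s IH w; rewrite IH. Qed.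

Definition mut_fac (P : semifieldType) (b : int) (w : P) : P :=
  if 0 <= b then ((w / sfadd 1 w) ^+ `|b|)%g else (sfadd 1 w ^+ `|b|)%g.

Lemma mut_fac0 (P : semifieldType) (w : P) : mut_fac 0 w = 1%g.
Proof. by rewrite /mut_fac /= expg0. Qed.

Lemma mut_yE (P : semifieldType) k B (y : V -> P) i :
  mut_y k B y i = if i == k then (y k)^-1%g else (y i * mut_fac (B k i) (y k))%g.
Proof. by rewrite /mut_y /mut_fac; case: ifP => // _; case: ifP. Qed.

Definition unlinked B s := {in s &, forall z z', B z z' = 0}.

(** A vertex unlinked to [z] is on no path of length two through [z] as an end, so its row and
    column survive the mutation at [z]. This is why the order of the mutations does not matter. *)
Lemma mut_B_unlinked B z s z' i : unlinked B (z :: s) -> z \notin s ->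
  z' \in s -> (mut_B z B z' i = if i == z then 0 else B z' i) /\
  (mut_B z B i z' = if i == z then 0 else B i z').
Proof.
move=> zs0 zs z's; have z'z : z' == z = false by apply: contraNF zs => /eqP<-.
have z'0 : B z' z = 0 by rewrite zs0 ?inE ?eqxx ?z's ?orbT.
have z0 : B z z' = 0 by rewrite zs0 ?inE ?eqxx ?z's ?orbT.
rewrite !mut_BE !z'z orbF /=; case: eqP => [->|_].
  by rewrite z'0 z0 oppr0.
by rewrite z'0 z0 mut_term0l mut_term0r !addr0.
Qed.

Lemma mut_B_unlinked_behead B z s : unlinked B (z :: s) -> z \notin s ->
  unlinked (mut_B z B) s.
Proof.
move=> zs0 zs i j si sj; rewrite (mut_B_unlinked j zs0 zs si).1.
by rewrite zs0 ?inE ?si ?sj ?orbT // if_same.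
Qed.

(** The rows and columns of the vertices still to be mutated stay untouched, so each [z] contributes
    with its entries in the original [B]. *)
Lemma mut_BsE B s i j : uniq s -> unlinked B s ->
  mut_Bs B s i j = if (i \in s) || (j \in s) then - B i j
                   else B i j + \sum_(z <- s) mut_term (B i z) (B z j).
Proof.
elim: s B => [|z s IH] B /=; first by rewrite big_nil addr0.
move=> /andP[zs us] zs0; rewrite IH //; last exact: mut_B_unlinked_behead.
rewrite !inE; have [si|si] := boolP (i \in s).
  rewrite (mut_B_unlinked j zs0 zs si).1 orbT /=; case: eqP => // ->.
  by rewrite zs0 ?inE ?eqxx ?si ?orbT.
have [sj|sj] := boolP (j \in s).
  rewrite (mut_B_unlinked i zs0 zs sj).2 !orbT /=; case: eqP => // ->.
  by rewrite zs0 ?inE ?eqxx ?sj ?orbT.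
rewrite !orbF /= big_cons mut_BE addrA; case: ifP => [ij|/norP[iz jz]];
  last first.
  congr (_ + _); apply: eq_big_seq => z' sz'.
  rewrite (mut_B_unlinked j zs0 zs sz').1 (mut_B_unlinked i zs0 zs sz').2.
  by rewrite (negPf iz) (negPf jz).
rewrite big1_seq ?addr0 // => z' /= sz'.
rewrite (mut_B_unlinked j zs0 zs sz').1 (mut_B_unlinked i zs0 zs sz').2.
by case/orP: ij => ->; rewrite ?mut_term0l ?mut_term0r.
Qed.

Lemma mut_xsE (F : fieldType) (w : xseed V F) s i : skew w.1 -> uniq s ->
    unlinked w.1 s ->
  (foldl (@mut_xseed V F) w s).2 i =
  if i \in s then mut_x i w.1 w.2 i else w.2 i.
Proof.
elim: s w => [|z s IH] //= w skB /andP[zs us] zs0.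
rewrite IH //; [|exact: mut_B_skew|exact: mut_B_unlinked_behead].
rewrite inE /=; have [si|si] := boolP (i \in s); last first.
  by rewrite orbF /mut_x; case: eqP => [->|//]; rewrite eqxx.
have iz : i == z = false by apply: contraNF zs => /eqP<-.
rewrite orbT /mut_x !eqxx iz; congr ((_ + _) / _).
  rewrite (eq_bigl (fun j => 0 < w.1 j i)) => [|j].
    apply: eq_bigr => j ji; rewrite (mut_B_unlinked j zs0 zs si).2.
    case: eqP => // jz; move: ji; rewrite jz zs0 ?inE ?eqxx ?si ?orbT //.
  rewrite (mut_B_unlinked j zs0 zs si).2; case: eqP => // ->.
  by rewrite zs0 ?inE ?eqxx ?si ?orbT.
rewrite (eq_bigl (fun j => w.1 j i < 0)) => [|j].
  apply: eq_bigr => j ji; rewrite (mut_B_unlinked j zs0 zs si).2.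
  case: eqP => // jz; move: ji; rewrite jz zs0 ?inE ?eqxx ?si ?orbT //.
rewrite (mut_B_unlinked j zs0 zs si).2; case: eqP => // ->.
by rewrite zs0 ?inE ?eqxx ?si ?orbT.
Qed.

Lemma mut_ysE (P : semifieldType) (w : yseed V P) s i : uniq s ->
    unlinked w.1 s ->
  (foldl (@mut_yseed V P) w s).2 i =
  if i \in s then (w.2 i)^-1%g
  else (w.2 i * \big[*%g/1%g]_(z <- s) mut_fac (w.1 z i) (w.2 z))%g.
Proof.
elim: s w => [|z s IH] w /=; first by rewrite big_nil mulg1.
move=> /andP[zs us] zs0; rewrite IH //; last exact: mut_B_unlinked_behead.
have yz z' : z' \in s -> mut_y z w.1 w.2 z' = w.2 z'.
  move=> sz'; rewrite mut_yE zs0 ?inE ?eqxx ?sz' ?orbT // mut_fac0 mulg1.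
  by case: eqP => // z'z; rewrite -z'z sz' in zs.
rewrite inE /=; have [si|si] := boolP (i \in s); first by rewrite yz ?orbT.
rewrite orbF mut_yE big_cons mulgA; case: eqP => [->|iz].
  rewrite big1_seq ?mulg1 // => z' /= sz'.
  by rewrite (mut_B_unlinked z zs0 zs sz').1 eqxx mut_fac0.
congr (_ * _)%g; apply: eq_big_seq => z' sz'.
by rewrite yz // (mut_B_unlinked i zs0 zs sz').1; case: eqP.
Qed.

Lemma sf_prod (J : Type) (t : seq J) (Q : pred J) (F : J -> ratfun V) :
  (forall i : J, Q i -> subtraction_free (F i)) ->
  subtraction_free (\prod_(i <- t | Q i) F i).
Proof. by apply: big_ind => //; [apply: sf_one | apply: sf_mul]. Qed.

Lemma sf_exp (f : ratfun V) n : subtraction_free f -> subtraction_free (f ^+ n).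
Proof.
move=> ff; elim: n => [|n IH]; first by rewrite expr0; apply: sf_one.
by rewrite exprS; apply: sf_mul.
Qed.

(** The invariant under which mutation of x-seeds is involutive: subtraction-free functions are
    nonzero, as [mut_x_K] demands. *)
Definition sf_xseed (w : xseed V (ratfun V)) :=
  skew w.1 /\ forall i, subtraction_free (w.2 i).

Lemma mut_xseed_sf w k : sf_xseed w -> sf_xseed (mut_xseed w k).
Proof.
move=> [skB fx]; split=> [|i]; first exact: mut_B_skew.
rewrite /= /mut_x; case: ifP => // _; apply: sf_div => //.
by apply: sf_add; apply: sf_prod => j _; apply: sf_exp.
Qed.

Lemma mut_xseedK w k : sf_xseed w -> mut_xseed (mut_xseed w k) k = w.
Proof.
move=> sfw; have [skB fx] := sfw; have [_ fx'] := mut_xseed_sf k sfw.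
case: w skB fx fx' {sfw} => B x /= skB fx fx'; rewrite /mut_xseed /= mut_B_K //.
by rewrite mut_x_K // subtraction_free_neq0.
Qed.

Lemma mut_yseed_skew (P : semifieldType) (w : yseed V P) k :
  skew w.1 -> skew (mut_yseed w k).1.
Proof. exact: mut_B_skew. Qed.

Lemma mut_yseedK (P : semifieldType) (w : yseed V P) k :
  skew w.1 -> mut_yseed (mut_yseed w k) k = w.
Proof. by case: w => B y skB; rewrite /mut_yseed /= mut_B_K // mut_y_K. Qed.

End MutationSequence.

(** * Evolution of seeds in both directions of time *)

Section Evolution.
Variables (V : finType) (S : Type) (mut : S -> V -> S) (M : int -> {set V}).
Variable inv : S -> Prop.
Hypothesis inv_mut : forall w k, inv w -> inv (mut w k).
Hypothesis mutK : forall w k, inv w -> mut (mut w k) k = w.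

Lemma inv_foldl w s : inv w -> inv (foldl mut w s).
Proof. by elim: s w => //= k s IH w iw; apply/IH/inv_mut. Qed.

Lemma foldl_mutK w s : inv w -> foldl mut (foldl mut w (rev s)) s = w.
Proof.
elim: s w => //= k s IH w iw; rewrite rev_cons foldl_rcons mutK ?IH //.
exact: inv_foldl.
Qed.

Lemma foldl_mut_inj w w' s : inv w -> inv w' ->
  foldl mut w s = foldl mut w' s -> w = w'.
Proof.
move=> iw iw' ww'; rewrite -[w](foldl_mutK (rev s)) // revK ww'.
by rewrite -{1}[s]revK foldl_mutK.
Qed.

Lemma evolve_inv w0 k : inv w0 -> inv (evolve mut M w0 k).
Proof.
by move=> iw0; case: k => n /=; [|apply: inv_foldl];
   elim: n => //= n IH; apply: inv_foldl.
Qed.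

(** One rule for both recursions: at a negative time, the mutations at [M k] undo, in reverse order,
    those which led from time [k + 1] back to time [k]. *)
Lemma evolve_step w0 k : inv w0 ->
  evolve mut M w0 (k + 1) = foldl mut (evolve mut M w0 k) (enum (M k)).
Proof.
move=> iw0; case: k => [n|n]; first by rewrite addrC -intS.
have ib m : inv (backward mut M w0 m) by elim: m => //= m IH; apply: inv_foldl.
rewrite [evolve _ _ _ (Negz n)]/= foldl_mutK // NegzE -[n.+1]addn1 PoszD opprD.
by rewrite -addrA addNr addr0; case: n.
Qed.

(** A step is injective on invariant seeds, so the value at 0 determines an orbit in the past as
    well. Matrices and y-patterns given by a formula are identified with the true ones in this
    way. *)
Lemma evolution_unique (w w' : int -> S) :
    (forall k, inv (w k)) -> (forall k, inv (w' k)) ->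
    (forall k, w (k + 1) = foldl mut (w k) (enum (M k))) ->
    (forall k, w' (k + 1) = foldl mut (w' k) (enum (M k))) ->
  w 0 = w' 0 -> w =1 w'.
Proof.
move=> iw iw' wS w'S w0; elim/int_ind => // n IH.
  by rewrite -addn1 PoszD wS w'S IH.
apply: (@foldl_mut_inj _ _ (enum (M (- n.+1%:Z)))) => //.
by rewrite -wS -w'S (_ : - _ + 1 = - n%:Z) //; lia.
Qed.

End Evolution.

(** * The quiver in terms of labels *)

(* [rho v i m] as a function of the time [n] to the next mutation. *)
Definition reach D n : nat := minn n (D.*2.-1 - n).

(** The condition means [s <= n <= 2D - 1 - s], and the parity leaves
    [n = s + 1, s + 3, ..., 2D - 1 - s]. Listed downwards, these are the [D - s] shifts in the
    products defining S and Z. *)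
Lemma big_reach (R : Type) (idx : R) (op : Monoid.com_law idx) D s
    (G : nat -> R) : (s <= D)%N ->
  \big[op/idx]_(0 <= n < D.*2 | (s <= reach D n)%N && odd (n + s)) G n =
  \big[op/idx]_(1 <= k < (D - s).+1) G (D.*2 - s + 1 - k.*2)%N.
Proof.
move=> sD; rewrite -[LHS]big_filter.
rewrite -[RHS](big_map (fun k => D.*2 - s + 1 - k.*2)%N xpredT G).
apply: perm_big; apply: uniq_perm; first by rewrite filter_uniq ?iota_uniq.
  rewrite map_inj_in_uniq ?iota_uniq // => j k.
  by rewrite !mem_index_iota; lia.
move=> n; rewrite mem_filter mem_index_iota /reach.
apply/idP/mapP => [H|[k]]; last by rewrite mem_index_iota; lia.
by exists ((D.*2 - s + 1 - n)./2); rewrite ?mem_index_iota; lia.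
Qed.

(** [reach D] is symmetric about [D - 1/2], not about [D]. The conditions at [n] and [2D - n] could
    differ only for [n = s] and [n = 2D - s], which the parity excludes. *)
Lemma reach_rev D n s : (0 < n < D.*2)%N -> odd (n + s) ->
  (s <= reach D (D.*2 - n))%N = (s <= reach D n)%N.
Proof.
move=> nD ons; rewrite /reach !leq_min.
have -> : (s <= D.*2.-1 - (D.*2 - n))%N = (s <= n)%N by apply/idP/idP; lia.
have -> : (s <= D.*2 - n)%N = (s <= D.*2.-1 - n)%N by apply/idP/idP; lia.
exact: andbC.
Qed.

Lemma big_nat_only (R : Type) (idx : R) (op : Monoid.com_law idx) m n p
    (F : nat -> R) : (m <= p < n)%N ->
    (forall i, (m <= i < n)%N -> i != p -> F i = idx) ->
  \big[op/idx]_(m <= i < n) F i = F p.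
Proof.
move=> mpn F1; have -> : F p = \big[op/idx]_(m <= i < n | i == p) F i.
  by rewrite big_nat1_eq mpn.
rewrite [RHS]big_mkcond; apply: eq_big_nat => i mi.
by case: eqVneq => // ip; apply: F1.
Qed.

Section Labels.
Variables (r : nat) (C : 'M[int]_r) (d : 'I_r -> nat).
Implicit Types (a b : 'I_r) (m n : nat).
Hypothesis d_gt0 : forall a, (0 < d a)%N.
Hypothesis dynkinC : forall a b, dynkin C a b = dynkin C b a.
Hypothesis dynkin_d : forall a b, dynkin C a b ->
  [|| d a == d b, (d a == 1) && (1 < d b) | (d b == 1) && (1 < d a)]%N.

(* The label [(a, m, n)] stands for the vertex carrying a T^(a)_m which is next
   mutated [n] time steps from now.  The four clauses are the arrows (A1), (A2)
   and, by the length of their source, (A3). *)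
Definition lout a m n b m' n' : bool :=
  [|| [&& a == b, (m' == m.+1) || (m == m'.+1), n < d a & n' == n + d a],
      [&& dynkin C a b, d a == d b, m == m', n' < d b & n == n' + d b],
      [&& dynkin C a b, 1 < d a, d b == 1, n' == 0,
          `|m'%:Z - (d a * m)%:Z| <= reach (d a) n & odd (n + n' + m' + d a * m)]
    | [&& dynkin C a b, 1 < d b, d a == 1, n == 1,
          `|m%:Z - (d b * m')%:Z| <= reach (d b) n' & odd (n + n' + m + d b * m')]]%N.

Lemma lout_same a m n m' n' : lout a m n a m' n' =
  [&& (m' == m.+1) || (m == m'.+1), n < d a & n' == n + d a]%N.
Proof. by rewrite /lout eqxx /dynkin eqxx /= !orbF. Qed.

Lemma lout_eqd a m n b m' n' : dynkin C a b -> d a = d b ->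
  lout a m n b m' n' = [&& m == m', n' < d b & n == n' + d b]%N.
Proof.
move=> ab dab; rewrite /lout dab eqxx ab /=.
have -> : a == b = false by case/andP: ab => /negPf.
by case: (ltngtP 1%N (d b)) => _ /=; rewrite ?orbF ?andbF.
Qed.

Lemma lout_long a m n b m' n' : dynkin C a b -> (1 < d a)%N -> d b = 1%N ->
  lout a m n b m' n' =
  [&& n' == 0, `|m'%:Z - (d a * m)%:Z| <= reach (d a) n
    & odd (n + n' + m' + d a * m)]%N.
Proof.
move=> ab da db; rewrite /lout db ab da !eqxx /=.
have -> : a == b = false by case/andP: ab => /negPf.
have -> : (d a == 1)%N = false by lia.
by rewrite ?orbF ?andbF.
Qed.

Lemma lout_short a m n b m' n' : dynkin C a b -> (1 < d b)%N -> d a = 1%N ->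
  lout a m n b m' n' =
  [&& n == 1, `|m%:Z - (d b * m')%:Z| <= reach (d b) n'
    & odd (n + n' + m + d b * m')]%N.
Proof.
move=> ab db da; rewrite /lout da ab db !eqxx /=.
have -> : a == b = false by case/andP: ab => /negPf.
by have -> : (1 == d b)%N = false by lia.
Qed.

Lemma lout_far a m n b m' n' : a != b -> ~~ dynkin C a b ->
  lout a m n b m' n' = false.
Proof. by rewrite /lout => /negPf-> /negPf->. Qed.

Definition lB a m n b m' n' : int :=
  (lout a m n b m' n')%:Z - (lout b m' n' a m n)%:Z.

(* The time to the next mutation, after one time step. *)
Definition lprev a n : nat := if n == 0%N then (d a).*2.-1 else n.-1.

(* The number of paths through vertices to be mutated now: the arrows leaving
   these go to labels of the form [(b, m +- 1, d b)]. *)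
Definition lpath a m n b m' n' : nat :=
  if n' == d b then (lout a m n b m'.+1 0 + lout a m n b m'.-1 0)%N else 0%N.

Lemma d_cases a b : [\/ a = b, a != b /\ ~~ dynkin C a b,
    dynkin C a b /\ d a = d b
  | [/\ dynkin C a b, (1 < d a)%N & d b = 1%N]
    \/ [/\ dynkin C a b, (1 < d b)%N & d a = 1%N]].
Proof.
have [->|ab] := eqVneq a b; first by constructor 1.
have [e|ne] := boolP (dynkin C a b); last by constructor 2.
case/or3P: (dynkin_d e) => [/eqP dd|/andP[/eqP d1 d2]|/andP[/eqP d1 d2]].
- by constructor 3.
- by constructor 4; right.
- by constructor 4; left.
Qed.

(** If one of two labels is mutated now, its 0 wraps to [2d - 1] and the arrow between them must
    come out reversed. *)
Lemma lout_flip a m n b m' n' : (n < (d a).*2)%N -> (n' < (d b).*2)%N ->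
    (n == 0)%N || (n' == 0)%N ->
  lout a m (lprev a n) b m' (lprev b n') = lout b m' n' a m n.
Proof.
move=> na nb n0; rewrite /lprev; have da := d_gt0 a; have db := d_gt0 b.
case: (d_cases a b) => [ab|[ab e]|[e dd]|[[e d1 d2]|[e d1 d2]]].
- subst b; rewrite !lout_same.
  case: (n =P 0%N) => ?; case: (n' =P 0%N) => ?; apply/idP/idP; lia.
- by rewrite !lout_far // 1?eq_sym // dynkinC.
- have e' := e; rewrite dynkinC in e'.
  rewrite (lout_eqd _ _ _ _ e dd) (lout_eqd _ _ _ _ e' (esym dd)).
  case: (n =P 0%N) => ?; case: (n' =P 0%N) => ?; apply/idP/idP; lia.
- have e' := e; rewrite dynkinC in e'.
  rewrite (lout_long _ _ _ _ e d1 d2) (lout_short _ _ _ _ e' d1 d2) /reach d2.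
  rewrite d2 in nb; set s := (d a * m)%N.
  case: (n =P 0%N) => ?; case: (n' =P 0%N) => ?; apply/idP/idP; lia.
- have e' := e; rewrite dynkinC in e'.
  rewrite (lout_short _ _ _ _ e d1 d2) (lout_long _ _ _ _ e' d1 d2) /reach d2.
  rewrite d2 in na; set s := (d b * m')%N.
  case: (n =P 0%N) => ?; case: (n' =P 0%N) => ?; apply/idP/idP; lia.
Qed.

Lemma lB_flip a m n b m' n' : (n < (d a).*2)%N -> (n' < (d b).*2)%N ->
    (n == 0)%N || (n' == 0)%N ->
  lB a m (lprev a n) b m' (lprev b n') = - lB a m n b m' n'.
Proof.
by move=> na nb n0; rewrite /lB opprB !lout_flip // orbC.
Qed.

(** The tent [|s| <= reach D n], on the sites with [n + s] even, obeys a discrete wave equation: the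
    values at [s] on the levels [n] and [n - 1] add up to those at [s - 1] and [s + 1] on level [n].
    It fails only at [n = D], [s = D] or [-D], whence the last two terms. In the mutation rule, the
    values at [s - 1] and [s + 1] count paths through short vertices, and the corrections count
    paths through long ones. *)
Lemma reach_shift D n (s k : int) : (0 < n < D.*2)%N -> n%:Z + s = 2 * k ->
  (absz s <= reach D n.-1)%N%:Z =
  - (absz s <= reach D n)%N%:Z +
    ((absz (s + 1)%R <= reach D n)%N%:Z + (absz (s - 1)%R <= reach D n)%N%:Z)
  - ((n == D) && (absz (s - D%:Z)%R <= 0)%N)%:Z
  - ((n == D) && (absz (s + D%:Z)%R <= 0)%N)%:Z.
Proof.
rewrite /reach => nD nk.
case: (leqP n D) => n_le.
  rewrite (_ : minn n.-1 _ = n.-1); last lia.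
  case: (n =P D) => nD'.
    rewrite (_ : minn n _ = n.-1); last lia.
    by rewrite /=; lia.
  rewrite (_ : minn n _ = n); last lia.
  by rewrite /=; lia.
rewrite (_ : minn n.-1 _ = D.*2 - n)%N; last lia.
rewrite (_ : minn n _ = D.*2.-1 - n)%N; last lia.
case: (n =P D) => nD' /=; first lia.
lia.
Qed.

Lemma lB_shift_long a m n b m' n' :
    dynkin C a b -> (1 < d a)%N -> d b = 1%N ->
    (0 < n < (d a).*2)%N -> (0 < n' < (d b).*2)%N -> (0 < m)%N -> (0 < m')%N ->
  lB a m n.-1 b m' n'.-1 =
  lB a m n b m' n' + (lpath a m n b m' n')%:Z - (lpath b m' n' a m n)%:Z.
Proof.
move=> e d1 d2 na nb m0 m'0; have -> : n' = 1%N by rewrite d2 in nb; lia.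
rewrite /lB /lpath d2 eqxx; have e' := e; rewrite dynkinC in e'.
rewrite !(lout_long _ _ _ _ e d1 d2) !(lout_short _ _ _ _ e' d1 d2) !eqxx /=.
rewrite mulnS; have -> : (d a * m.-1 = d a * m - d a)%N.
  by rewrite -[in RHS](prednK m0) mulnS addKn.
set s := (d a * m)%N; have sd : (d a <= s)%N by rewrite leq_pmulr.
have r0 : reach (d a) 0 = 0%N by rewrite /reach min0n.
(* In this parity class the two labels are not linked and no path joins them: both sides are 0. *)
rewrite r0; have [o|o] := boolP (odd (n + m' + s)).
  have -> : odd (n.-1 + 0 + m' + s) = false by lia.
  have -> : odd (n + 0 + m'.+1 + s) = false by lia.
  have -> : odd (n + 0 + m'.-1 + s) = false by lia.
  rewrite !andbF; case: eqP => [nd|] //=.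
  have -> : odd (0 + 0 + m' + (d a + s)) by lia.
  have -> : odd (0 + 0 + m' + (s - d a)) by lia.
  by rewrite !andbF.
have -> : odd (n.-1 + 0 + m' + s) by lia.
have -> : odd (n + 0 + m'.+1 + s) by lia.
have -> : odd (n + 0 + m'.-1 + s) by lia.
have [k nk] : exists k, n%:Z + (m'%:Z - s%:Z) = 2 * k.
  by exists ((n + m' + s)./2%:Z - s%:Z); lia.
rewrite !andbT (reach_shift na nk).
rewrite (_ : m'.+1%:Z - s%:Z = m'%:Z - s%:Z + 1); last lia.
rewrite (_ : m'.-1%:Z - s%:Z = m'%:Z - s%:Z - 1); last lia.
rewrite (_ : m'%:Z - (d a + s)%N%:Z = m'%:Z - s%:Z - (d a)%:Z); last lia.
rewrite (_ : m'%:Z - (s - d a)%N%:Z = m'%:Z - s%:Z + (d a)%:Z); last lia.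
case: eqP => [nd|_] /=; last by rewrite sub0r PoszD !subr0.
have -> : odd (0 + 0 + m' + (d a + s)) = false by lia.
have -> : odd (0 + 0 + m' + (s - d a)) = false by lia.
by rewrite !andbT !PoszD; ring.
Qed.

Lemma lB_anti a m n b m' n' : lB a m n b m' n' = - lB b m' n' a m n.
Proof. by rewrite /lB opprB. Qed.

(** Paths through the mutated vertices make up the change of an entry. Above a single node there are
    none, for equal lengths those in the two directions cancel, and only a long and a short node
    need the wave equation. *)
Lemma lB_shift a m n b m' n' : (0 < n < (d a).*2)%N -> (0 < n' < (d b).*2)%N ->
    (0 < m)%N -> (0 < m')%N ->
  lB a m n.-1 b m' n'.-1 =
  lB a m n b m' n' + (lpath a m n b m' n')%:Z - (lpath b m' n' a m n)%:Z.
Proof.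
move=> na nb m0 m'0; have db := d_gt0 b.
case: (d_cases a b) => [ab|[ab e]|[e dd]|[[e d1 d2]|[e d1 d2]]].
- subst b.
  have path0 k p k' q : lpath a k p a k' q = 0%N.
    have da q' : (0 == q' + d a)%N = false by lia.
    by rewrite /lpath !lout_same !da !andbF addn0 if_same.
  rewrite !path0 subr0 addr0 /lB !lout_same.
  by congr (Posz (nat_of_bool _) - Posz (nat_of_bool _)); apply/idP/idP; lia.
- by rewrite /lB /lpath !lout_far ?if_same // 1?eq_sym // dynkinC.
- have e' := e; rewrite dynkinC in e'; rewrite dd in na.
  have -> : lpath a m n b m' n' = lpath b m' n' a m n.
    rewrite /lpath !(lout_eqd _ _ _ _ e dd) !(lout_eqd _ _ _ _ e' (esym dd)).
    rewrite dd db !add0n /= addnC.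
    have -> : (m == m'.-1) = (m' == m.+1) by lia.
    have -> : (m == m'.+1) = (m' == m.-1) by lia.
    by case: (n == d b); case: (n' == d b); rewrite ?andbF.
  rewrite addrK /lB !(lout_eqd _ _ _ _ e dd) !(lout_eqd _ _ _ _ e' (esym dd)) dd.
  by congr (Posz (nat_of_bool _) - Posz (nat_of_bool _)); apply/idP/idP; lia.
- exact: lB_shift_long.
- rewrite lB_anti lB_shift_long // 1?dynkinC // [in RHS]lB_anti; ring.
Qed.

End Labels.

(** * Generated subrings and subgroups *)

Lemma inj_surj_bij (A B : Type) (f : A -> B) :
  injective f -> (forall y, exists x, f x = y) -> bijective f.
Proof.
move=> fI fS; exists (fun y => projT1 (cid (fS y))) => [x|y].
  by apply: fI; case: cid.
by case: cid.
Qed.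

Section SubringIsomorphism.
Variables (R S : comPzRingType) (A : R -> Prop) (A' : S -> Prop).
Variable h : {rmorphism R -> S}.
Hypothesis hA : forall x, A x -> in_subring A' (h x).
Hypothesis A'h : forall y, A' y -> exists2 x, in_subring A x & h x = y.
Hypothesis h_inj : forall x, h x = 0 -> x = 0.

Lemma in_subring_morph x : in_subring A x -> in_subring A' (h x).
Proof.
elim=> {x} [x Ax||x y _ hx _ hy|x y _ hx _ hy].
- exact: hA.
- by rewrite rmorph1; apply: in_subring_one.
- by rewrite rmorphB; apply: in_subring_sub.
- by rewrite rmorphM; apply: in_subring_mul.
Qed.

Lemma in_subring_lift y : in_subring A' y -> exists2 x, in_subring A x & h x = y.
Proof.
elim=> {y} [y Ay||x y _ [x' ? <-] _ [y' ? <-]|x y _ [x' ? <-] _ [y' ? <-]].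
- exact: A'h.
- by exists 1; [apply: in_subring_one|rewrite rmorph1].
- by exists (x' - y'); [apply: in_subring_sub|rewrite rmorphB].
- by exists (x' * y'); [apply: in_subring_mul|rewrite rmorphM].
Qed.

Lemma gen_subring_iso : ring_isomorphic (gen_subring A) (gen_subring A').
Proof.
have im (x : gen_subring A) : h (val x) \in subring_pred A'.
  by apply/asboolP/in_subring_morph/asboolP/(valP x).
pose f (x : gen_subring A) : gen_subring A' := exist _ (h (val x)) (im x).
have fB : zmod_morphism f by move=> x y; apply/val_inj; rewrite /= rmorphB.
have fM : monoid_morphism f.
  by split=> [|x y]; apply/val_inj; rewrite /= ?rmorph1 ?rmorphM.
pose fBm := GRing.isZmodMorphism.Build _ _ f fB.
pose fMm := GRing.isMonoidMorphism.Build _ _ f fM.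
pose F : {rmorphism gen_subring A -> gen_subring A'} := HB.pack f fBm fMm.
exists F; apply: inj_surj_bij.
  move=> x y /(congr1 val) /= hxy; apply/val_inj/eqP; rewrite -subr_eq0;
    apply/eqP.
  by apply: h_inj; rewrite rmorphB hxy subrr.
move=> y; have /asboolP/in_subring_lift[x Ax hx] := valP y.
by exists (exist _ x (asboolT Ax)); apply/val_inj.
Qed.

End SubringIsomorphism.

Section SubgroupIsomorphism.
Local Open Scope group_scope.
Variables (G H : groupType) (A : G -> Prop) (A' : H -> Prop).
Variable h : G -> H.
Hypothesis hM : {morph h : x y / x * y}.
Hypothesis hA : forall x, A x -> in_subgroup A' (h x).
Hypothesis A'h : forall y, A' y -> exists2 x, in_subgroup A x & h x = y.
Hypothesis h_inj : injective h.

Let h1 : h 1 = 1.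
Proof. by apply: (mulgI (h 1)); rewrite -hM !mulg1. Qed.

Let hdiv x y : h (x / y) = h x / h y.
Proof. by apply: (mulIg (h y)); rewrite -hM !mulgVK. Qed.

Lemma in_subgroup_morph x : in_subgroup A x -> in_subgroup A' (h x).
Proof.
elim=> {x} [x Ax||x y _ hx _ hy]; first exact: hA.
  by rewrite h1; apply: in_subgroup_one.
by rewrite hdiv; apply: in_subgroup_div.
Qed.

Lemma in_subgroup_lift y : in_subgroup A' y -> exists2 x, in_subgroup A x & h x = y.
Proof.
elim=> {y} [y Ay||x y _ [x' ? <-] _ [y' ? <-]]; first exact: A'h.
  by exists 1; [apply: in_subgroup_one|].
by exists (x' / y'); [apply: in_subgroup_div|rewrite hdiv].
Qed.

Lemma gen_subgroup_iso : group_isomorphic (gen_subgroup A) (gen_subgroup A').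
Proof.
have im (x : gen_subgroup A) : h (val x) \in subgroup_pred A'.
  by apply/asboolP/in_subgroup_morph/asboolP/(valP x).
pose f (x : gen_subgroup A) : gen_subgroup A' := exist _ (h (val x)) (im x).
have fM : {morph f : x y / x / y} by move=> x y; apply/val_inj; rewrite /= hdiv.
pose fMm := isGroupMorphism.Build _ _ f fM.
pose F : {multiplicative gen_subgroup A -> gen_subgroup A'} := HB.pack f fMm.
exists F; apply: inj_surj_bij.
  by move=> x y /(congr1 val) /= /h_inj xy; apply/val_inj.
move=> y; have /asboolP/in_subgroup_lift[x Ax hx] := valP y.
by exists (exist _ x (asboolT Ax)); apply/val_inj.
Qed.

Lemma in_subgroup_mul x y : in_subgroup A x -> in_subgroup A y -> in_subgroup A (x * y).
Proof.
move=> Ax Ay; rewrite -[y]invgK; apply: in_subgroup_div => //.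
by rewrite -[y^-1]mul1g; apply: in_subgroup_div => //; apply: in_subgroup_one.
Qed.

End SubgroupIsomorphism.

(** * Lifts of the variables are algebraically independent *)

Section AlgebraicIndependence.
Variables (V : finType) (S : comPzRingType) (h : {rmorphism S -> ratfun V}).
Variable t : V -> S.
Hypothesis ht : forall v, h (t v) = ratvar v.

(** Such an [x] is an integer polynomial in the [t v], and [h] sends it to the same polynomial in
    the variables, which vanishes only if all of its coefficients do. *)
Lemma ratvar_indep x : in_subring (fun z =>
  exists v, z = t v) x -> h x = 0 -> x = 0.
Proof.
move=> xt hx0.
have nz : (1 : S) != 0.
  by apply/negP => /eqP /(congr1 h); rewrite rmorph1 rmorph0 => /eqP;
    rewrite oner_eq0.
(* Evaluation of polynomials asks for a nonzero ring; [S] is one, since it maps to a field. *)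
pose S' : comNzRingType := HB.pack (GRing.ComPzRing.sort S)
  (GRing.PzSemiRing_isNonZero.Build (GRing.ComPzRing.sort S) nz).
pose h' : {rmorphism S' -> ratfun V} := h.
pose psi : {rmorphism {mpoly int[#|V|]} -> S'} :=
  mmap (intr : int -> S') (fun i => t (enum_val i) : S').
have [p psip] : exists p, psi p = x.
  elim: xt => {x hx0} [_ [v ->]||x y _ [p <-] _ [q <-]|x y _ [p <-] _ [q <-]].
  - by exists 'X_(enum_rank v); rewrite /psi /= mmapX mmap1U enum_rankK.
  - by exists 1; rewrite rmorph1.
  - by exists (p - q); rewrite rmorphB.
  - by exists (p * q); rewrite rmorphM.
have hpsi q : h' (psi q) = tofrac (map_mpoly (intr : int -> rat) q).
  rewrite /psi /map_mpoly /mmap !rmorph_sum /=; apply: eq_bigr => m _.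
  rewrite !rmorphM /= !rmorph_int !rmorph_prod; congr (_ * _).
  by apply: eq_bigr => i _; rewrite !rmorphXn /= [h _]ht /ratvar enum_valK.
have: tofrac (map_mpoly (intr : int -> rat) p) = 0 :> ratfun V.
  by rewrite -hpsi psip.
move/eqP; rewrite tofrac_eq0 => /eqP p0.
have -> : x = psi 0; last by rewrite rmorph0.
rewrite -psip; congr (psi _); apply/mpolyP => m; rewrite mcoeff0.
have := congr1 (mcoeff m) p0; rewrite mcoeff_map_mpoly mcoeff0.
by move/eqP; rewrite intr_eq0 => /eqP.
Qed.

End AlgebraicIndependence.

(** * The universal property of subtraction-free functions *)

(* A semifield has no zero: sums over possibly empty families are taken in the
   semiring obtained by adjoining one. *)
Definition sf0 (P : semifieldType) := option P.

Section SemifieldZero.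
Variable P : semifieldType.
Implicit Types x y : sf0 P.

HB.instance Definition _ := Choice.on (sf0 P).

Definition sf0_add x y : sf0 P :=
  match x, y with
  | Some a, Some b => Some (sfadd a b)
  | None, _ => y
  | _, None => x
  end.

Definition sf0_mul x y : sf0 P :=
  match x, y with Some a, Some b => Some (a * b)%g | _, _ => None end.

Lemma sf0_addA : associative sf0_add.
Proof. by move=> [x|] [y|] [z|] //=; rewrite sfaddA. Qed.

Lemma sf0_addC : commutative sf0_add.
Proof. by move=> [x|] [y|] //=; rewrite sfaddC. Qed.

Lemma sf0_add0 : left_id None sf0_add.
Proof. by case. Qed.

HB.instance Definition _ := GRing.isNmodule.Build (sf0 P) sf0_addA sf0_addC sf0_add0.

Lemma sf0_mulA : associative sf0_mul.
Proof. by move=> [x|] [y|] [z|] //=; rewrite mulgA. Qed.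

Lemma sf0_mulC : commutative sf0_mul.
Proof. by move=> [x|] [y|] //=; rewrite sfmulC. Qed.

Lemma sf0_mul1 : left_id (Some 1%g) sf0_mul.
Proof. by case=> //= x; rewrite mul1g. Qed.

Lemma sf0_mulDl : left_distributive sf0_mul sf0_add.
Proof. by move=> [x|] [y|] [z|] //=; rewrite sfmulDl. Qed.

Lemma sf0_mul0 : left_zero None sf0_mul.
Proof. by []. Qed.

Lemma sf0_one_neq0 : Some 1%g != None :> sf0 P.
Proof. by []. Qed.

HB.instance Definition _ := GRing.Nmodule_isComNzSemiRing.Build (sf0 P)
  sf0_mulA sf0_mulC sf0_mul1 sf0_mulDl sf0_mul0 sf0_one_neq0.

End SemifieldZero.

(* A subtraction-free function is a quotient of nonzero polynomials with
   coefficients in nat, that is, of nonempty lists of monomials.  As rat has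
   characteristic 0, lists with the same sum are permutations of each other, so
   that they have the same value in every semifield. *)
Section UniversalSemifield.
Variables (V : finType) (P : semifieldType) (f : V -> P).
Local Notation n := #|V|.
Implicit Types (s t : seq 'X_{1..n}) (m : 'X_{1..n}).

Definition mon_prod s t := [seq (m + m')%MM | m <- s, m' <- t].

Definition mon_poly s : {mpoly rat[n]} := \sum_(m <- s) 'X_[m].

Definition mon_val m : P := \big[*%g/1%g]_i (f (enum_val i) ^+ m i)%g.

Definition mon_vals s : sf0 P := \sum_(m <- s) (Some (mon_val m) : sf0 P).

Lemma mon_valD m m' : mon_val (m + m')%MM = (mon_val m * mon_val m')%g.
Proof. by rewrite /mon_val -big_split; apply: eq_bigr => i _;
  rewrite mnmDE expgnDr. Qed.

Lemma mon_poly_prod s t : mon_poly (mon_prod s t) = mon_poly s * mon_poly t.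
Proof.
rewrite /mon_poly /mon_prod big_allpairs_dep mulr_suml; apply: eq_bigr => m _.
by rewrite mulr_sumr; apply: eq_bigr => m' _; rewrite mpolyXD.
Qed.

Lemma mon_vals_prod s t : mon_vals (mon_prod s t) = mon_vals s * mon_vals t.
Proof.
rewrite /mon_vals /mon_prod big_allpairs_dep mulr_suml; apply: eq_bigr => m _.
by rewrite mulr_sumr; apply: eq_bigr => m' _; rewrite mon_valD.
Qed.

Lemma mon_poly_cat s t : mon_poly (s ++ t) = mon_poly s + mon_poly t.
Proof. exact: big_cat. Qed.

Lemma mon_vals_cat s t : mon_vals (s ++ t) = mon_vals s + mon_vals t.
Proof. exact: big_cat. Qed.

Lemma mon_poly_coef s m : (mon_poly s)@_m = (count_mem m s)%:R.
Proof.
elim: s => [|m' s IH]; first by rewrite /mon_poly big_nil mcoeff0.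
by rewrite /mon_poly big_cons mcoeffD IH mcoeffX -natrD.
Qed.

Lemma mon_poly_perm s t : mon_poly s = mon_poly t -> perm_eq s t.
Proof.
move=> st; apply/allP => m _ /=; have := congr1 (mcoeff m) st.
by rewrite !mon_poly_coef => /eqP; rewrite eqr_nat.
Qed.

(** The default 1 only concerns the empty list, which [mon_frac] excludes. *)
Definition mon_sum s : P := odflt 1%g (mon_vals s).

Lemma mon_sumE s : (0 < size s)%N -> mon_vals s = Some (mon_sum s).
Proof.
rewrite /mon_sum /mon_vals; case: s => // m s _; rewrite big_cons.
by case: (\sum_(_ <- _) _).
Qed.

Definition mon_frac (g : ratfun V) s t :=
  [/\ (0 < size s)%N, (0 < size t)%N & g * tofrac (mon_poly t) = tofrac (mon_poly s)].

Lemma size_mon_prod s t : (0 < size s)%N -> (0 < size t)%N -> (0 < size (mon_prod s t))%N.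
Proof. by rewrite size_allpairs muln_gt0 => -> ->. Qed.

Lemma mon_frac_uniq g s t s' t' : mon_frac g s t -> mon_frac g s' t' ->
  (mon_sum s / mon_sum t = mon_sum s' / mon_sum t')%g.
Proof.
move=> [s0 t0 e] [s0' t0' e'].
have: mon_vals (mon_prod s t') = mon_vals (mon_prod s' t).
  apply: perm_big; apply: mon_poly_perm; apply/eqP.
  rewrite !mon_poly_prod -tofrac_eq !rmorphM /= -e -e'.
  by rewrite mulrAC.
rewrite !mon_vals_prod !mon_sumE // => -[st].
apply: (mulIg (mon_sum t));
  rewrite mulgVK -mulgA [(_^-1 * _)%g]sfmulC mulgA -st.
by rewrite mulgK.
Qed.

Lemma mon_fracM g h s t s' t' : mon_frac g s t -> mon_frac h s' t' ->
  mon_frac (g * h) (mon_prod s s') (mon_prod t t').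
Proof.
move=> [s0 t0 e] [s0' t0' e']; split; rewrite ?size_mon_prod //.
by rewrite !mon_poly_prod !rmorphM /= -e -e' mulrACA.
Qed.

Lemma mon_fracD g h s t s' t' : mon_frac g s t -> mon_frac h s' t' ->
  mon_frac (g + h) (mon_prod s t' ++ mon_prod s' t) (mon_prod t t').
Proof.
move=> [s0 t0 e] [s0' t0' e']; split; rewrite ?size_mon_prod //.
  by rewrite size_cat addn_gt0 size_mon_prod.
rewrite mon_poly_cat !mon_poly_prod rmorphD !rmorphM /= -e -e' mulrDl.
by congr (_ + _); rewrite mulrA // mulrAC.
Qed.

Lemma mon_fracV g s t : g != 0 -> mon_frac g s t -> mon_frac g^-1 t s.
Proof.
by move=> g0 [s0 t0 e]; split=> //; rewrite -e mulKf.
Qed.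

Lemma sf_mon_frac g : subtraction_free g -> exists st, mon_frac g st.1 st.2.
Proof.
elim=> {g} [v||g h _ [[s t] H] _ [[s' t'] H']|g h _ [[s t] H] _ [[s' t'] H']
  |g h sg [[s t] H] sh [[s' t'] H']].
- exists ([:: U_(enum_rank v)%MM], [:: 0%MM]); split=> //=.
  by rewrite /mon_poly !big_seq1 mpolyX0 rmorph1 mulr1.
- by exists ([:: 0%MM], [:: 0%MM]); split; rewrite ?mul1r.
- by exists (mon_prod s t' ++ mon_prod s' t, mon_prod t t'); apply: mon_fracD.
- by exists (mon_prod s s', mon_prod t t'); apply: mon_fracM.
- exists (mon_prod s t', mon_prod t s'); apply: mon_fracM => //.
  by apply: mon_fracV => //; apply: subtraction_free_neq0.
Qed.

Definition usf_eval (g : usf V) : P :=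
  let st := projT1 (cid (sf_mon_frac (usf_free g))) in (mon_sum st.1 / mon_sum st.2)%g.

Lemma usf_evalE g s t : mon_frac (val g) s t -> usf_eval g = (mon_sum s / mon_sum t)%g.
Proof. by rewrite /usf_eval; case: cid => st H /= /(mon_frac_uniq H). Qed.

Lemma mon_sum_prod s t : (0 < size s)%N -> (0 < size t)%N ->
  mon_sum (mon_prod s t) = (mon_sum s * mon_sum t)%g.
Proof.
by move=> s0 t0; apply: Some_inj;
  rewrite -mon_sumE ?size_mon_prod // mon_vals_prod !mon_sumE.
Qed.

Lemma mon_sum_cat s t : (0 < size s)%N -> (0 < size t)%N ->
  mon_sum (s ++ t) = sfadd (mon_sum s) (mon_sum t).
Proof.
move=> s0 t0; apply: Some_inj; rewrite -mon_sumE ?mon_vals_cat ?mon_sumE //.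
by rewrite size_cat addn_gt0 s0.
Qed.

Lemma usf_evalM : {morph usf_eval : g h / (g * h)%g}.
Proof.
move=> g h; have [[s t] H] := sf_mon_frac (usf_free g).
have [[s' t'] H'] := sf_mon_frac (usf_free h).
have HH : mon_frac (val (g * h)%g) (mon_prod s s') (mon_prod t t').
  exact: (mon_fracM H H').
rewrite (usf_evalE H) (usf_evalE H') (usf_evalE HH);
  case: H H' => s0 t0 _ [s0' t0' _].
by rewrite !mon_sum_prod //= invgM [(_^-1 / _)%g]sfmulC; apply: Monoid.mulmACA.
Qed.

Lemma usf_evalD : {morph usf_eval : g h / sfadd g h}.
Proof.
move=> g h; have [[s t] H] := sf_mon_frac (usf_free g).
have [[s' t'] H'] := sf_mon_frac (usf_free h).
have HH : mon_frac (val (sfadd g h)) (mon_prod s t' ++ mon_prod s' t) (mon_prod t t').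
  exact: (mon_fracD H H').
rewrite (usf_evalE H) (usf_evalE H') (usf_evalE HH);
  case: H H' => s0 t0 _ [s0' t0' _].
rewrite mon_sum_cat ?size_mon_prod // !mon_sum_prod //= sfmulDl invgM.
congr sfadd; first by rewrite mulgA mulgK.
by rewrite [(_^-1 / _)%g]sfmulC mulgA mulgK.
Qed.

Lemma usf_eval_var v : usf_eval (usf_var v) = f v.
Proof.
have H : mon_frac (val (usf_var v)) [:: U_(enum_rank v)%MM] [:: 0%MM].
  by split=> //=; rewrite /mon_poly !big_seq1 mpolyX0 rmorph1 mulr1.
rewrite (usf_evalE H) /mon_sum /mon_vals !big_seq1 /=.
have -> : mon_val 0%MM = 1%g by apply: big1 => i _; rewrite mnm0E.
rewrite invg1 mulg1 /mon_val (bigD1 (enum_rank v)) //= mnm1E eqxx enum_rankK.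
rewrite big1 ?mulg1 // => i iv; rewrite mnm1E eq_sym (negPf iv).
by rewrite expg0.
Qed.

End UniversalSemifield.

(** * Quivers with labelled vertices *)

Section LabelledQuiver.
Variables (r : nat) (C : 'M[int]_r) (d : 'I_r -> nat) (l : nat).
Implicit Types (a b : 'I_r) (m n : nat) (k : int).
Hypothesis d_gt0 : forall a, (0 < d a)%N.
Hypothesis dynkinC : forall a b, dynkin C a b = dynkin C b a.
Hypothesis dynkin_d : forall a b, dynkin C a b ->
  [|| d a == d b, (d a == 1) && (1 < d b) | (d b == 1) && (1 < d a)]%N.
Let N a := (tquo d a * l)%N.
Hypothesis N_d : forall a b, (d a * N a = d b * N b)%N.

Variables (V : finType) (vb : V -> 'I_r) (vm vt : V -> nat).
Implicit Types x y z : V.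
Hypothesis vm_range : forall x, (0 < vm x < N (vb x))%N.
Hypothesis vt_lt : forall x, (vt x < (d (vb x)).*2)%N.
Hypothesis label_inj : forall x y,
  vb x = vb y -> vm x = vm y -> vt x = vt y -> x = y.
Hypothesis label_surj : forall a m n, (0 < m < N a)%N -> (n < (d a).*2)%N ->
  exists x, [/\ vb x = a, vm x = m & vt x = n].

Definition phase k x : nat := absz (((vt x)%:Z - k) %% (d (vb x)).*2%:Z)%Z.

Lemma phase_lt k x : (phase k x < (d (vb x)).*2)%N.
Proof.
rewrite /phase; have D0 : (d (vb x)).*2%:Z != 0 by have := d_gt0 (vb x); lia.
have := ltz_mod ((vt x)%:Z - k) D0; have := modz_ge0 ((vt x)%:Z - k) D0; lia.
Qed.

Lemma phaseE k x : exists q : int,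
  (vt x)%:Z - k = q * (d (vb x)).*2%:Z + (phase k x)%:Z.
Proof.
exists (((vt x)%:Z - k) %/ (d (vb x)).*2%:Z)%Z.
have D0 : (d (vb x)).*2%:Z != 0 by have := d_gt0 (vb x); lia.
by rewrite /phase gez0_abs ?modz_ge0 // -divz_eq.
Qed.

Lemma phase_unique k x (q : int) n : (n < (d (vb x)).*2)%N ->
  (vt x)%:Z - k = q * (d (vb x)).*2%:Z + n%:Z -> phase k x = n.
Proof. by move=> nD e; rewrite /phase e modzMDl modz_small //; lia. Qed.

Lemma phase0 x : phase 0 x = vt x.
Proof. by apply: (@phase_unique _ _ 0) => //; lia. Qed.

Lemma phaseS k x : phase (k + 1) x = lprev d (vb x) (phase k x).
Proof.
have [q e] := phaseE k x; have p := phase_lt k x; have d0 := d_gt0 (vb x).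
rewrite /lprev; case: eqP => p0.
  by apply: (@phase_unique _ _ (q - 1)); nia.
by apply: (@phase_unique _ _ q); lia.
Qed.

Lemma phase_inj k x y :
  vb x = vb y -> vm x = vm y -> phase k x = phase k y -> x = y.
Proof.
move=> xyb xym e; apply: label_inj => //.
have [q e1] := phaseE k x; have [q' e2] := phaseE k y.
have l1 := vt_lt x; have l2 := vt_lt y.
rewrite -xyb -?e in e2 l2; move: (d _).*2 e1 e2 l1 l2 => D e1 e2 l1 l2.
have eD : (vt x)%:Z - (vt y)%:Z = (q - q') * D%:Z by lia.
have [qq|qq] := eqVneq q q'; first by rewrite qq in eD; lia.
have [qq'|qq'] : (q - q' <= -1) \/ (1 <= q - q') by lia.
  by have : (q - q') * D%:Z <= -1 * D%:Z by [rewrite ler_wpM2r]; lia.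
by have : 1 * D%:Z <= (q - q') * D%:Z by [rewrite ler_wpM2r]; lia.
Qed.

Definition labelled k b m n x := [&& vb x == b, vm x == m & phase k x == n].
Definition lab k b m n : option V := [pick x | labelled k b m n x].

Lemma labelled_lab k x : lab k (vb x) (vm x) (phase k x) = Some x.
Proof.
rewrite /lab; case: pickP => [y /and3P[/eqP b /eqP m /eqP p]|/(_ x)].
  by rewrite (phase_inj b m p).
by rewrite /labelled !eqxx.
Qed.

Lemma lab_SomeP k b m n x :
  lab k b m n = Some x <-> [/\ vb x = b, vm x = m & phase k x = n].
Proof.
split=> [|[<- <- <-]]; last exact: labelled_lab.
by rewrite /lab; case: pickP => // y /and3P[/eqP<- /eqP<- /eqP<-] [<-].
Qed.

Lemma lab_range k b m n x : lab k b m n = Some x ->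
  (0 < m < N b)%N /\ (n < (d b).*2)%N.
Proof. by move=> /lab_SomeP[<- <- <-]; rewrite vm_range phase_lt. Qed.

Lemma lab_Some k b m n : (0 < m < N b)%N -> (n < (d b).*2)%N ->
  exists x, lab k b m n = Some x.
Proof.
move=> mN nD; have d0 := d_gt0 b.
have D0 : (d b).*2%:Z != 0 by lia.
pose t := absz ((n%:Z + k) %% (d b).*2%:Z)%Z.
have tE : t%:Z = ((n%:Z + k) %% (d b).*2%:Z)%Z by rewrite gez0_abs // modz_ge0.
have tD : (t < (d b).*2)%N by have := ltz_mod (n%:Z + k) D0; lia.
have [x [xb xm xt]] := label_surj mN tD.
exists x; apply/lab_SomeP; split=> //.
apply: (@phase_unique _ _ (- ((n%:Z + k) %/ (d b).*2%:Z)%Z)); rewrite xb //.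
by have := divz_eq (n%:Z + k) (d b).*2%:Z; rewrite xt tE; lia.
Qed.

Lemma lab_None k b m : ~~ (0 < m < N b)%N -> forall n, lab k b m n = None.
Proof.
by move=> mN n; case e: (lab k b m n) => [x|//]; have [] := lab_range e;
  rewrite (negPf mN).
Qed.

Lemma lab_time k k' b m n n' : k + n%:Z = k' + n'%:Z ->
  (n < (d b).*2)%N -> (n' < (d b).*2)%N -> lab k b m n = lab k' b m n'.
Proof.
move=> e nD n'D; suff H k1 k2 n1 n2 : k1 + n1%:Z = k2 + n2%:Z ->
   (n2 < (d b).*2)%N -> forall x, lab k1 b m n1 = Some x -> lab k2 b m n2 = Some x.
  case e1: (lab k b m n) => [x|]; first by rewrite (H _ _ _ _ e n'D _ e1).
  case e2: (lab k' b m n') => [x|//].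
  by rewrite (H _ _ _ _ (esym e) nD _ e2) in e1.
move=> {}e n2D x /lab_SomeP[xb xm xp]; apply/lab_SomeP; split=> //.
have [q eq] := phaseE k1 x.
by apply: (@phase_unique _ _ q); rewrite xb ?xp // in eq *; lia.
Qed.

Section BigLabel.
Variables (R : Type) (idx : R) (op : Monoid.com_law idx).

Lemma big_lab k b m n (F : V -> R) :
  \big[op/idx]_(x | labelled k b m n x) F x = oapp F idx (lab k b m n).
Proof.
rewrite /lab; case: pickP => [x lx|no]; last by rewrite big_pred0.
rewrite (big_pred1 x) // => y; apply/idP/eqP => [ly|->//].
move: lx ly => /and3P[/eqP xb /eqP xm /eqP xp] /and3P[/eqP yb /eqP ym /eqP yp].
by apply: (@phase_inj k); congruence.
Qed.

Lemma big_base k b (P : nat -> nat -> bool) (F : V -> R) :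
  \big[op/idx]_(x | (vb x == b) && P (vm x) (phase k x)) F x =
  \big[op/idx]_(0 <= m < N b) \big[op/idx]_(0 <= n < (d b).*2 | P m n)
    oapp F idx (lab k b m n).
Proof.
under [RHS]eq_bigr => m _ do under eq_bigr => n _ do rewrite -big_lab.
under [RHS]eq_bigr => m _.
  rewrite (exchange_big_dep (fun x => (vb x == b) && (vm x == m))) /=.
    over.
  by move=> n x _ /and3P[-> ->].
rewrite (exchange_big_dep (fun x => vb x == b)) /=;
  last by move=> m x _ /andP[].
rewrite big_mkcondr; apply: eq_bigr => x /eqP xb.
have -> : index_iota 0 (N b) = index_iota 0 (N (vb x)) by rewrite xb.
rewrite [RHS](big_rem (vm x)) ?mem_index_iota ?(andP (vm_range x)).2 //=.
rewrite xb !eqxx /= [X in op _ X]big1_seq ?Monoid.mulm1; last first.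
  move=> m /andP[/eqP<-]; rewrite mem_rem_uniqF ?iota_uniq //.
have pD := phase_lt k x; rewrite xb in pD.
have [Pmp|nP] := boolP (P _ _).
  rewrite (big_rem (phase k x)) ?mem_index_iota //= Pmp /labelled xb !eqxx /=.
  rewrite big1_seq ?Monoid.mulm1 // => n /andP[/andP[_ /eqP<-]].
  by rewrite mem_rem_uniqF ?iota_uniq.
rewrite big1 // => n /andP[Pn /and3P[_ _ /eqP pn]].
by rewrite pn Pn in nP.
Qed.

End BigLabel.

(** From long to short, [reach] is 0 at 0, which forces [m' = d a * m], and then the parity
    condition fails; from short to long, an arrow starts at time 1. *)
Lemma lout0 a m b m' n' : lout C d a m 0 b m' n' =
  [&& a == b, (m' == m.+1) || (m == m'.+1) & n' == d b]%N.
Proof.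
have db := d_gt0 b; case: (d_cases dynkin_d a b) =>
  [ab|[ab e]|[e dd]|[[e d1 d2]|[e d1 d2]]].
- by subst b; rewrite lout_same eqxx d_gt0.
- by rewrite lout_far // (negPf ab).
- have /andP[/negPf-> _] := e; rewrite lout_eqd //.
  by rewrite (_ : (0 == n' + d b)%N = false) ?andbF //; lia.
- have /andP[/negPf-> _] := e;
  rewrite lout_long // /reach min0n leqn0 absz_eq0 subr_eq0.
  by apply/negbTE; apply/and3P => -[/eqP-> /eqP[->]];
    rewrite !add0n addnn odd_double.
- by have /andP[/negPf-> _] := e; rewrite lout_short.
Qed.

(** Keeps the formal counts over labels honest: a label outside the range, which no vertex carries,
    receives no arrow from a vertex. For a long source this rests on [reach < d a] and
    [N b = d a * N a]. *)
Lemma lout_to0 a m n b m' : (0 < m < N a)%N -> lout C d a m n b m' 0 ->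
  (0 < m' < N b)%N /\ dynkin C a b.
Proof.
have db := d_gt0 b; have da := d_gt0 a; have NN := N_d a b.
case: (d_cases dynkin_d a b) => [ab|[ab e]|[e dd]|[[e d1 d2]|[e d1 d2]]] mN.
- by subst b; rewrite lout_same => /and3P[_ _]; lia.
- by rewrite lout_far.
- rewrite lout_eqd // => /and3P[/eqP<- _ _]; split=> //.
  by move: NN; rewrite dd => /eqP; rewrite eqn_pmul2l // => /eqP<-.
- rewrite lout_long // => /and3P[_ lr _]; split=> //.
  have rd : (reach (d a) n < d a)%N by rewrite /reach; lia.
  move: NN; rewrite d2 mul1n => <-; have := mN; have : (d a * m < d a * N a)%N.
    by rewrite ltn_pmul2l //; case/andP: mN.
  have : (d a * m.+1 <= d a * N a)%N by rewrite leq_pmul2l //; case/andP: mN.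
  have : (d a * 1 <= d a * m)%N by rewrite leq_pmul2l //; case/andP: mN.
  by rewrite muln1 [(d a * m.+1)%N]mulnS;
    move: (d a * N a)%N (d a * m)%N lr => X Y; lia.
- rewrite lout_short // /reach min0n leqn0 absz_eq0 subr_eq0.
  move=> /and3P[_ /eqP[mm] _]; split=> //.
  move: NN mN; rewrite d2 mul1n mm => ->; rewrite ltn_pmul2l //.
  by rewrite muln_gt0 => /andP[/andP[_ ->] ->].
Qed.

Definition qB k x y : int :=
  lB C d (vb x) (vm x) (phase k x) (vb y) (vm y) (phase k y).

Definition Mset k : {set V} := [set x | phase k x == 0%N].

Lemma qB_skew k : skew (qB k).
Proof. by move=> x y; apply: lB_anti. Qed.

Lemma mem_Mset k x : (x \in enum (Mset k)) = (phase k x == 0%N).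
Proof. by rewrite mem_enum inE. Qed.

Lemma qB_unlinked k : unlinked (qB k) (enum (Mset k)).
Proof.
move=> x y; rewrite !mem_Mset => /eqP px /eqP py.
rewrite /qB /lB px py !lout0; have dx := d_gt0 (vb x); have dy := d_gt0 (vb y).
by rewrite !(ltn_eqF dx, ltn_eqF dy) !andbF.
Qed.

Definition qout k x y : bool :=
  lout C d (vb x) (vm x) (phase k x) (vb y) (vm y) (phase k y).

(** Arrows out of a vertex to be mutated stay above the same node, whereas arrows into it come from
    adjacent nodes; hence there are no 2-cycles, and the two monomials of the exchange are the two
    terms of the T-system. *)
Lemma qB_outE k x z : phase k z = 0%N -> [/\ qB k x z = (qout k x z)%:Z - (qout k z x)%:Z,
  qB k z x = (qout k z x)%:Z - (qout k x z)%:Z & ~~ (qout k x z && qout k z x)].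
Proof.
move=> pz; split=> //; apply/andP=> -[]; rewrite /qout pz => xz.
have [_ e] := lout_to0 (vm_range x) xz; rewrite lout0 => /and3P[/eqP bz _ _].
by move: e; rewrite bz /dynkin eqxx.
Qed.

Lemma qB_mut_term k x y z : phase k z = 0%N ->
  mut_term (qB k x z) (qB k z y) =
  (qout k x z && qout k z y)%:Z - (qout k y z && qout k z x)%:Z.
Proof.
move=> pz; have [-> _ nx] := qB_outE x pz; have [_ -> ny] := qB_outE y pz.
by move: nx ny; do 4!case: qout.
Qed.

(** The middle vertex of a path must have the label [(vb y, vm y +- 1, 0)]; where that label is out
    of range, [lout_to0] shows that its term in [lpath] is 0. *)
Lemma sum_paths k x y :
  \sum_(z <- enum (Mset k)) (qout k x z && qout k z y)%:Z =
  (lpath C d (vb x) (vm x) (phase k x) (vb y) (vm y) (phase k y))%:Z.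
Proof.
rewrite big_enum /= /lpath.
have E z : phase k z = 0%N -> qout k z y =
  [&& vb z == vb y, (vm y == (vm z).+1) || (vm z == (vm y).+1) & phase k y == d (vb y)].
  by rewrite /qout => ->; rewrite lout0.
have [py|py] := eqVneq (phase k y) (d (vb y)); last first.
  by rewrite big1 // => z; rewrite inE => /eqP pz;
    rewrite E // (negPf py) !andbF.
pose F m := (lout C d (vb x) (vm x) (phase k x) (vb y) m 0)%:Z.
have one m : (if (0 < m)%N then F m else 0) =
    \sum_(z | labelled k (vb y) m 0 z) F m.
  rewrite big_lab; case: ifP => m0; last by rewrite lab_None ?m0.
  have [mN|mN] := ltnP m (N (vb y)).
    have D0 : (0 < (d (vb y)).*2)%N by rewrite double_gt0 d_gt0.
    have mr : (0 < m < N (vb y))%N by rewrite m0.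
    by have [z ->] := lab_Some k mr D0.
  rewrite lab_None /F; last by rewrite [(m < _)%N]ltnNge mN andbF.
  case lo: (lout _ _ _ _ _ _ _ _) => //.
  by have [] := lout_to0 (vm_range x) lo; lia.
have y0 := vm_range y.
transitivity (F (vm y).+1 + (if (0 < (vm y).-1)%N then F (vm y).-1 else 0));
  last first.
  rewrite PoszD; congr (_ + _); case: ifP => // y1; rewrite /F.
  case lo: (lout _ _ _ _ _ _ _ _) => //.
  by have [] := lout_to0 (vm_range x) lo; lia.
rewrite (one (vm y).-1) (one (vm y).+1 : F (vm y).+1 = _).
rewrite [LHS]big_mkcond [X in _ = X + _]big_mkcond [X in _ = _ + X]big_mkcond -big_split.
apply: eq_bigr => z _; rewrite inE /labelled.
case: (phase k z =P 0%N) => pz;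
  rewrite ?andbF ?andbT // E // py eqxx andbT /qout pz /F.
case: eqP => [->|_]; rewrite ?andbF //= ?andbT.
case: (vm z =P (vm y).+1) => [->|_].
  have -> : ((vm y).+1 == (vm y).-1) = false by lia.
  by rewrite orbT andbT addr0.
have -> : (vm y == (vm z).+1) = (vm z == (vm y).-1) by lia.
by case: eqP => [->|_]; rewrite ?andbT ?andbF ?addr0 ?add0r.
Qed.

Lemma qB_step k : mut_Bs (qB k) (enum (Mset k)) = qB (k + 1).
Proof.
apply/funext=> x; apply/funext=> y.
rewrite mut_BsE ?enum_uniq; [|done|exact: qB_unlinked].
rewrite !mem_Mset /qB !phaseS; have px := phase_lt k x; have py := phase_lt k y.
case: ifP => [p0|/norP[px0 py0]]; first by rewrite lB_flip.
rewrite /lprev (negPf px0) (negPf py0) lB_shift //; first last.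
- by case/andP: (vm_range y).
- by case/andP: (vm_range x).
- by rewrite lt0n py0.
- by rewrite lt0n px0.
rewrite -!sum_paths -[RHS]addrA -sumrB; congr (_ + _); apply: eq_big_seq => z.
by rewrite mem_Mset => /eqP pz; apply: qB_mut_term.
Qed.

Lemma mut_Bs_orbit (w : int -> V -> V -> int) : (forall k, skew (w k)) ->
    (forall k, w (k + 1) = mut_Bs (w k) (enum (Mset k))) -> w 0 = qB 0 ->
  forall k, w k = qB k.
Proof.
move=> skw wS w0 k.
apply: (evolution_unique (mut := fun B z => mut_B z B) (M := Mset)
  (inv := @skew V) (w := w) (w' := qB) _ _ skw qB_skew wS _ w0 k).
- by move=> *; apply: mut_B_skew.
- by move=> *; apply: mut_B_K.
- by move=> k'; rewrite -qB_step.
Qed.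

(** * Cluster variables and exchange relations in labels *)

Section ClusterVariables.

Let seed k := evolve (@mut_xseed V (ratfun V)) Mset (qB 0, @ratvar V) k.

Let seed0 : sf_xseed (qB 0, @ratvar V).
Proof. by split=> [|i]; [apply: qB_skew | apply: sf_var]. Qed.

Let seed_sf k : sf_xseed (seed k).
Proof. by apply: evolve_inv seed0 => w i; apply: mut_xseed_sf. Qed.

Let seedS k : seed (k + 1) = foldl (@mut_xseed V (ratfun V)) (seed k) (enum (Mset k)).
Proof.
by apply: (@evolve_step _ _ _ Mset (@sf_xseed V)) => // w i;
  [apply: mut_xseed_sf|apply: mut_xseedK].
Qed.

Let seedB k : (seed k).1 = qB k.
Proof.
apply: (mut_Bs_orbit (w := fun k => (seed k).1)) => // {}k.
  by case: (seed_sf k).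
by rewrite seedS mut_xseeds1.
Qed.

Local Notation xk := (x_at (qB 0) Mset).

Lemma xk_neq0 k x : xk k x != 0.
Proof. by have [_ /(_ x)] := seed_sf k; apply: subtraction_free_neq0. Qed.

Lemma xk_step k x :
  xk (k + 1) x = if phase k x == 0%N then mut_x x (qB k) (xk k) x else xk k x.
Proof.
rewrite [LHS](_ : _ = (seed (k + 1)).2 x) // seedS mut_xsE ?enum_uniq // seedB.
- by rewrite mem_Mset.
- exact: qB_skew.
- exact: qB_unlinked.
Qed.

Lemma exchange k z : phase k z = 0%N ->
  xk k z * xk (k + 1) z =
  \prod_(j | qout k j z) xk k j + \prod_(j | qout k z j) xk k j.
Proof.
move=> pz; rewrite xk_step pz eqxx /mut_x eqxx mulrCA mulfV ?xk_neq0 // mulr1.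
congr (_ + _).
  rewrite (eq_bigl (fun j => qout k j z)) => [|j].
    apply: eq_bigr => j jz; have [-> _] := qB_outE j pz; rewrite jz.
    by case: qout => // _; rewrite expr1.
  by have [-> _] := qB_outE j pz; do 2!case: qout.
rewrite (eq_bigl (fun j => qout k z j)) => [|j].
  apply: eq_bigr => j jz; have [-> _] := qB_outE j pz; rewrite jz.
  by case: qout => // _; rewrite expr1.
by have [-> _] := qB_outE j pz; do 2!case: qout.
Qed.

(* The exchange at time [k] turns T^(a)_m(k - d_a) into T^(a)_m(k + d_a). *)
Definition XT b m (u : int) : ratfun V :=
  oapp (xk (u + (d b)%:Z)) 1 (lab (u + (d b)%:Z) b m 0).

(** A cluster variable does not change until its next mutation, so one may wait until the phase is
    0. *)
Lemma xk_XT k x : xk k x = XT (vb x) (vm x) (k + (phase k x)%:Z - (d (vb x))%:Z).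
Proof.
move: {2}(phase k x) (erefl (phase k x)) => n; elim: n k => [|n IH] k pk.
  have := labelled_lab k x; rewrite pk => lx.
  by rewrite /XT addr0 subrK lx.
rewrite pk (_ : k + n.+1%:Z = k + 1 + n%:Z); last lia.
have pk1 : phase (k + 1) x = n by rewrite phaseS /lprev pk.
by have := IH _ pk1; rewrite pk1 => <-; rewrite xk_step pk.
Qed.

Lemma XT_lab k b m n : (n < (d b).*2)%N ->
  oapp (xk k) 1 (lab k b m n) = XT b m (k + n%:Z - (d b)%:Z).
Proof.
move=> nD; case e: (lab k b m n) => [x|] /=.
  by move: e => /lab_SomeP[<- <- <-]; rewrite -xk_XT.
by rewrite /XT subrK -(@lab_time k _ b m n) ?addr0 ?e ?double_gt0 ?d_gt0.
Qed.

(** The default of [oapp] is chosen as the boundary value 1 of the T-system. *)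
Lemma XT_out b m u : ~~ (0 < m < N b)%N -> XT b m u = 1.
Proof. by move=> mN; rewrite /XT lab_None. Qed.

End ClusterVariables.

(** * The exchange relations are the T-system *)

Section TSystem.

Local Notation xk := (x_at (qB 0) Mset).

Lemma prod_out k z : phase k z = 0%N ->
  \prod_(j | qout k z j) xk k j = XT (vb z) (vm z).-1 k * XT (vb z) (vm z).+1 k.
Proof.
move=> pz; have d0 := d_gt0 (vb z);
  have dD : (d (vb z) < (d (vb z)).*2)%N by lia.
have XE m : XT (vb z) m k = \prod_(j | labelled k (vb z) m (d (vb z)) j) xk k j.
  by rewrite big_lab XT_lab // addrK.
have z0 := vm_range z; rewrite !XE big_mkcond [X in X * _]big_mkcond.
rewrite [X in _ * X]big_mkcond -big_split; apply: eq_bigr => j _ /=.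
rewrite /qout pz lout0 /labelled [vb z == _]eq_sym.
case: (vb j =P vb z) => [->|_] /=; last by rewrite Monoid.mulm1.
case: (phase k j =P d (vb z)) => _; rewrite ?andbF ?andbT ?Monoid.mulm1 //.
have -> : (vm z == (vm j).+1) = (vm j == (vm z).-1) by lia.
case: (vm j =P (vm z).+1) => [->|_] /=; last by rewrite Monoid.mulm1.
by rewrite (_ : (_ == _) = false) ?Monoid.mul1m //; lia.
Qed.

(* Both sides are the product of the [T b m' (u + n - d b)] for [|m - d b * m'| < d b]
   and the [n] of the right parity at distance at most [d b - 1 - |m - d b * m'|] of [d b]. *)
Lemma prod_S (R : comPzRingType) (tv : nat -> int -> R) b m (u : int) :
    (forall m' v, ~~ (0 < m' < N b)%N -> tv m' v = 1) -> (m < d b * N b)%N ->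
  \prod_(0 <= m' < N b) \prod_(0 <= n < (d b).*2 |
      (absz (m%:Z - (d b * m')%:Z)%R <= reach (d b) n)%N && odd (n + m + d b * m'))
    tv m' (u + n%:Z - (d b)%:Z) =
  (\prod_(1 <= k < (m %% d b).+1)
     tv (m %/ d b).+1 (u + ((m %% d b).+1%:Z - k.*2%:Z))) *
  \prod_(1 <= k < (d b - m %% d b).+1)
     tv (m %/ d b)%N (u + ((d b - m %% d b).+1%:Z - k.*2%:Z)).
Proof.
move=> tv1 mN; have d0 := d_gt0 b.
set q := (m %/ d b)%N; set j := (m %% d b)%N; set D := d b in d0 mN *.
have jD : (j < D)%N by rewrite ltn_mod.
have mE : m = (D * q + j)%N by rewrite mulnC -divn_eq.
have qN : (q < N b)%N by rewrite ltn_divLR // mulnC.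
clearbody q j D.
pose H m' := \prod_(0 <= n < D.*2 |
      (absz (m%:Z - (D * m')%:Z)%R <= reach D n)%N && odd (n + m + D * m'))
    tv m' (u + n%:Z - D%:Z).
have H1 m' : ~~ (0 < m' < N b)%N -> H m' = 1 by move=> ?; apply: big1 => *;
  apply: tv1.
(* The extra factor at [N b] is 1; it ensures that [q.+1] lies in the range. *)
have -> : \prod_(0 <= m' < N b) H m' = \prod_(0 <= m' < (N b).+1) H m'.
  by rewrite [RHS]big_nat_recr //= (H1 (N b)) ?mulr1 // ltnn andbF.
(* Only multiples of [D] at distance less than [D] from [m = D * q + j] count: at most [D * q], at
   distance [j], and [D * q.+1], at distance [D - j]. *)
have far m' : (m' < q)%N || (q.+1 < m')%N -> H m' = 1.
  move=> m'q; apply: big_pred0 => n; apply/negbTE; apply/andP => -[+ _].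
  have : (reach D n < D)%N by rewrite /reach; lia.
  case/orP: m'q => m'q.
    have : (D * m'.+1 <= D * q)%N by rewrite leq_pmul2l.
    by rewrite mulnS; move: (D * q)%N (D * m')%N mE => X Y; lia.
  have : (D * q.+2 <= D * m')%N by rewrite leq_pmul2l.
  by rewrite !mulnS; move: (D * q)%N (D * m')%N mE => X Y; lia.
rewrite (@big_cat_nat _ _ _ q) //=; last exact: leqW (ltnW qN).
rewrite (@big_cat_nat _ _ _ q.+2 q) //=; last exact: leqW (leqnSn q).
rewrite big_nat big1 ?mul1r => [|m' m'q]; last by apply: far; lia.
rewrite [X in _ * X]big_nat [X in _ * X]big1 ?mulr1 => [|m' m'q];
  last by apply: far; lia.
rewrite [X in X = _]big_ltn 1?ltnW // [X in _ * X = _]big_ltn //.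
rewrite [X in _ * (_ * X)]big_geq // mulr1 mulrC; congr (_ * _).
  have -> : H q.+1 = \prod_(0 <= n < D.*2 | (D - j <= reach D n)%N && odd (n + (D - j)))
      tv q.+1 (u + n%:Z - D%:Z).
    apply: eq_bigl => n; rewrite mE mulnS.
    rewrite (_ : absz _ = D - j)%N; last lia.
    by congr (_ && _); lia.
  rewrite (@big_reach _ _ _ D _ (fun n =>
    tv q.+1 (u + n%:Z - D%:Z))) ?leq_subr // subKn 1?ltnW //.
  by apply: eq_big_nat => k kj; congr (tv _ _); lia.
have -> : H q = \prod_(0 <= n < D.*2 | (j <= reach D n)%N && odd (n + j))
    tv q (u + n%:Z - D%:Z).
  apply: eq_bigl => n; rewrite mE.
  rewrite (_ : absz _ = j)%N; last lia.
  by congr (_ && _); lia.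
rewrite (@big_reach _ _ _ D _ (fun n => tv q (u + n%:Z - D%:Z))) 1?ltnW //.
by apply: eq_big_nat => k kj; congr (tv _ _); lia.
Qed.

(** Sorted by node, the arrows into [z] come from a single vertex above [b] unless [b] is longer
    than [vb z]; in that case they fill a tent, and [prod_S] turns the product into S. *)
Lemma prod_in k z : phase k z = 0%N ->
  \prod_(j | qout k j z) xk k j =
  \prod_(b | dynkin C b (vb z))
    if (1 < d (vb z))%N then XT b (d (vb z) * vm z %/ d b)%N k
    else (\prod_(1 <= i < (vm z %% d b).+1)
           XT b (vm z %/ d b).+1 (k + ((vm z %% d b).+1%:Z - i.*2%:Z))) *
         \prod_(1 <= i < (d b - vm z %% d b).+1)
           XT b (vm z %/ d b)%N (k + ((d b - vm z %% d b).+1%:Z - i.*2%:Z)).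
Proof.
move=> pz; have z0 := vm_range z; set a := vb z in z0 *; set m := vm z in z0 *.
have qz j : qout k j z = lout C d (vb j) (vm j) (phase k j) a m 0.
  by rewrite /qout pz.
rewrite (partition_big vb (fun b => dynkin C b a)) /=; last first.
  by move=> j; rewrite qz => /(lout_to0 (vm_range j)) [].
apply: eq_bigr => b ba; have db := d_gt0 b; have da := d_gt0 a.
have lab1 m' n' : (n' < (d b).*2)%N -> (forall j, vb j = b -> qout k j z = (vm j == m') && (phase k j == n')) ->
    \prod_(j | qout k j z && (vb j == b)) xk k j = XT b m' (k + n'%:Z - (d b)%:Z).
  move=> nD H; rewrite -XT_lab // -(@big_lab _ 1 *%R); apply: eq_bigl => j.
  by rewrite /labelled andbC; case: eqP => // /H.
case/or3P: (dynkin_d ba) => [/eqP dd|/andP[/eqP db1 da1]|/andP[/eqP da1 db1]].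
- case: ifP => da1.
    rewrite dd mulKn // (lab1 m (d b)) ?dd ?addrK //; first lia.
    by move=> j jb; rewrite qz jb lout_eqd // da add0n.
  have da1' : d a = 1%N by lia.
  rewrite dd da1' modn1 divn1 subn0 big_geq // big_nat1 mul1r.
  rewrite (lab1 m 1%N) ?dd ?da1' //; first by congr (XT _ _ _); lia.
  by move=> j jb; rewrite qz jb lout_eqd // da1'.
- rewrite da1 db1 divn1 (lab1 (d a * m)%N 1%N) ?db1 ?addrK //.
  move=> j jb; rewrite qz jb lout_short // /reach min0n leqn0 absz_eq0 subr_eq0.
  rewrite eqz_nat; case: (vm j =P (d a * m)%N) => [->|_]; rewrite ?andbF //.
  case: (phase k j =P 1%N) => [->|//] /=.
  by rewrite addn0 addnn odd_double.
rewrite da1 /= -(@prod_S _ (fun m' v => XT b m' v) b m k); last 2 first.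
- by move=> m' v; apply: XT_out.
- by rewrite -(N_d a b) da1 mul1n; case/andP: z0.
pose P m' n := (absz (m%:Z - (d b * m')%:Z)%R <= reach (d b) n)%N && odd (n + m + d b * m').
rewrite (eq_bigl (fun j => (vb j == b) && P (vm j) (phase k j))).
  rewrite big_base; apply: eq_bigr => m' _;
    rewrite big_nat_cond [RHS]big_nat_cond.
  by apply: eq_bigr => n /andP[/andP[_ nD] _]; rewrite XT_lab.
move=> j; rewrite andbC; case: eqP => //= jb; rewrite qz jb lout_long //.
by rewrite addn0.
Qed.

Definition Tgen (g : Tindex d l + Tindex d l) : ratfun V :=
  match g with
  | inl g => XT (idx_a g) (idx_m g) (idx_u g)
  | inr g => (XT (idx_a g) (idx_m g) (idx_u g))^-1
  end.

Lemma reval_Tm b m u : reval Tgen (Tm d l b m u) = XT b m u.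
Proof.
rewrite /Tm; case: insubP => [g _ e|nr] /=.
  by rewrite /idx_a /idx_m /idx_u e.
by rewrite XT_out.
Qed.

Lemma XT_neq0 b m u : XT b m u != 0.
Proof.
rewrite /XT; case: (lab _ _ _ _) => [x|] /=;
  [exact: xk_neq0 | exact: oner_neq0].
Qed.

Lemma reval_prod (G : Type) (R : comPzRingType) (f : G -> R) (J : Type)
    (t : seq J) (Q : pred J) (F : J -> rexpr G) :
  reval f (\big[@RMul _/ROne]_(j <- t | Q j) F j) =
  \prod_(j <- t | Q j) reval f (F j).
Proof. exact: (big_morph (reval f)). Qed.

Lemma reval_Sm b m u : reval Tgen (Sm d l b m u) =
  (\prod_(1 <= i < (m %% d b).+1)
     XT b (m %/ d b).+1 (u + ((m %% d b).+1%:Z - i.*2%:Z))) *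
  \prod_(1 <= i < (d b - m %% d b).+1)
     XT b (m %/ d b)%N (u + ((d b - m %% d b).+1%:Z - i.*2%:Z)).
Proof.
rewrite /Sm /= !reval_prod; congr (_ * _);
  by apply: eq_bigr => i _; rewrite reval_Tm.
Qed.

Lemma Tgen_relation e e' : T_relation C e e' -> reval Tgen e = reval Tgen e'.
Proof.
case=> [g a m u|g] /=; last by rewrite mulfV ?XT_neq0.
have mN : (0 < m < N a)%N by case: (g) @a @m @u.
have dD : (0 < (d a).*2)%N by rewrite double_gt0.
have [z lz] := lab_Some u mN dD; have /lab_SomeP[za zm pz] := lz.
rewrite !reval_Tm -za -zm -prod_out // [RHS]addrC.
have -> : reval Tgen (T_nbr C d l (vb z) (vm z) u) = \prod_(j | qout u j z) xk u j.
  rewrite prod_in // /T_nbr; case: ifP => _; rewrite reval_prod.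
    by apply: eq_bigr => b _; rewrite reval_Tm.
  by apply: eq_bigr => b _; rewrite reval_Sm.
(* After the mutation the phase is [2d - 1], so the new variable is T at
   [u + 1 + (2d - 1) - d = u + d]. *)
rewrite -exchange // !xk_XT pz addr0 phaseS /lprev pz /=; congr (_ * XT _ _ _).
by have := d_gt0 (vb z); lia.
Qed.

End TSystem.

(** * Injectivity on the T-ring *)

Section TRing.

Local Notation TR := (T_ring C d l).
Local Notation pgen := (pres_gen (@T_relation r C d l)).

Definition tau b m (u : int) : TR := reval pgen (Tm d l b m u).

Lemma tau_out b m u : ~~ (0 < m < N b)%N -> tau b m u = 1.
Proof. by move=> mN; rewrite /tau /Tm insubN. Qed.

Lemma tau_gen (g : Tindex d l) : tau (idx_a g) (idx_m g) (idx_u g) = pgen (inl g).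
Proof. by rewrite /tau /Tm; case: g => -[[a m] u] ? /=; rewrite insubT. Qed.

Lemma tau_sys a m (k : int) : (0 < m < N a)%N ->
  tau a m (k - (d a)%:Z) * tau a m (k + (d a)%:Z) =
  tau a m.-1 k * tau a m.+1 k + reval pgen (T_nbr C d l a m k).
Proof.
move=> mN; pose g : Tindex d l := exist _ (a, m, k) mN.
exact: (presring_rel (T_sys C g)).
Qed.

(** The generators here are the T^(a)_m(u) with [- d_a <= u < d_a], the lifts of the variables [x]
    at time 0. *)
Definition tau_init := in_subring (fun z : TR => exists x,
  z = tau (vb x) (vm x) ((phase 0 x)%:Z - (d (vb x))%:Z)).

(* Up to units, every element of the T-ring is an integer polynomial in the
   initial variables; hence the T-ring injects into the rational functions, and
   the Laurent phenomenon is not needed. *)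
Definition tau_loc (p : TR) := exists W W', [/\ W * W' = 1, tau_init W & tau_init (W * p)].

Lemma tau_loc_init p : tau_init p -> tau_loc p.
Proof. by move=> ip; exists 1, 1; rewrite !mul1r; split=> //;
  apply: in_subring_one. Qed.

Lemma tau_loc1 : tau_loc 1.
Proof. by apply: tau_loc_init; apply: in_subring_one. Qed.

Lemma tau_locM p q : tau_loc p -> tau_loc q -> tau_loc (p * q).
Proof.
move=> [W [W' [WW' iW iWp]]] [X [X' [XX' iX iXq]]]; exists (W * X), (W' * X').
rewrite mulrACA WW' XX' mulr1 [W * X * _]mulrACA.
by split=> //; apply: in_subring_mul.
Qed.

Lemma tau_locB p q : tau_loc p -> tau_loc q -> tau_loc (p - q).
Proof.
move=> [W [W' [WW' iW iWp]]] [X [X' [XX' iX iXq]]]; exists (W * X), (W' * X').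
rewrite mulrACA WW' XX' mulr1 mulrBr; split=> //; first exact: in_subring_mul.
rewrite mulrAC -[W * X * q]mulrA; apply: in_subring_sub; exact: in_subring_mul.
Qed.

Lemma tau_locN p : tau_loc p -> tau_loc (- p).
Proof.
move=> kp; rewrite -sub0r; apply: tau_locB => //.
by rewrite -(subrr 1); apply: tau_locB; apply: tau_loc1.
Qed.

Lemma tau_locD p q : tau_loc p -> tau_loc q -> tau_loc (p + q).
Proof. by move=> kp kq; rewrite -[q]opprK; apply: tau_locB => //;
  apply: tau_locN. Qed.

(** The unit [W * p] works as a multiplier for [q], as it sends [q] to [W]. It is for this step that
    the multiplier itself has to lie in [tau_init]. *)
Lemma tau_locV p q : p * q = 1 -> tau_loc p -> tau_loc q.
Proof.
move=> pq [W [W' [WW' iW iWp]]]; exists (W * p), (W' * q).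
by rewrite mulrACA WW' pq mulr1 -mulrA pq mulr1; split.
Qed.

Lemma tau_unit b m u : exists q, tau b m u * q = 1.
Proof.
rewrite /tau /Tm; case: insubP => [g _ _|_]; last by exists 1; rewrite mulr1.
by exists (pgen (inr g)); apply: (presring_rel (T_inv C g)).
Qed.

(** The window holds the times of the T carried by the vertices at time [k], one for each phase. *)
Definition tau_seed (k : int) := forall b m u,
  k - (d b)%:Z <= u -> u < k + (d b)%:Z -> tau_loc (tau b m u).

Lemma tau_seed0 : tau_seed 0.
Proof.
move=> b m u u1 u2; have [mN|mN] := boolP (0 < m < N b)%N; last first.
  by rewrite tau_out //; apply: tau_loc1.
have nD : (absz (u + (d b)%:Z)%R < (d b).*2)%N by lia.
have [x /lab_SomeP[xb xm xp]] := lab_Some 0 mN nD.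
apply: tau_loc_init; apply: in_subring_gen; exists x; rewrite xb xm xp.
by congr (tau _ _ _); lia.
Qed.

Lemma tau_loc_nbr a m (k : int) :
    (forall b m' u, k - (d b)%:Z < u -> u < k + (d b)%:Z -> tau_loc (tau b m' u)) ->
  tau_loc (reval pgen (T_nbr C d l a m k)).
Proof.
move=> H; rewrite /T_nbr; case: ifP => _; rewrite reval_prod;
  apply: big_ind => [||b _]; try exact: tau_loc1; try exact: tau_locM.
  by apply: H; have := d_gt0 b; lia.
rewrite /Sm /= !reval_prod; have jD : (m %% d b < d b)%N by rewrite ltn_mod.
by apply: tau_locM; rewrite big_nat; apply: big_ind => [||i /andP[i1 i2]];
  try exact: tau_loc1; try exact: tau_locM; apply: H; lia.
Qed.

(** The right-hand side of the T-system at [k] only involves times at distance less than [d b] from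
    [k], which belong to both windows. The relation thus trades one end, [k - d b] or [k + d b], for
    the other, since both are units. *)
Lemma tau_seedS k : tau_seed k <-> tau_seed (k + 1).
Proof.
have rhs a m (S : tau_seed k \/ tau_seed (k + 1)) : tau_loc
    (tau a m.-1 k * tau a m.+1 k + reval pgen (T_nbr C d l a m k)).
  have H b m' u : k - (d b)%:Z < u -> u < k + (d b)%:Z -> tau_loc (tau b m' u).
    by move=> u1 u2; case: S => S; apply: S; lia.
  have da := d_gt0 a; apply: tau_locD; last exact: tau_loc_nbr.
  by apply: tau_locM; apply: H; lia.
split=> S b m u u1 u2; have [mN|mN] := boolP (0 < m < N b)%N;
  try by rewrite tau_out //; apply: tau_loc1.
- have [uk|uk] := ltP u (k + (d b)%:Z); first by apply: S; lia.
  have -> : u = k + (d b)%:Z by lia.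
  have [q tq] := tau_unit b m (k - (d b)%:Z).
  have kq : tau_loc q by apply: (tau_locV tq); apply: S; have := d_gt0 b; lia.
  rewrite -[tau _ _ _]mul1r -tq mulrAC tau_sys // mulrC.
  by apply: tau_locM => //; apply: rhs; left.
- have [uk|uk] := leP (k + 1 - (d b)%:Z) u; first by apply: S; lia.
  have -> : u = k - (d b)%:Z by lia.
  have [q tq] := tau_unit b m (k + (d b)%:Z).
  have kq : tau_loc q by apply: (tau_locV tq); apply: S; have := d_gt0 b; lia.
  rewrite -[tau _ _ _]mulr1 -tq mulrA tau_sys //.
  by apply: tau_locM => //; apply: rhs; right.
Qed.

Lemma tau_loc_tau b m u : tau_loc (tau b m u).
Proof.
have S k : tau_seed k.
  elim/int_ind: k => [|k IH|k IH]; first exact: tau_seed0.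
    by rewrite -addn1 PoszD; apply: (tau_seedS k).1.
  by apply: (tau_seedS _).2; rewrite (_ : _ + 1 = - k%:Z) //; lia.
by apply: (S u); have := d_gt0 b; lia.
Qed.

Lemma tau_loc_all p : tau_loc p.
Proof.
elim/quotW: p => e; rewrite -presring_eval.
elim: e => [[g|g]|||x IHx y IHy|x IHx|x IHx y IHy] /=.
- by rewrite -tau_gen; apply: tau_loc_tau.
- by apply: (tau_locV (presring_rel (T_inv C g))); rewrite /= -tau_gen;
  apply: tau_loc_tau.
- by rewrite -(subrr 1); apply: tau_locB; apply: tau_loc1.
- exact: tau_loc1.
- exact: tau_locD.
- exact: tau_locN.
- exact: tau_locM.
Qed.

Lemma T_iso : ring_isomorphic (T_ring_pos C d l) (T_subalgebra (qB 0) Mset).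
Proof.
have [h [[h1 hD hM hg] _]] := presring_univ Tgen_relation.
have h0 : h 0 = 0 by apply: (addrI (h 0)); rewrite -hD !addr0.
have hB : zmod_morphism h.
  move=> x y; apply: (addIr (h y)); rewrite -hD !subrK //.
have hMm : monoid_morphism h by split.
pose H : {rmorphism TR -> ratfun V} := HB.pack h
  (GRing.isZmodMorphism.Build _ _ h hB) (GRing.isMonoidMorphism.Build _ _ h hMm).
have htau b m u : h (tau b m u) = XT b m u.
  rewrite /tau /Tm; case: insubP => [g _ e|nr] /=.
    by rewrite hg /= /idx_a /idx_m /idx_u e.
  by rewrite h1 XT_out.
apply: (gen_subring_iso (h := H)).
- move=> _ [g ->]; rewrite /= hg /= /XT; case: (lab _ _ _ _) => [x|] /=.
    by apply: in_subring_gen; exists (idx_u g + (d (idx_a g))%:Z), x.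
  exact: in_subring_one.
- move=> _ [k [x ->]]; exists (tau (vb x) (vm x) (k + (phase k x)%:Z - (d (vb x))%:Z)).
    apply: in_subring_gen; rewrite /tau /Tm; case: insubP => [g _ _|];
      first by exists g.
    by rewrite /= vm_range.
  by rewrite /= htau -xk_XT.
(* Injectivity: a unit multiple of [p] is a polynomial in the initial variables, whose images are
   independent. *)
move=> p hp; have [W [W' [WW' iW iWp]]] := tau_loc_all p.
have Wp0 : W * p = 0.
  apply: (ratvar_indep (h := H) _ iWp); last by rewrite rmorphM hp mulr0.
  by move=> x; rewrite /= htau -{1}[(phase 0 x)%:Z]add0r -xk_XT.
by rewrite -[p]mul1r -WW' mulrAC Wp0 mul0r.
Qed.

End TRing.

(** * The factors of y over one period *)

Section YSystem.
Variables (P : semifieldType) (f : Tindex d l -> P).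

Definition Yv b m (u : int) : P := seval f (Ym d l b m u).

Definition Yfac k x : P :=
  \big[*%g/1%g]_(z <- enum (Mset k)) mut_fac (qB k z x) (Yv (vb z) (vm z) k).

Lemma seval_prod (J : Type) (t : seq J) (Q : pred J) (F : J -> sexpr (Tindex d l)) :
  seval f (\big[@SMul _/SOne]_(j <- t | Q j) F j) =
  \big[*%g/1%g]_(j <- t | Q j) seval f (F j).
Proof. exact: (big_morph (seval f)). Qed.

Lemma big_mutated k b (F : nat -> P) :
  \big[*%g/1%g]_(z | (vb z == b) && (phase k z == 0%N)) F (vm z) =
  \big[*%g/1%g]_(1 <= m < N b) F m.
Proof.
rewrite (@big_base _ 1%g *%g k b (fun _ n => n == 0%N) (fun z => F (vm z))).
have D0 : (0 < (d b).*2)%N by rewrite double_gt0.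
have inner m : \big[*%g/1%g]_(0 <= n < (d b).*2 | n == 0%N)
    oapp (fun z => F (vm z)) 1%g (lab k b m n) =
    oapp (fun z => F (vm z)) 1%g (lab k b m 0).
  by rewrite big_ltn_cond //= big_nat_cond big1 ?mulg1 // => n; lia.
under eq_bigr => m _ do rewrite inner.
have [N0|N0] := posnP (N b); first by rewrite N0 !big_geq.
rewrite big_ltn // lab_None //= mul1g; apply: eq_big_nat => m mN.
by have [z lz] := lab_Some k mN D0; rewrite lz /=;
  have /lab_SomeP[_ -> _] := lz.
Qed.

Lemma phase_after k x n : phase k x = 0%N -> (0 < n < (d (vb x)).*2)%N ->
  phase (k + n%:Z) x = ((d (vb x)).*2 - n)%N.
Proof.
move=> p0 nD; have [q e] := phaseE k x; rewrite p0 in e.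
by apply: (@phase_unique _ _ (q - 1)); lia.
Qed.

Lemma phase_period k x : phase k x = 0%N -> phase (k + (d (vb x)).*2%:Z) x = 0%N.
Proof.
move=> p0; have [q e] := phaseE k x; rewrite p0 in e.
by have d0 := d_gt0 (vb x); apply: (@phase_unique _ _ (q - 1)); lia.
Qed.

Lemma mut_facN1 (w : P) : mut_fac (-1) w = sfadd 1%g w.
Proof. by rewrite /mut_fac /= expg1. Qed.

(** The share of the node [b] in one period of a vertex mutated at time [k], whose phase at time
    [k + n] is [2 d_a - n]. *)
Definition Ynbr_fac a m k b : P :=
  \big[*%g/1%g]_(1 <= n < (d a).*2) \big[*%g/1%g]_(1 <= m' < N b)
    mut_fac (lB C d b m' 0 a m ((d a).*2 - n)) (Yv b m' (k + n%:Z)).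

Lemma Yfac_split k x : phase k x = 0%N ->
  \big[*%g/1%g]_(1 <= n < (d (vb x)).*2) Yfac (k + n%:Z) x =
  \big[*%g/1%g]_b Ynbr_fac (vb x) (vm x) k b.
Proof.
move=> p0; rewrite /Ynbr_fac exchange_big /=; apply: eq_big_nat => n nD.
rewrite /Yfac big_enum /= (partition_big vb xpredT) //=.
apply: eq_bigr => b _; rewrite -(big_mutated (k + n%:Z)).
apply: eq_big => z; rewrite inE andbC //.
by move=> /andP[/eqP zb /eqP zp]; rewrite /qB zp phase_after // zb.
Qed.

(** The labels [(a, m +- 1, 0)] only point to phase [d a], reached half-way through the period. The
    entry is 1, and [sf_divN] rewrites the factor. *)
Lemma Ynbr_fac_same a m k : (0 < m < N a)%N ->
  Ynbr_fac a m k a = (seval f (Ym1V d l a m.-1 (k + (d a)%:Z)) *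
    seval f (Ym1V d l a m.+1 (k + (d a)%:Z)))^-1%g.
Proof.
move=> mN; have da := d_gt0 a; rewrite /Ynbr_fac.
have lBE m' p : lB C d a m' 0 a m p = (((m == m'.+1) || (m' == m.+1)) && (p == d a))%:Z.
  rewrite /lB !lout_same d_gt0 add0n /=.
  by rewrite (_ : (0 == p + d a)%N = false) ?andbF ?subr0 //; lia.
rewrite (big_nat_only _ (p := d a)); first 1 last.
- by lia.
- move=> n nD nd; rewrite big1 // => m' _; rewrite lBE.
  by rewrite (_ : (_ - n == d a)%N = false) ?andbF ?mut_fac0 //; lia.
pose G m' := (seval f (Ym1V d l a m' (k + (d a)%:Z)))^-1%g.
have G1 m' : ~~ (0 < m' < N a)%N -> G m' = 1%g.
  by move=> m'N; rewrite /G /Ym1V insubN // invg1.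
transitivity (\big[*%g/1%g]_(1 <= m' < N a)
    ((if m' == m.-1 then G m' else 1) * (if m' == m.+1 then G m' else 1)))%g.
  apply: eq_big_nat => m' m'N; rewrite lBE.
  rewrite (_ : (_ - d a == d a)%N) ?andbT; last lia.
  have GE : G m' = mut_fac 1 (Yv a m' (k + (d a)%:Z)).
    by rewrite /G /Ym1V /Yv /Ym insubT /mut_fac /= expg1 sf_divN.
  case: (m' =P m.-1) => [e|ne].
    have -> : (m == m'.+1) by lia.
    have -> : (m' == m.+1) = false by lia.
    by rewrite mulg1 GE.
  case: (m' =P m.+1) => [e|_].
    by rewrite orbT mul1g GE.
  by rewrite (_ : (_ == _) = false) ?mul1g ?mut_fac0 //; lia.
rewrite big_split -!big_mkcond !big_nat1_eq invgM sfmulC; congr (_ * _)%g.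
  by case: ifP => // nr; apply/esym/G1; lia.
by case: ifP => // nr; apply/esym/G1; lia.
Qed.

Lemma mut_fac_nbr a m p b m' (w : P) : dynkin C b a ->
  mut_fac (lB C d b m' 0 a m p) w =
  if lout C d a m p b m' 0 then sfadd 1%g w else 1%g.
Proof.
move=> ba; have /andP[/negPf ab _] := ba.
rewrite /lB lout0 ab sub0r; case: lout => /=; first exact: mut_facN1.
exact: (mut_fac0 w).
Qed.

Lemma Ynbr_fac_eqd a m k b : dynkin C b a -> d b = d a -> (0 < m < N a)%N ->
  Ynbr_fac a m k b = sfadd 1%g (Yv b m (k + (d a)%:Z)).
Proof.
move=> ba dd mN; have da := d_gt0 a; rewrite /Ynbr_fac.
have ab : dynkin C a b by rewrite dynkinC.
have NN : N b = N a by apply/eqP; rewrite -(eqn_pmul2l da) -{1}dd (N_d b a).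
rewrite (big_nat_only _ (p := d a)); first 1 last.
- by lia.
- move=> n nD nd; rewrite big1 // => m' _; rewrite mut_fac_nbr // lout_eqd //.
  by case: ifP => //; lia.
rewrite (big_nat_only _ (p := m)); first 1 last.
- by rewrite NN.
- by move=> m' m'N m'm; rewrite mut_fac_nbr // lout_eqd // eq_sym (negPf m'm).
rewrite mut_fac_nbr // lout_eqd // eqxx dd da (_ : (_ == _) = true) //; lia.
Qed.

(** A long vertex mutated now has reach 0 and so meets [a] only at [m = d b * m']: this is the
    divisibility condition of the Y-system. *)
Lemma Ynbr_fac_short a m k b : dynkin C b a -> (1 < d b)%N -> d a = 1%N ->
    (0 < m < N a)%N ->
  Ynbr_fac a m k b =
  if (d b %| m)%N then sfadd 1%g (Yv b (m %/ d b) (k + 1)) else 1%g.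
Proof.
move=> ba db da mN; rewrite /Ynbr_fac da big_nat1.
have ab : dynkin C a b by rewrite dynkinC.
have E m' : mut_fac (lB C d b m' 0 a m (1.*2 - 1)) (Yv b m' (k + 1)) =
    if m == (d b * m')%N then sfadd 1%g (Yv b m' (k + 1)) else 1%g.
  rewrite mut_fac_nbr // lout_short // /reach min0n leqn0 absz_eq0 subr_eq0 eqz_nat.
  by case: (m =P _) => // ->; rewrite addn0 -addnA addnn /= odd_double.
under eq_bigr => m' _ do rewrite E.
case: ifP => dm.
  rewrite (big_nat_only _ (p := m %/ d b)%N);
    first by rewrite mulnC divnK ?eqxx.
    have := N_d a b; rewrite da mul1n => NN; have /andP[m0 m1] := mN.
    by rewrite divn_gt0 ?(ltnW db) // dvdn_leq //= ltn_divLR ?(ltnW db) // mulnC -NN.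
  move=> m' _ m'p; case: eqP => // e.
  by move: m'p; rewrite e mulKn ?(ltnW db) // eqxx.
rewrite big1 // => m' _; case: eqP => // e; by rewrite e dvdn_mulr in dm.
Qed.

(** Sorted by [m']: at distance [s] from [d a * m] there are [d a - s] mutations linked to the
    vertex, at the times listed by [big_reach]. They form the inner product of Z with
    [j = m' - d a * m]. *)
Lemma Ynbr_fac_long a m k b : dynkin C b a -> (1 < d a)%N -> d b = 1%N ->
    (0 < m < N a)%N ->
  Ynbr_fac a m k b = seval f (Zm d l b (d a) m (k + (d a)%:Z)).
Proof.
move=> ba da db mN; have ab : dynkin C a b by rewrite dynkinC.
have NN : N b = (d a * N a)%N by rewrite (N_d a b) db mul1n.
rewrite /Ynbr_fac exchange_big /=; set D := d a in da NN *; set u := k + D%:Z.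
pose H m' s := \big[*%g/1%g]_(1 <= i < (D - s).+1)
   sfadd 1%g (Yv b m' (u + ((D - s).+1%:Z - i.*2%:Z))).
transitivity (\big[*%g/1%g]_(1 <= m' < N b)
    H m' (minn D (absz (m'%:Z - (D * m)%:Z)%R))).
  apply: eq_big_nat => m' m'N; set s := absz _.
  transitivity (\big[*%g/1%g]_(1 <= n < D.*2 | (s <= reach D n)%N && odd (n + s))
      sfadd 1%g (Yv b m' (k + n%:Z))).
    rewrite [RHS]big_mkcond; apply: eq_big_nat => n nD;
      rewrite mut_fac_nbr // lout_long //=.
    have -> : odd (D.*2 - n + 0 + m' + D * m) = odd (n + s).
      have sE : odd s = odd (m' + D * m).
        by rewrite /s; move: (D * m)%N => Dm; lia.
      by rewrite addn0 -addnA oddD oddB ?odd_double 1?ltnW ?(andP nD).2 // -sE oddD.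
    by case ons: (odd _); rewrite ?andbF // !andbT reach_rev.
  have rD n : (reach D n < D)%N by rewrite /reach; lia.
  rewrite /H; have [sD|Ds] := leqP s D; last first.
    rewrite subnn [RHS]big_geq // big_pred0 // => n.
    by rewrite leqNgt (ltn_trans (rD n) Ds).
  have D20 : (0 < D.*2)%N by rewrite double_gt0 d_gt0.
  transitivity (\big[*%g/1%g]_(0 <= n < D.*2 | (s <= reach D n)%N && odd (n + s))
      sfadd 1%g (Yv b m' (k + n%:Z))).
    rewrite [RHS]big_ltn_cond // ifF //; apply/negbTE.
    by rewrite /reach min0n leqn0; case: (s) => [|?].
  rewrite (@big_reach _ _ *%g D s (fun n => sfadd 1%g (Yv b m' (k + n%:Z)))) //.
  by apply: eq_big_nat => i iD; congr (sfadd _ (Yv _ _ _)); rewrite /u; lia.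
have /andP[m0 m1] := mN.
have mD : (D <= D * m)%N by rewrite leq_pmulr.
have mD' : (D * m + D <= N b)%N by rewrite NN -mulnSr leq_pmul2l ?d_gt0.
have HD m' : (D <= absz (m'%:Z - (D * m)%:Z)%R)%N ->
    H m' (minn D (absz (m'%:Z - (D * m)%:Z)%R)) = 1%g.
  by move=> Dm; rewrite (minn_idPl Dm) /H subnn big_geq.
(* What remains is [m'] strictly between [D * m - D] and [D * m + D], that is, the range of [j] in
   Z. *)
rewrite (@big_cat_nat _ _ _ (1 + (D * m - D))) //=; last by lia.
rewrite (@big_cat_nat _ _ _ (D * m + D) (1 + (D * m - D))) //=; last by lia.
rewrite big_nat big1 ?mul1g => [|m' m'D]; last by apply: HD; lia.
rewrite [X in (_ * X)%g]big_nat [X in (_ * X)%g]big1 ?mulg1 => [|m' m'D];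
  last by apply: HD; lia.
rewrite big_addn (_ : D * m + D - (D * m - D) = D.*2)%N; last by lia.
rewrite /Zm seval_prod big_map /index_iota subn1.
apply: eq_big_seq => i; rewrite mem_iota => iD; rewrite seval_prod.
have -> : absz ((i + (D * m - D))%N%:Z - (D * m)%:Z)%R = absz (i%:Z - D%:Z)%R.
  by congr absz; lia.
rewrite (minn_idPr _); last by lia.
apply: eq_big_nat => j jD; rewrite /= /Yv.
by congr (sfadd _ (seval f (Ym d l b _ _))); lia.
Qed.

Lemma Yfac_cycle k x : phase k x = 0%N ->
  let a := vb x in let m := vm x in let u := k + (d (vb x))%:Z in
  \big[*%g/1%g]_(1 <= n < (d a).*2) Yfac (k + n%:Z) x =
  seval f (Y_nbr C d l a m u / (Ym1V d l a m.-1 u * Ym1V d l a m.+1 u))%sx.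
Proof.
move=> p0 a m u; have mN := vm_range x; rewrite Yfac_split // (bigD1 a) //=.
rewrite Ynbr_fac_same // sfmulC; congr (_ * _)%g.
rewrite (bigID (fun b => dynkin C b a)) /= [X in (_ * X)%g]big1 ?mulg1;
  last first.
  move=> b /andP[ba nba]; rewrite /Ynbr_fac big1 // => n _;
    rewrite big1 // => m' _.
  by rewrite /lB !lout_far ?subr0 ?mut_fac0 // 1?eq_sym // dynkinC.
transitivity (\big[*%g/1%g]_(b | dynkin C b a) Ynbr_fac a m k b).
  by apply: eq_bigl => b; rewrite andb_idl // => /andP[].
rewrite /Y_nbr; have da0 := d_gt0 a; case: ifP => da.
  rewrite seval_prod; apply: eq_bigr => b ba.
  case/or3P: (dynkin_d ba) => [/eqP dd|/andP[/eqP db _]|/andP[/eqP da1 _]];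
    last first.
  - by rewrite da1 in da.
  - by rewrite Ynbr_fac_long // db divn1.
  rewrite Ynbr_fac_eqd // dd divnn da0 /Zm seval_prod /= big_seq1 seval_prod /= big_nat1.
  by rewrite /= mul1n addr0 /Yv; congr (sfadd _ (seval f (Ym d l b _ _))); lia.
rewrite seval_prod [RHS]big_mkcondr; apply: eq_bigr => b ba.
have da1 : d a = 1%N by lia.
have db0 := d_gt0 b; case: (ltngtP 1%N (d b)) => db; last 2 first.
- by lia.
- by rewrite -db dvd1n divn1 Ynbr_fac_eqd -?db ?da1 // /u da1.
by rewrite Ynbr_fac_short // /u da1; case: ifP.
Qed.

End YSystem.

(** * From a solution of the Y-system to a y-pattern *)

Section YSolution.
Variables (P : semifieldType) (f : Tindex d l -> P).

Lemma Yv_out b m u : ~~ (0 < m < N b)%N -> Yv f b m u = 1%g.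
Proof. by move=> mN; rewrite /Yv /Ym insubN. Qed.

Lemma Yv_gen (g : Tindex d l) : Yv f (idx_a g) (idx_m g) (idx_u g) = f g.
Proof. by rewrite /Yv /Ym; case: g => -[[a m] u] ? /=; rewrite insubT. Qed.

Lemma Yfac_telescope (s : int -> V -> P) x k n : (phase k x + n < (d (vb x)).*2)%N ->
    (forall k, phase k x != 0%N -> s (k + 1) x = (s k x * Yfac f k x)%g) ->
    phase k x = 0%N -> (0 < n)%N ->
  s (k + n.+1%:Z) x = (s (k + 1) x * \big[*%g/1%g]_(1 <= i < n.+1) Yfac f (k + i%:Z) x)%g.
Proof.
move=> + sS p0; rewrite p0 add0n; elim: n => // n IH nD _.
rewrite (_ : k + n.+2%:Z = k + n.+1%:Z + 1); last by lia.
rewrite sS; last by rewrite phase_after //; lia.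
rewrite [in RHS]big_nat_recr //= mulgA; congr (_ * _)%g.
by case: n IH nD => [_ _|n IH nD]; [rewrite big_geq // mulg1|apply: IH => //;
  lia].
Qed.

Lemma Yfac_full_turn (s : int -> V -> P) x k :
    (forall k, phase k x != 0%N -> s (k + 1) x = (s k x * Yfac f k x)%g) ->
    phase k x = 0%N ->
  s (k + (d (vb x)).*2%:Z) x =
  (s (k + 1) x * \big[*%g/1%g]_(1 <= i < (d (vb x)).*2) Yfac f (k + i%:Z) x)%g.
Proof.
move=> sS p0; have d0 := d_gt0 (vb x);
  have e : ((d (vb x)).*2 = ((d (vb x)).*2.-1).+1)%N by lia.
by rewrite e Yfac_telescope //; lia.
Qed.

Hypothesis f_rel : forall e e', Y_relation C e e' -> seval f e = seval f e'.

(* Between two mutations at [x], the variable y_x is multiplied by [Yfac] at each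
   time step; so a solution of the Y-system determines the whole y-pattern. *)
Definition Yseed k x : P :=
  (Yv f (vb x) (vm x) (k + (phase k x)%:Z) *
   \big[*%g/1%g]_(0 <= i < phase k x) (Yfac f (k + i%:Z) x)^-1)%g.

Lemma Yseed_phase0 k x : phase k x = 0%N -> Yseed k x = Yv f (vb x) (vm x) k.
Proof. by move=> p0; rewrite /Yseed p0 big_geq // mulg1 addr0. Qed.

Lemma Yseed_step k x : phase k x != 0%N -> Yseed (k + 1) x = (Yseed k x * Yfac f k x)%g.
Proof.
move=> p0; rewrite /Yseed phaseS /lprev (negPf p0).
have [p pE] : exists p, phase k x = p.+1 by exists (phase k x).-1; lia.
rewrite pE /= big_nat_recl // addr0 (_ : k + 1 + p%:Z = k + p.+1%:Z);
  last by lia.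
rewrite -mulgA; congr (_ * _)%g; rewrite sfmulC mulgA mulgV mul1g.
by apply: eq_bigr => i _; rewrite (_ : k + 1 + i%:Z = k + i.+1%:Z) //; lia.
Qed.

(** This is where the Y-system enters: over one period the factors multiply to Y(k) Y(k + 2d), while
    they lead from the value just after the mutation to Y(k + 2d). *)
Lemma Yseed_flip k x : phase k x = 0%N -> Yseed (k + 1) x = (Yseed k x)^-1%g.
Proof.
move=> p0; have := Yfac_full_turn (fun k => @Yseed_step k x) p0.
rewrite Yseed_phase0 ?phase_period // => e.
apply: (mulgI (Yseed k x)); rewrite mulgV.
apply: (mulIg (\big[*%g/1%g]_(1 <= i < (d (vb x)).*2) Yfac f (k + i%:Z) x)).
rewrite mul1g -mulgA -e Yfac_cycle // Yseed_phase0 //.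
pose g : Tindex d l := exist _ (vb x, vm x, k + (d (vb x))%:Z) (vm_range x).
have := f_rel (Y_sys C g); rewrite /= /idx_a /idx_m /idx_u /= addrK => <-.
by rewrite /Yv; congr (_ * seval f (Ym d l _ _ _))%g; lia.
Qed.

Lemma Yseed_orbit k : (qB (k + 1), Yseed (k + 1)) =
  foldl (@mut_yseed V P) (qB k, Yseed k) (enum (Mset k)).
Proof.
rewrite [RHS]surjective_pairing mut_yseeds1 /= qB_step; congr pair.
apply/funext => x; rewrite mut_ysE ?enum_uniq //; last exact: qB_unlinked.
rewrite mem_Mset; case: eqP => [p0|/eqP p0]; first exact: Yseed_flip.
rewrite Yseed_step //=; congr (_ * _)%g; apply: eq_big_seq => z.
by rewrite mem_Mset => /eqP pz; rewrite Yseed_phase0.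
Qed.

End YSolution.

Lemma sf_morph_expg (P Q : semifieldType) (g : P -> Q) :
  {morph g : p q / (p * q)%g} -> forall p n, g (p ^+ n)%g = (g p ^+ n)%g.
Proof.
move=> gM p n; have g1 : g 1%g = 1%g by apply: (mulgI (g 1%g));
  rewrite -gM !mulg1.
by elim: n => [|n IH]; rewrite ?expg0 // !expgS gM IH.
Qed.

Lemma mut_yseeds_morph (P Q : semifieldType) (g : P -> Q) (w : yseed V P) s :
    {morph g : x y / (x * y)%g} -> {morph g : x y / sfadd x y} ->
  foldl (@mut_yseed V Q) (w.1, g \o w.2) s =
  ((foldl (@mut_yseed V P) w s).1, g \o (foldl (@mut_yseed V P) w s).2).
Proof.
move=> gM gD; have g1 : g 1%g = 1%g by apply: (mulgI (g 1%g));
  rewrite -gM !mulg1.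
have gV p : g p^-1%g = (g p)^-1%g by apply: (mulgI (g p)); rewrite -gM !mulgV.
elim: s w => [|z s IH] w //=; rewrite -(IH (mut_yseed w z));
  congr (foldl _ _ s).
rewrite /mut_yseed /=; congr pair; apply/funext => x /=.
rewrite /mut_y; case: ifP => _; first by rewrite gV.
case: ifP => _; rewrite gM (sf_morph_expg gM); first by rewrite gM gV gD g1.
by rewrite gD g1.
Qed.

(** * The isomorphism of the Y-groups *)

Section YIso.

Let yorb k := evolve (@mut_yseed V (usf V)) Mset (qB 0, @usf_var V) k.

Local Notation yk := (y_at (qB 0) Mset).

Let skew1 (P : semifieldType) (w : yseed V P) := skew w.1.

Let yorb_skew k : skew (yorb k).1.
Proof.
apply: (@evolve_inv _ _ _ Mset (@skew1 (usf V))) => [w i|].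
  exact: mut_yseed_skew.
exact: qB_skew.
Qed.

Let yorbS k : yorb (k + 1) = foldl (@mut_yseed V (usf V)) (yorb k) (enum (Mset k)).
Proof.
apply: (@evolve_step _ _ _ Mset (@skew1 (usf V))) => [w i|w i|].
- exact: mut_yseed_skew.
- exact: mut_yseedK.
- exact: qB_skew.
Qed.

Let yorbB k : (yorb k).1 = qB k.
Proof.
apply: (mut_Bs_orbit (w := fun k => (yorb k).1)) => // {}k.
by rewrite yorbS mut_yseeds1.
Qed.

Definition YT b m (u : int) : usf V := oapp (yk u) 1%g (lab u b m 0).

Definition Ygen (g : Tindex d l) : usf V := YT (idx_a g) (idx_m g) (idx_u g).

Lemma Yv_YT b m u : Yv Ygen b m u = YT b m u.
Proof.
have [mN|mN] := boolP (0 < m < N b)%N; last by rewrite Yv_out // /YT lab_None.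
by rewrite /Yv /Ym insubT.
Qed.

Lemma YT_yk k x : phase k x = 0%N -> YT (vb x) (vm x) k = yk k x.
Proof. by move=> p0; have := labelled_lab k x; rewrite p0 /YT => ->. Qed.

Lemma yk_flip k x : phase k x = 0%N -> yk (k + 1) x = (yk k x)^-1%g.
Proof.
move=> p0; rewrite [LHS](_ : _ = (yorb (k + 1)).2 x) // yorbS mut_ysE ?enum_uniq //.
  by rewrite mem_Mset p0.
by rewrite yorbB; apply: qB_unlinked.
Qed.

Lemma yk_step k x : phase k x != 0%N -> yk (k + 1) x = (yk k x * Yfac Ygen k x)%g.
Proof.
move=> p0; rewrite [LHS](_ : _ = (yorb (k + 1)).2 x) // yorbS mut_ysE ?enum_uniq //.
  rewrite mem_Mset (negPf p0) yorbB; congr (_ * _)%g; apply: eq_big_seq => z.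
  by rewrite mem_Mset => /eqP pz; rewrite Yv_YT YT_yk.
by rewrite yorbB; apply: qB_unlinked.
Qed.

(** The period runs from the mutation at [u - d a] to the one at [u + d a]; it starts from the
    inverse of y at [u - d a], which passes to the left-hand side. *)
Lemma Ygen_relation e e' : Y_relation C e e' -> seval Ygen e = seval Ygen e'.
Proof.
case=> g a m u; have mN : (0 < m < N a)%N by case: (g) @a @m @u.
have dD : (0 < (d a).*2)%N by rewrite double_gt0.
have [z /lab_SomeP[za zm pz]] := lab_Some (u - (d a)%:Z) mN dD.
have := Yfac_cycle Ygen pz; rewrite /= za zm subrK => <-.
transitivity (Yv Ygen a m (u - (d a)%:Z) * Yv Ygen a m (u + (d a)%:Z))%g => //.
have e1 : YT a m (u - (d a)%:Z) = yk (u - (d a)%:Z) z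
  by rewrite -(YT_yk pz) za zm.
have e2 : YT a m (u + (d a)%:Z) = yk (u - (d a)%:Z + (d (vb z)).*2%:Z) z.
  rewrite -(YT_yk (phase_period pz)) za zm; congr (YT _ _ _); lia.
rewrite !Yv_YT e1 e2 (Yfac_full_turn (s := yk) (fun k => @yk_step k z) pz) za.
by rewrite yk_flip // mulgA mulgV mul1g.
Qed.

Lemma Y_iso : group_isomorphic (Y_group C d l) (Y_subgroup (qB 0) Mset).
Proof.
have [h [[hM hD hg] _]] := pressf_univ Ygen_relation.
have h1 : h 1%g = 1%g by apply: (mulgI (h 1%g)); rewrite -hM !mulg1.
have hV p : h p^-1%g = (h p)^-1%g by apply: (mulgI (h p)); rewrite -hM !mulgV.
pose YS := Y_semifield C d l;
  pose gen : Tindex d l -> YS := pressf_gen (@Y_relation r C d l).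
have gen_rel e e' : Y_relation C e e' -> seval gen e = seval gen e'
  by apply: pressf_rel.
pose A (z : YS) := exists g, z = gen g \/ z = sfadd 1%g (gen g).
apply: (gen_subgroup_iso (A := A) (h := h)) => //.
- move=> p [g gE].
  have mN : (0 < idx_m g < N (idx_a g))%N by case: (g).
  have dD : (0 < (d (idx_a g)).*2)%N by rewrite double_gt0.
  have [z lz] := lab_Some (idx_u g) mN dD; have /lab_SomeP[_ _ pz] := lz.
  have hgE : h (gen g) = yk (idx_u g) z by rewrite hg /Ygen /YT lz.
  apply: in_subgroup_gen; case: gE => ->; [left|right];
    exists (idx_u g), z => //.
  by rewrite hD h1 hgE inE pz.
- pose im (p : usf V) := exists2 q, in_subgroup A q & h q = p.
  have im1 : im 1%g by exists 1%g => //; apply: in_subgroup_one.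
  have imM (q q' : usf V) : im q -> im q' -> im (q * q')%g.
    move=> [x' x'A <-] [y' y'A <-]; exists (x' * y')%g => //.
    exact: in_subgroup_mul.
  have imV (q : usf V) : im q -> im q^-1%g.
    move=> [x' x'A <-]; exists x'^-1%g; rewrite ?hV // -[x'^-1%g]mul1g.
    by apply: in_subgroup_div => //; apply: in_subgroup_one.
  have imX (n : nat) (q : usf V) : im q -> im (q ^+ n)%g.
    by move=> iq; elim: n => [|n IH]; rewrite ?expg0 // expgS; apply: imM.
  have im0 k x : phase k x = 0%N -> im (yk k x) /\ im (sfadd 1%g (yk k x)).
    move=> p0; pose g : Tindex d l := exist _ (vb x, vm x, k) (vm_range x).
    have hgE : h (gen g) = yk k x
      by rewrite hg /Ygen /idx_a /idx_m /idx_u /= YT_yk.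
    split; first by exists (gen g) => //; apply: in_subgroup_gen; exists g;
      left.
    exists (sfadd 1%g (gen g)); last by rewrite hD h1 hgE.
    by apply: in_subgroup_gen; exists g; right.
  have im_fac k x : im (Yfac Ygen k x).
    rewrite /Yfac big_seq; apply: big_ind => // z.
    rewrite mem_Mset Yv_YT => /eqP pz; rewrite YT_yk //;
      have [iz iz1] := im0 k z pz.
    by rewrite /mut_fac; case: ifP => _; apply: imX => //; apply: imM => //;
      apply: imV.
  (* Between mutations, y is recovered from its value at the next mutation by dividing by the
     factors collected on the way. *)
  have im_all k x : im (yk k x).
    move: {2}(phase k x) (erefl (phase k x)) => n; elim: n k => [|n IH] k pk.
      by case: (im0 k x pk).
    have p0 : phase k x != 0%N by rewrite pk.
    have -> : yk k x = (yk (k + 1) x * (Yfac Ygen k x)^-1)%g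
      by rewrite yk_step // mulgK.
    apply: imM; last exact: imV.
    by apply: IH; rewrite phaseS /lprev pk.
  move=> _ [[k [x ->]]|[k [x [xM ->]]]]; first exact: im_all.
  case/orP: xM; rewrite inE => /eqP p0; first by case: (im0 k x p0).
  have [i0 i1] := im0 _ _ p0.
  (* Just after a mutation y is the inverse of a former [w], and [1 + w^-1] is the inverse of
     [w / (1 + w)]. *)
  rewrite -[k](subrK 1) yk_flip // -[sfadd _ _]invgK -sf_divN.
  by apply: (imV); apply: imM => //; apply: imV.
(* The left inverse: [gen] is the tautological solution of the Y-system in its own semifield, and
   [G] evaluates functions at the initial seed of its y-pattern. *)
pose eta := Yseed gen; pose G := usf_eval (eta 0).
have GM : {morph G : x y / (x * y)%g} by apply: usf_evalM.
have GD : {morph G : x y / sfadd x y} by apply: usf_evalD.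
have orbit k : ((yorb k).1, G \o (yorb k).2) = (qB k, eta k).
  apply: (@evolution_unique _ _ (@mut_yseed V YS) Mset (@skew1 YS) _ _
    (fun k => ((yorb k).1, G \o (yorb k).2)) (fun k => (qB k, eta k))).
  - exact: mut_yseed_skew.
  - exact: mut_yseedK.
  - exact: yorb_skew.
  - exact: qB_skew.
  - by move=> k'; rewrite yorbS mut_yseeds_morph.
  - by move=> k'; apply: Yseed_orbit.
  - congr pair; apply/funext => x /=; exact: usf_eval_var.
have Gyk k x : G (yk k x) = eta k x.
  by have := congr1 (fun w => w.2 x) (orbit k).
have Ghg g : G (h (gen g)) = gen g.
  have mN : (0 < idx_m g < N (idx_a g))%N by case: (g).
  have dD : (0 < (d (idx_a g)).*2)%N by rewrite double_gt0.
  have [z lz] := lab_Some (idx_u g) mN dD; have /lab_SomeP[za zm pz] := lz.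
  by rewrite hg /Ygen /YT lz /= Gyk /eta Yseed_phase0 // za zm Yv_gen.
have [k0 [_ kU]] := pressf_univ gen_rel.
have GhK p : G (h p) = p.
  (* [G \o h] and [id] are both the unique endomorphism fixing the generators. *)
  rewrite -[LHS]/((G \o h) p) -(kU (G \o h)); last first.
    by split=> [x' y'|x' y'|g] /=; rewrite ?hM ?hD.
  by rewrite (kU id).
exact: can_inj GhK.
Qed.

End YIso.

End LabelledQuiver.

(** * The labels of the quiver of a tamely laced Cartan matrix *)

Section CartanFacts.
Variables (r : nat) (C : 'M[int]_r) (d : 'I_r -> nat).
Hypotheses (C_cartan : cartan C) (d_symm : symmetrizer C d) (C_tame : tamely_laced C d).
Implicit Types a b : 'I_r.

Lemma cartan_d_gt0 a : (0 < d a)%N.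
Proof. by case: d_symm. Qed.

Lemma cartan_symm a b : (d a)%:Z * C a b = (d b)%:Z * C b a.
Proof.
have [_ /matrixP/(_ b a) + _] := d_symm; rewrite !mxE.
rewrite (bigD1 a) //= big1 => [|i /negPf ia]; last first.
  by rewrite !mxE eq_sym ia mulr0n mul0r.
rewrite (bigD1 b) //= big1 => [|i /negPf ib]; last first.
  by rewrite !mxE eq_sym ib mulr0n mul0r.
by rewrite !mxE !eqxx !mulr1n !addr0.
Qed.

Lemma cartan_dynkinC a b : dynkin C a b = dynkin C b a.
Proof.
rewrite /dynkin eq_sym; case: eqP => //= /eqP ba.
have [_ /(_ a b) ab0 /(_ a b) [abba baab]] := C_cartan.
have [_ /(_ b a ba) ba0 _] := C_cartan; rewrite eq_sym in ba;
  have {}ab0 := ab0 ba.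
rewrite !lt_neqAle ab0 ba0 !andbT; congr (~~ _).
by apply/eqP/eqP => [/abba|/baab].
Qed.

(** If [C a b < -1], tameness gives [d a = 1] and [C b a = -1], whence [d b = - C a b > 1]; if both
    entries are -1, symmetry gives [d a = d b]. *)
Lemma cartan_dynkin_d a b : dynkin C a b ->
  [|| d a == d b, (d a == 1) && (1 < d b) | (d b == 1) && (1 < d a)]%N.
Proof.
move=> ab; have := ab; rewrite cartan_dynkinC => /andP[_ ba0].
have /andP[_ ab0] := ab; have sy := cartan_symm a b.
have da := cartan_d_gt0 a; have db := cartan_d_gt0 b.
have [ab1|ab1] := ltP (C a b) (-1).
  have [da1 ba1] := C_tame ab1; rewrite da1 in sy *.
  have ba1' : C b a = -1 by lia.
  by rewrite ba1' in sy; lia.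
have [ba1|ba1] := ltP (C b a) (-1).
  have [db1 ab1'] := C_tame ba1; rewrite db1 in sy *.
  have ab2 : C a b = -1 by lia.
  by rewrite ab2 in sy; lia.
have e1 : C a b = -1 by lia.
have e2 : C b a = -1 by lia.
by rewrite e1 e2 in sy; lia.
Qed.

Lemma d_dvd_tlcm a : (d a %| tlcm d)%N.
Proof. by rewrite /tlcm (bigD1 a) //= dvdn_lcml. Qed.

Lemma d_tquo a : (d a * tquo d a = tlcm d)%N.
Proof. by rewrite mulnC /tquo divnK // d_dvd_tlcm. Qed.

Lemma tlcm_gt0 : (0 < tlcm d)%N.
Proof.
rewrite /tlcm; apply: (big_ind (fun n => 0 < n)%N) => // [m n m0 n0|a _].
  by rewrite lcmn_gt0 m0.
exact: cartan_d_gt0.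
Qed.

Lemma even_dynkinC : ssrbool.symmetric (even_dynkin C d).
Proof. by move=> a b; rewrite /even_dynkin cartan_dynkinC [X in _ && X]andbC. Qed.

Lemma block_eq a b : b \in block C d a -> block C d b = block C d a.
Proof.
rewrite inE => ab; apply/setP => b'; rewrite !inE.
by rewrite (same_connect (sym_connect_sym even_dynkinC) ab).
Qed.

Lemma block_even a b : b \in block C d a -> odd (d b) = odd (d a).
Proof.
rewrite inE => /connectP[p pa ->]; elim: p a pa => //= a' p IH a /andP[+ pa'].
by rewrite IH // => /and3P[_ /negPf-> /negPf->].
Qed.

Lemma block_nonbip a b : b \in block C d a -> in_nonbip C d b = in_nonbip C d a.
Proof. by move=> ab; rewrite /in_nonbip (block_even ab) (block_eq ab). Qed.

Lemma nonbip_even a : in_nonbip C d a -> ~~ odd (d a).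
Proof. by case/andP. Qed.

(** * Colours on nonbipartite even blocks *)

Section Colours.
Variable c : tvertex C d -> colour.
Hypothesis c_proper : proper_colouring c.

Definition isbeta (e : colour) : bool := if e is beta then true else false.

Lemma tadj_isbeta v w : tadj v w -> ~~ odd (dv v) -> ~~ odd (dv w) ->
  isbeta (c w) = ~~ isbeta (c v).
Proof. by move=> vw ov ow; have := c_proper vw ov ow; case: (c v);
  case: (c w). Qed.

Lemma nbvertex_subproof a (t : bool) :
  in_nonbip C d a -> isSome (Some t) == in_nonbip C d a.
Proof. by move=> ->. Qed.

Definition nbvertex a (s t : bool) (nb : in_nonbip C d a) : tvertex C d :=
  exist _ (a, s, Some t) (nbvertex_subproof t nb).

Lemma nbvertex_tadj a b s t (na : in_nonbip C d a) (nb : in_nonbip C d b) :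
  dynkin C a b -> tadj (nbvertex s t na) (nbvertex s (~~ t) nb).
Proof.
move=> ab; rewrite /tadj /base /eps /del /dv /= ab (negPf (nonbip_even na)) /= eqxx /=.
by apply/implyP => _; case: (t).
Qed.

(** Lifting the path with alternating third components gives adjacent vertices, so the colours
    alternate too. The relation [e] is a parameter because the lemma serves for an odd cycle and for
    a path leading to it, which use different relations. *)
Lemma nbvertex_path a s t (na : in_nonbip C d a) (e : rel 'I_r) p :
    {in block C d a &, forall b b', e b b' -> dynkin C b b'} ->
    {in block C d a, forall b b', e b b' -> b' \in block C d a} ->
    forall b (nb : in_nonbip C d b), b \in block C d a -> path e b p ->
  forall nl : in_nonbip C d (last b p),
  isbeta (c (nbvertex s (t (+) odd (size p)) nl)) =
  isbeta (c (nbvertex s t nb)) (+) odd (size p).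
Proof.
move=> e_dynkin e_block; elim: p t => [|b' p IH] t b nb ab /=.
  by move=> _ nl; rewrite !addbF (bool_irrelevance nl nb).
move=> /andP[bb' pp] nl; have ab' := e_block _ ab _ bb'.
have nb' : in_nonbip C d b' by rewrite (block_nonbip ab').
have E : t (+) ~~ odd (size p) = ~~ t (+) odd (size p) by rewrite addbN addNb.
rewrite E (IH (~~ t) b' nb' ab' pp nl).
have bb'C := nbvertex_tadj s t nb nb' (e_dynkin _ _ ab ab' bb').
by rewrite (tadj_isbeta bb'C) ?(nonbip_even nb) ?(nonbip_even nb') //= addbN addNb.
Qed.

(** Going around an odd cycle leads to the other third component after an odd number of colour
    changes; a path from [a] to the cycle carries this over to [a]. *)
Lemma nbvertex_flip a s t (na : in_nonbip C d a) :
  isbeta (c (nbvertex s (~~ t) na)) = ~~ isbeta (c (nbvertex s t na)).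
Proof.
have /andP[oa /asboolP nb] := na; apply: contrapT => nG;
  apply: nb => -[|x p] //.
move=> /andP[/= cyc _]; apply/negP => od; apply: nG.
set e := (fun _ : 'I_r => _) in cyc.
have xa : x \in block C d a by case: (p) cyc => [|y p'] /= /andP[/and3P[]].
have nx : in_nonbip C d x by rewrite (block_nonbip xa).
have lx : last x (rcons p x) = x by rewrite last_rcons.
have turn t' : isbeta (c (nbvertex s (~~ t') nx)) = ~~ isbeta (c (nbvertex s t' nx)).
  have nl : in_nonbip C d (last x (rcons p x)) by rewrite lx.
  have := nbvertex_path s t' na _ _ nx xa cyc nl.
  rewrite size_rcons [odd _]od !addbT => <-.
  - by congr (isbeta (c _)); apply/val_inj; rewrite /= lx.
  - by move=> b b' _ _ /and3P[].
  - by move=> b _ b' /and3P[].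
have := xa; rewrite inE => /connectP[q aq xq].
have even_block : {in block C d a, forall b b', even_dynkin C d b b' -> b' \in block C d a}.
  by move=> b + b' bb'; rewrite !inE => ab;
    apply: connect_trans ab (connect1 bb').
have even_edge : {in block C d a &, forall b b', even_dynkin C d b b' -> dynkin C b b'}.
  by move=> b b' _ _ /and3P[].
have aa : a \in block C d a by rewrite inE connect0.
have nl : in_nonbip C d (last a q) by rewrite -xq.
have lE t' : nbvertex s t' nl = nbvertex s t' nx by apply/val_inj;
  rewrite /= xq.
have E1 := nbvertex_path s t na even_edge even_block na aa aq nl.
have E2 := nbvertex_path s (~~ t) na even_edge even_block na aa aq nl.
move: E2; rewrite addNb lE turn -lE E1.
by case: (odd _); case: (isbeta _); case: (isbeta _).
Qed.

Lemma nbvertexE v (nv : in_nonbip C d (base v)) :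
  exists t, del v = Some t /\ v = nbvertex (eps v) t nv.
Proof.
have := valP v; rewrite -/(base v) nv; case e: (val v).2 => [t|] // _.
exists t; split=> //; apply/val_inj; rewrite /= -e /base /eps.
by rewrite -!surjective_pairing.
Qed.

Lemma nonbip_colour v w : base v = base w -> eps v = eps w -> in_nonbip C d (base v) ->
  (isbeta (c v) == isbeta (c w)) = (del v == del w).
Proof.
move=> bvw evw nv; have nw : in_nonbip C d (base w) by rewrite -bvw.
have [t [vt vE]] := nbvertexE nv; have [t' [wt wE]] := nbvertexE nw.
have {}wE : w = nbvertex (eps v) t' nv by rewrite wE; apply/val_inj;
  rewrite /= bvw evw.
have cv : c v = c (nbvertex (eps v) t nv) by rewrite -vE.
rewrite vt wt wE cv; have [->|tt'] := eqVneq t t'; first by rewrite !eqxx.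
have -> : t' = ~~ t by case: t t' tt' {vt wt vE wE cv} => -[].
by rewrite nbvertex_flip; case: isbeta; case: (t).
Qed.

(** * The first mutation time as a label *)

Section Phases.
Variable l : nat.
Local Notation V := (qvertex C d l).
Implicit Types x y : V.

(** The step [p] of a half-period at which row [i] is mutated: it solves [i = p + 1] for odd [i] and
    [i = D - p] for even [i]. For even [D], a row of each parity shares the same [p]. *)
Definition qcore (D i : nat) : nat := if odd i then i.-1 else (D - i)%N.

(* The time of the first mutation at [x], from time 0 on. *)
Definition theta x : nat :=
  (qcore (dv (qv x)) (qi x) + (if vsign c x then 0 else dv (qv x))
   + (~~ odd (dv (qv x)) && ~~ eps (qv x)))%N.

Lemma qi_range x : (0 < qi x <= dv (qv x))%N.
Proof. by have /andP[/andP[]] := valP x. Qed.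

Lemma qi_odd x : in_nonbip C d (base (qv x)) -> odd (qi x).
Proof. by have /andP[/andP[_ /implyP]] := valP x. Qed.

Lemma qm_range x : (0 < qm x < tquo d (base (qv x)) * l)%N.
Proof. by have /andP[] := valP x. Qed.

Lemma dv_gt0 (v : tvertex C d) : (0 < dv v)%N.
Proof. exact: cartan_d_gt0. Qed.

Lemma vsignE x : vsign c x = (~~ odd (qi x + qm x) ==
  (if odd (dv (qv x)) then eps (qv x) else isbeta (c (qv x)))).
Proof. by []. Qed.

Lemma qcore_lt D i : (0 < i <= D)%N -> (qcore D i < D)%N.
Proof. by rewrite /qcore; case: ifP => oi; lia. Qed.

Lemma qcore_lt_even D i : ~~ odd D -> (0 < i <= D)%N -> ((qcore D i).+1 < D)%N.
Proof. by rewrite /qcore; case: ifP => oi; lia. Qed.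

Lemma qcore_even D i : ~~ odd D -> (0 < i <= D)%N -> ~~ odd (qcore D i).
Proof. by rewrite /qcore; case: ifP => oi; lia. Qed.

Lemma qcore_odd D i : odd D -> (0 < i <= D)%N -> odd (qcore D i) = ~~ odd i.
Proof. by rewrite /qcore; case: ifP => oi; lia. Qed.

Lemma qcore_inj D i j : (0 < i <= D)%N -> (0 < j <= D)%N -> qcore D i = qcore D j ->
  odd D || (odd i == odd j) -> i = j.
Proof. by rewrite /qcore; case: ifP => oi; case: ifP => oj; lia. Qed.

Lemma theta_sign x : vsign c x = (theta x < dv (qv x))%N.
Proof.
have iD := qi_range x; have lt := qcore_lt iD; rewrite /theta.
case: vsign; last by lia.
have [oD|oD] := boolP (odd (dv (qv x))); first by lia.
by have := qcore_lt_even oD iD; lia.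
Qed.

Lemma theta_lt x : (theta x < (dv (qv x)).*2)%N.
Proof.
have iD := qi_range x; have lt := qcore_lt iD; rewrite /theta.
have [oD|oD] := boolP (odd (dv (qv x))); first by case: vsign; lia.
by have := qcore_lt_even oD iD; case: vsign; lia.
Qed.

(** The label does not name the copy: here and in [theta_even] it is read off from parities, as is
    the sign from the half-period in [theta_sign]. *)
Lemma theta_odd x : odd (dv (qv x)) -> eps (qv x) = odd (qm x + theta x).
Proof.
move=> oD; have := vsignE x; rewrite oD /theta.
have := qcore_odd oD (qi_range x); rewrite oD /=.
case: vsign; case: eps; lia.
Qed.

Lemma theta_even x : ~~ odd (dv (qv x)) -> eps (qv x) = ~~ odd (theta x).
Proof.
move=> oD; rewrite /theta; have := qcore_even oD (qi_range x); rewrite oD /=.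
case: vsign; case: eps; lia.
Qed.

Lemma qcore_theta x : qcore (dv (qv x)) (qi x) =
  (theta x - (if vsign c x then 0 else dv (qv x)) - (~~ odd (dv (qv x)) && ~~ eps (qv x)))%N.
Proof. rewrite /theta; lia. Qed.

Lemma tvertex_eq (v w : tvertex C d) : base v = base w -> eps v = eps w ->
  (in_nonbip C d (base v) -> del v = del w) -> v = w.
Proof.
move=> bvw evw dvw; apply/val_inj.
rewrite [val v]surjective_pairing [val w]surjective_pairing.
rewrite [(val v).1]surjective_pairing [(val w).1]surjective_pairing.
rewrite -/(base v) -/(base w) -/(eps v) -/(eps w) -/(del v) -/(del w) bvw evw.
have [nv|nv] := boolP (in_nonbip C d (base v)); first by rewrite dvw.
have := valP v; have := valP w; rewrite -/(base v) -/(base w) -bvw (negPf nv).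
rewrite -/(del v) -/(del w); by case: (del v); case: (del w).
Qed.

Lemma qvertex_eq x y : qv x = qv y -> qi x = qi y -> qm x = qm y -> x = y.
Proof.
move=> v i m; apply/val_inj.
rewrite [val x]surjective_pairing [val y]surjective_pairing.
rewrite [(val x).1]surjective_pairing [(val y).1]surjective_pairing.
by congr (_, _, _) => //; apply/val_inj.
Qed.

(** For even length the core leaves the row or the copy ambiguous, and the sign decides. Outside
    nonbipartite blocks it gives the parity of [i]; inside them [i] is odd, and the sign gives the
    colour, hence the third component. *)
Lemma qvertex_sigma x y : base (qv x) = base (qv y) -> eps (qv x) = eps (qv y) ->
    qcore (dv (qv x)) (qi x) = qcore (dv (qv y)) (qi y) ->
    vsign c x (+) odd (qm x) = vsign c y (+) odd (qm y) -> qv x = qv y /\ qi x = qi y.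
Proof.
move=> bxy exy; have dxy : dv (qv x) = dv (qv y) by rewrite /dv bxy.
have ix := qi_range x; have iy := qi_range y; rewrite dxy in ix *.
move=> cxy; rewrite !vsignE dxy exy.
have [oD|oD] := boolP (odd (dv (qv y))) => sxy.
  split; last by apply: qcore_inj cxy _; rewrite ?oD.
  apply: tvertex_eq => // nv; have := nonbip_even nv.
  by rewrite -/(dv (qv x)) dxy oD.
have [nv|nv] := boolP (in_nonbip C d (base (qv x))).
  have ox := qi_odd nv; have oy : odd (qi y) by apply: qi_odd; rewrite -bxy.
  split; last by apply: qcore_inj cxy _; rewrite ?ox ?oy ?orbT.
  apply: tvertex_eq => // _; apply/eqP; rewrite -nonbip_colour //.
  by move: sxy; rewrite !oddD ox oy; do 2!case: isbeta; do 2!case: (odd (qm _)).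
have vxy : qv x = qv y by apply: tvertex_eq => //; rewrite (negPf nv).
split=> //; apply: qcore_inj cxy _; rewrite // (negPf oD) /=.
move: sxy; rewrite vxy !oddD.
by case: isbeta; do 2!case: (odd (qm _)); do 2!case: (odd (qi _)).
Qed.

Lemma theta_inj x y : base (qv x) = base (qv y) -> qm x = qm y -> theta x = theta y -> x = y.
Proof.
move=> bxy mxy txy; have dxy : dv (qv x) = dv (qv y) by rewrite /dv bxy.
have exy : eps (qv x) = eps (qv y).
  have [oD|oD] := boolP (odd (dv (qv y))).
    by rewrite !theta_odd ?dxy // mxy txy.
  by rewrite !theta_even ?dxy // txy.
have sxy : vsign c x = vsign c y by rewrite !theta_sign dxy txy.
have [] := qvertex_sigma bxy exy; rewrite ?sxy ?mxy //.
  by rewrite !qcore_theta txy sxy dxy exy.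
by move=> *; apply: qvertex_eq.
Qed.

Lemma reach_half D n (s : bool) : (n < D)%N ->
  reach D (n + (if s then 0 else D)) = (if s then n else D.-1 - n)%N.
Proof. by rewrite /reach; case: s => nD; lia. Qed.

(** All cases of [rho] are one function of the mutation time. On the [-] copy of an even node
    [theta] is shifted by one, and passing from [i] to [istar i] compensates for this. *)
Lemma rho_reach x : rho c (qv x) (qi x) (qm x) = reach (dv (qv x)) (theta x).
Proof.
have iD := qi_range x; rewrite /theta addnAC reach_half; last first.
  have [oD|oD] := boolP (odd (dv (qv x))); first by rewrite addn0 qcore_lt.
  by apply: leq_trans (qcore_lt_even oD iD);
    rewrite ltnS /= -addn1 leq_add2l leq_b1.
have -> : rho c (qv x) (qi x) (qm x) =
    let i := if odd (dv (qv x)) || eps (qv x) then qi x else istar (qi x) in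
    let b := if odd (dv (qv x)) then eps (qv x) else isbeta (c (qv x)) in
    if b == odd (qm x) then (i - 1)%N else (dv (qv x) - i)%N.
  rewrite /rho; case: (odd (dv _)); first by case: eps; case: (odd (qm x)).
  by case: (c _); case: (odd (qm x)).
rewrite vsignE /qcore /istar oddD; move: (qi x) (dv _) iD => i D iD /=.
case: (odd D); case: (eps (qv x)); case: (isbeta (c (qv x)));
  case: (odd (qm x)); case: (odd i); rewrite /= ?eqxx ?eqb_id ?eqbF_neg /=; lia.
Qed.
(** Above [base w] there is a neighbour of [v] with the other third component, and it has the colour
    of [w]; in a nonbipartite block, colours determine third components. *)
Lemma nonbip_adj_del v w : dynkin C (base v) (base w) -> d (base v) = d (base w) ->
    eps v = eps w -> in_nonbip C d (base v) -> isbeta (c w) = ~~ isbeta (c v) ->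
  del v != del w.
Proof.
move=> vw dvw evw nv cvw; have ov := nonbip_even nv.
have wb : base w \in block C d (base v).
  by rewrite inE connect1 // /even_dynkin vw -dvw ov.
have nw : in_nonbip C d (base w) by rewrite (block_nonbip wb).
have [t [vt _]] := nbvertexE nv; apply/eqP => dd.
pose w' := nbvertex (eps v) (~~ t) nw.
have vw' : tadj v w'.
  rewrite /tadj vw /dv (negPf ov) /= eqxx nv wb vt /=.
  by rewrite /del /=; case: (t).
have := tadj_isbeta vw'; rewrite /dv -dvw => /(_ ov ov) cw'.
have := nonbip_colour (v := w') (w := w) erefl evw nw.
rewrite cw' cvw eqxx -dd vt /del /= => /esym/eqP[].
by case: (t).
Qed.

(** The rule on second components becomes a parity of labels, the one in the last two clauses of
    [lout]. *)
Lemma tadj_long x y : dynkin C (base (qv x)) (base (qv y)) ->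
    (1 < dv (qv x))%N -> dv (qv y) = 1%N ->
  tadj (qv x) (qv y) = odd (theta x + theta y + qm y + dv (qv x) * qm x).
Proof.
move=> xy dx dy.
have nb : in_nonbip C d (base (qv x)) && (base (qv y) \in block C d (base (qv x))) = false.
  apply/negbTE; apply/andP => -[/nonbip_even nx /block_even].
  by rewrite -/(dv (qv y)) dy (negPf nx).
rewrite /tadj xy nb dy /= andbT (theta_odd (x := y)) ?dy //.
have [ox|ox] := boolP (odd (dv (qv x))).
  rewrite /= theta_odd //; move: (theta x) (theta y) => tx ty.
  by rewrite !oddD oddM ox; do 4!case: odd.
rewrite /= theta_even //; move: (theta x) (theta y) => tx ty.
by rewrite !oddD oddM (negPf ox); do 3!case: odd.
Qed.

(** Arrows constrain copies, rows and third components, which labels do not show. For equal lengths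
    these are recovered from equal cores and known signs; for unequal ones, [tadj_long] and
    [rho_reach] translate the conditions directly. *)
Lemma arrow_lout x y : arrow c x y =
  lout C d (base (qv x)) (qm x) (theta x) (base (qv y)) (qm y) (theta y).
Proof.
have ix := qi_range x; have iy := qi_range y.
have sx := theta_sign x; have sy := theta_sign y.
have tx := theta_lt x; have ty := theta_lt y.
case: (d_cases cartan_dynkin_d (base (qv x)) (base (qv y))) =>
  [bxy|[bxy e]|[e dd]|[[e d1 d2]|[e d1 d2]]].
- have dxy : dv (qv x) = dv (qv y) by rewrite /dv bxy.
  have nadj : tadj (qv x) (qv y) = false by rewrite /tadj bxy /dynkin eqxx.
  have nadj' : tadj (qv y) (qv x) = false by rewrite /tadj bxy /dynkin eqxx.
  rewrite /arrow /tied nadj nadj' /= !orbF.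
  rewrite -bxy lout_same -/(dv (qv x)) sx sy; apply/idP/idP.
    move=> /and4P[/eqP vxy /eqP ixy mm /andP[s1 s2]]; apply/and3P; split=> //.
    by rewrite /theta sx sy s1 (negPf s2) vxy ixy addn0 addnAC.
  (* Since [theta] grows by [d] and [m] changes by 1, the second components agree for either parity
     of [d]. *)
  move=> /and3P[mm s1 /eqP tt];
    have s2 : (theta y < dv (qv y))%N = false by rewrite tt dxy; lia.
  have exy : eps (qv x) = eps (qv y).
    have [oD|oD] := boolP (odd (dv (qv y))).
      by rewrite !theta_odd ?dxy // tt; move: oD; rewrite dxy; lia.
    by rewrite !theta_even ?dxy // tt; move: oD; rewrite dxy; lia.
  have [||vxy ixy] := qvertex_sigma bxy exy.
  + rewrite !qcore_theta sx sy s1 s2 exy dxy; rewrite tt dxy; lia.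
  + by rewrite sx sy s1 s2; lia.
  by rewrite mm s1 s2 vxy ixy !eqxx.
- rewrite lout_far //; apply/negbTE; apply: contra e.
  have nv : qv x == qv y = false by apply: contraNF bxy => /eqP->.
  rewrite /arrow nv /= => /orP[/and3P[/and3P[]//]|].
  by case/orP => /andP[/and4P[/and3P[]]] //; rewrite cartan_dynkinC.
- have nv : qv x == qv y = false by apply: contraTF e => /eqP->;
  rewrite /dynkin eqxx.
  have -> : arrow c x y = [&& tadj (qv x) (qv y), qi x == qi y, qm x == qm y, ~~ vsign c x & vsign c y].
    have no1 : (1 < dv (qv x))%N && (dv (qv y) == 1%N) = false
      by rewrite /dv dd; lia.
    have no2 : (1 < dv (qv y))%N && (dv (qv x) == 1%N) = false
      by rewrite /dv dd; lia.
    rewrite /arrow /tied nv -[dv (qv x) == _]/(d _ == d _) dd eqxx /=.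
    have t1 : [&& tadj (qv x) (qv y), 1 < dv (qv x), dv (qv y) == 1
        & `|(qm y)%:Z - (dv (qv x) * qm x)%:Z| <= rho c (qv x) (qi x) (qm x)]%N = false.
      by rewrite [X in _ && X]andbA no1 andbF.
    have t2 : [&& tadj (qv y) (qv x), 1 < dv (qv y), dv (qv x) == 1
        & `|(qm x)%:Z - (dv (qv y) * qm y)%:Z| <= rho c (qv y) (qi y) (qm y)]%N = false.
      by rewrite [X in _ && X]andbA no2 andbF.
    by rewrite t1 t2 /= !orbF.
  rewrite lout_eqd //; have ddv : dv (qv x) = dv (qv y) by [].
  rewrite -/(dv (qv y)) sx sy; apply/idP/idP.
    move=> /and5P[xy /eqP ixy mm s1 s2]; apply/and3P; split=> //.
    rewrite /theta sx sy s2 (negPf s1) ixy ddv addn0.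
    have [oD|oD] := boolP (odd (dv (qv y))); first by rewrite !addn0.
    case/and3P: xy => _ + _; rewrite ddv (negPf oD) /= => /eqP->.
    by rewrite addnAC.
  move=> /and3P[/eqP mm s2 /eqP tt];
    have s1 : (theta x < dv (qv x))%N = false by rewrite tt ddv; lia.
  have ix' : (0 < qi x <= dv (qv y))%N by rewrite -ddv.
  (* With equal [m], a difference of [d] between the times means opposite copies for odd [d] and
     equal ones for even [d], as adjacency requires. *)
  have [oD|oD] := boolP (odd (dv (qv y))).
    have exy : eps (qv x) = ~~ eps (qv y).
      by rewrite !theta_odd ?ddv // tt mm; move: oD; lia.
    have cxy : qcore (dv (qv y)) (qi x) = qcore (dv (qv y)) (qi y).
      by rewrite -{1}ddv !qcore_theta sx sy s1 s2 tt ddv oD /=; lia.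
    have -> : qi x = qi y by apply: (qcore_inj ix' iy cxy); rewrite oD.
    rewrite mm s2 s1 !eqxx /tadj e ddv oD /= exy.
    have -> : in_nonbip C d (base (qv x)) = false.
      by apply: contraTF oD => /nonbip_even; rewrite -ddv.
    by case: (eps _).
  have exy : eps (qv x) = eps (qv y).
    by rewrite !theta_even ?ddv // tt; move: oD; lia.
  have cxy : qcore (dv (qv y)) (qi x) = qcore (dv (qv y)) (qi y).
    by rewrite -{1}ddv !qcore_theta sx sy s1 s2 tt ddv exy; lia.
  have sx' : (~~ odd (qi x + qm x) == isbeta (c (qv x))) = false.
    by rewrite -s1 -sx vsignE ddv (negPf oD).
  have sy' : (~~ odd (qi y + qm y) == isbeta (c (qv y))) = true.
    by rewrite -[RHS]s2 -sy vsignE (negPf oD).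
  have [nx|nx] := boolP (in_nonbip C d (base (qv x))).
    have yb : base (qv y) \in block C d (base (qv x)).
      by rewrite inE connect1 // /even_dynkin e -/(dv (qv x)) -/(dv (qv y)) ddv oD.
    have ny : in_nonbip C d (base (qv y)) by rewrite (block_nonbip yb).
    have iE : qi x = qi y.
      by apply: (qcore_inj ix' iy cxy); rewrite (qi_odd nx) (qi_odd ny) orbT.
    rewrite iE mm s1 s2 !eqxx /tadj e ddv (negPf oD) /= exy eqxx nx yb /= andbT.
    apply: nonbip_adj_del => //; move: sx' sy'; rewrite iE mm.
    by case: isbeta; case: isbeta; case: odd.
  have xy : tadj (qv x) (qv y)
    by rewrite /tadj e ddv (negPf oD) /= exy eqxx (negPf nx).
  have cc := tadj_isbeta xy; rewrite ddv in cc; have {}cc := cc oD oD.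
  have iE : qi x = qi y.
    apply: (qcore_inj ix' iy cxy); rewrite (negPf oD) /=.
    move: sx' sy'; rewrite cc mm !oddD.
    by case: isbeta; do 3!case: odd.
  by rewrite xy iE mm s1 s2 !eqxx.
- have nv : qv x == qv y = false by apply: contraTF e => /eqP->;
  rewrite /dynkin eqxx.
  rewrite lout_long // /arrow /tied nv -!/(dv (qv x)).
  rewrite -/(dv (qv x)) in d1; rewrite -/(dv (qv y)) in d2.
  rewrite d1 d2 tadj_long // rho_reach (gtn_eqF d1) ltnn !andbF !andFb orbF /= sy d2.
  by rewrite ltnS leqn0 andbC; congr (_ && _); rewrite andbC.
- have nv : qv x == qv y = false by apply: contraTF e => /eqP->;
  rewrite /dynkin eqxx.
  have e' : dynkin C (base (qv y)) (base (qv x)) by rewrite cartan_dynkinC.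
  rewrite lout_short // /arrow /tied nv -!/(dv (qv y)).
  rewrite -/(dv (qv y)) in d1; rewrite -/(dv (qv x)) in d2.
  rewrite (tadj_long e' d1 d2) !rho_reach sx d1 d2 (ltn_eqF d1) ltnn !andbF !andFb /=.
  rewrite d2 in tx; have -> : (theta x == 1%N) = ~~ (theta x < 1)%N by lia.
  by rewrite andbC [odd _ && _]andbC [(theta y + theta x)%N]addnC.
Qed.

Lemma absz_mod_eq D n (k : int) : (0 < D)%N -> (n < D.*2)%N ->
  (absz ((n%:Z - k) %% D.*2%:Z)%Z == 0%N) = (absz (k %% (2 * D)%:Z)%Z == n).
Proof.
move=> D0 nD; rewrite mul2n.
have D20 : D.*2%:Z != 0 by lia.
have kE := divz_eq k D.*2%:Z; have m0 := modz_ge0 k D20.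
apply/eqP/eqP => [e|e].
  have e0 : ((n%:Z - k) %% D.*2%:Z)%Z = 0 by lia.
  have := divz_eq (n%:Z - k) D.*2%:Z; rewrite e0 addr0 => e1.
  have -> : k = - ((n%:Z - k) %/ D.*2%:Z)%Z * D.*2%:Z + n%:Z
    by rewrite mulNr -e1; lia.
  by rewrite modzMDl modz_small //; lia.
have -> : n%:Z - k = - (k %/ D.*2%:Z)%Z * D.*2%:Z + 0 by rewrite mulNr -e; lia.
by rewrite modzMDl mod0z.
Qed.

Lemma in_M_theta k x : in_M c k x = (phase d (fun z : V =>
  base (qv z)) theta k x == 0%N).
Proof.
have iD := qi_range x; have D0 := dv_gt0 (qv x).
rewrite /in_M /phase -/(dv (qv x)).
have tD := theta_lt x.
have D20 : (2 * dv (qv x))%:Z != 0 by lia.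
have [oD|oD] := boolP (odd (dv (qv x))).
  rewrite absz_mod_eq // /theta oD /= addn0 /qcore.
  have pD := ltz_mod k D20; have p0 := modz_ge0 k D20.
  have : (absz (k %% (2 * dv (qv x))%:Z)%Z < 2 * dv (qv x))%N by lia.
  move: (absz _) => p {pD p0}.
  move: (dv _) (qi x) iD oD {D20 D0 tD} => D i iD oD pD.
  case: vsign; case: ifP => p1; case: ifP => p2; case: ifP => i1;
    rewrite ?andTb ?andFb /=; lia.
set k' := if eps _ then k else k - 1.
set t' := (qcore (dv (qv x)) (qi x) + (if vsign c x then 0 else dv (qv x)))%N.
(* The delay by one of the [-] copy is the last summand of [theta]. *)
have tt : (theta x)%:Z - k = t'%:Z - k' by rewrite /theta /k' oD -/t' /=;
  case: eps; lia.
have t'D : (t' < (dv (qv x)).*2)%N by apply: leq_ltn_trans tD;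
  rewrite /theta leq_addr.
rewrite tt absz_mod_eq //.
have pD := ltz_mod k' D20; have p0 := modz_ge0 k' D20.
have : (absz (k' %% (2 * dv (qv x))%:Z)%Z < 2 * dv (qv x))%N by lia.
rewrite {tt t'D} /t' /qcore {t'}.
move: (absz _) => p {pD p0}.
move: (dv _) (qi x) iD oD {D20 D0 tD k'} => D i iD oD pD.
have [op|op] := boolP (odd p); have [p1|p1] := ltnP p D;
  have [oi|oi] := boolP (odd i); case: vsign; rewrite /=; lia.
Qed.

Lemma qvertex_intro (v : tvertex C d) i m : inN v i -> (0 < m < tv v * l)%N ->
  exists x : V, [/\ qv x = v, qi x = i & qm x = m].
Proof.
move=> iv mv; have iD : (0 < i <= dv v)%N by case/andP: iv.
have dt : (dv v <= tlcm d)%N by rewrite dvdn_leq ?tlcm_gt0 ?d_dvd_tlcm.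
have il : (i < (tlcm d).+1)%N by lia.
have ml : (m < tlcm d * l)%N.
  case/andP: mv => _ mv; apply: leq_trans mv _; rewrite leq_mul2r.
  by rewrite -(d_tquo (base v)) leq_pmull ?orbT // cartan_d_gt0.
have ok : inN v (Ordinal il) && (0 < Ordinal ml < tv v * l)%N by rewrite iv.
by exists (exist _ (v, Ordinal il, Ordinal ml) ok).
Qed.

(** The parity of [n], together with that of [m] for odd [d a], gives the copy; the half-period
    gives the sign, and the rest of [n] is the core [w] of the row. *)
Lemma theta_surj a m n : (0 < m < tquo d a * l)%N -> (n < (d a).*2)%N ->
  exists x : V, [/\ base (qv x) = a, qm x = m & theta x = n].
Proof.
move=> mN nD; have da := cartan_d_gt0 a.
have [na|na] := boolP (in_nonbip C d a).
  have oD := nonbip_even na; pose n' := (n - odd n)%N.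
  pose w := (if (n < d a)%N then n' else n' - d a)%N.
  (* The row is odd here, so the required sign imposes a colour; one of the two third components has
     it. *)
  have [t ct] : exists t, isbeta (c (nbvertex (~~ odd n) t na)) = ((n < d a)%N == odd m).
    pose b := isbeta (c (nbvertex (~~ odd n) true na)).
    exists (b == ((n < d a)%N == odd m)); case e: (b == _); first exact/eqP.
    by rewrite -[false]/(~~ true) nbvertex_flip -/b; move: e; case: (b);
      case: (_ == odd m).
  have wD : (w < d a)%N by rewrite /w /n'; case: ifP => n1; lia.
  have wo : ~~ odd w by rewrite /w /n'; case: ifP => n1; lia.
  have iv : inN (nbvertex (~~ odd n) t na) w.+1.
    by rewrite /inN /dv /base /= wD na wo.
  have [x [xv xi xm]] := qvertex_intro iv mN.
  exists x; rewrite xv xm; split=> //.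
  have vs := vsignE x; rewrite xi xm xv /dv /base /= (negPf oD) ct in vs.
  have {}vs : vsign c x = (n < d a)%N.
    rewrite vs negbK oddD (negPf wo) /=.
    by case: (odd m); case: (n < d a)%N.
  rewrite /theta vs xi xv /dv /base /eps /= oD /qcore /= wo negbK.
  by rewrite /w /n'; case: ifP => n1; lia.
have okv (s : bool) : isSome (None : option bool) == in_nonbip C d (a, s).1.
  by rewrite /= (negPf na).
pose v s : tvertex C d := exist _ (a, s, None) (okv s).
have [oD|oD] := boolP (odd (d a)).
  pose w := (if (n < d a)%N then n else n - d a)%N.
  pose i := if odd w then (d a - w)%N else w.+1.
  have wD : (w < d a)%N by rewrite /w; case: ifP => n1; lia.
  have ow : odd w = (odd n == (n < d a)%N).
    by rewrite /w; case: (ltnP n (d a)) => n1; lia.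
  have io : odd i = ~~ odd w.
    by rewrite /i; case: ifP => o /=; rewrite ?o // oddB 1?ltnW // oD o.
  have iv : inN (v (odd (m + n))) i.
    by rewrite /inN /dv /base /= (negPf na) andbT /i; case: ifP => o; lia.
  have [x [xv xi xm]] := qvertex_intro iv mN.
  exists x; rewrite xv xm; split=> //.
  have vs : vsign c x = (n < d a)%N.
    rewrite vsignE xi xm xv /dv /base /eps /= oD !oddD io ow.
    by case: (odd m); case: (odd n); case: (n < d a)%N.
  have cw : qcore (d a) i = w.
    by rewrite /qcore io /i; case: (odd w); rewrite //= subKn // ltnW.
  rewrite /theta vs xi xv /dv /base /eps /= oD cw /w.
  by case: ifP => n1; lia.
pose n' := (n - odd n)%N; pose w := (if (n < d a)%N then n' else n' - d a)%N.
pose b := isbeta (c (v (~~ odd n))).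
(* Two rows of opposite parity have the core [w]; the colour and the required sign select one of
   them. *)
pose i := if ((n < d a)%N == b) == odd m then w.+1 else (d a - w)%N.
have wD : (w < d a)%N by rewrite /w /n'; case: ifP => n1; lia.
have wo : ~~ odd w by rewrite /w /n'; case: ifP => n1; lia.
have io : odd i = (((n < d a)%N == b) == odd m).
  by rewrite /i; case: ifP => e /=;
    rewrite ?wo // oddB 1?ltnW // (negPf oD) (negPf wo).
have iv : inN (v (~~ odd n)) i.
  by rewrite /inN /dv /base /= (negPf na) andbT /i; case: ifP => e; lia.
have [x [xv xi xm]] := qvertex_intro iv mN.
exists x; rewrite xv xm; split=> //.
have vs : vsign c x = (n < d a)%N.
  rewrite vsignE xi xm xv /dv /base /= (negPf oD) -/b oddD io.
  by case: (odd m); case: (n < d a)%N; case: (b).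
have cw : qcore (d a) i = w.
  by rewrite /qcore io /i; case: (_ == odd m); rewrite //= subKn // ltnW.
have n'E : (n' + odd n = n)%N by rewrite subnK //; case: (n) => // k; case: odd.
rewrite /theta vs xi xv /dv /base /eps /= oD cw negbK /w.
case: (ltnP n (d a)) => n1; first by rewrite addn0.
by rewrite subnK // /n'; move: (d a) oD n1 => D; case: (boolP (odd n)); lia.
Qed.

End Phases.

End Colours.
End CartanFacts.

Theorem theorem7p2 (r : nat) (C : 'M[int]_r) (d : 'I_r -> nat) (l : nat)
    (C_cartan : cartan C) (d_symm : symmetrizer C d)
    (C_tame : tamely_laced C d) (C_indec : indecomposable C)
    (X'_nonbip : ~ bipartite (shrunk_dynkin C d)) (l_ge2 : (2 <= l)%N)
    (c : tvertex C d -> colour) (c_proper : proper_colouring c) :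
  ring_isomorphic (T_ring_pos C d l)
    (T_subalgebra (quiver_matrix l c) (mut_set l c)) /\
  group_isomorphic (Y_group C d l)
    (Y_subgroup (quiver_matrix l c) (mut_set l c)).
Proof.
pose vb (x : qvertex C d l) := base (qv x).
pose vm (x : qvertex C d l) := qm x.
pose vt (x : qvertex C d l) := theta c x.
have d_gt0 := cartan_d_gt0 d_symm.
have dynC := cartan_dynkinC C_cartan.
have dyn_d := cartan_dynkin_d C_cartan d_symm C_tame.
have N_d a b : (d a * (tquo d a * l) = d b * (tquo d b * l))%N.
  by rewrite !mulnA !d_tquo.
have vt_lt (x : qvertex C d l) : (vt x < (d (vb x)).*2)%N by apply: theta_lt.
have -> : quiver_matrix l c = qB C d vb vm vt 0.
  apply/funext => x; apply/funext => y;
    rewrite /quiver_matrix /qB /lB !phase0 //.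
  by rewrite !(arrow_lout C_cartan d_symm C_tame c_proper).
have -> : mut_set l c = Mset d vb vt.
  by apply/funext => k; apply/setP => x; rewrite !inE (in_M_theta d_symm).
by split; [apply: T_iso | apply: Y_iso] => //;
  first [exact: qm_range | exact: theta_inj | exact: theta_surj].
Qed.
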